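(* Let $A$ be a commutative (non-positive) DG-ring, and suppose that $A$ has bounded cohomology and that the commutative ring $\mathrm{H}^0(A)$ is noetherian. Let $S : \mathsf{D}(\mathrm{H}^0(A)) \to \mathsf{D}(A)$ be the forgetful functor, and let $M, N \in \mathsf{D}(\mathrm{H}^0(A))$. Then: (1) $S(M)\otimes^{\mathrm{L}}_A S(N) \cong 0$ if and only if $M \otimes^{\mathrm{L}}_{\mathrm{H}^0(A)} N \cong 0$. (2) $\mathrm{R}\operatorname{Hom}_A(S(M),S(N)) \cong 0$ if and only if $\mathrm{R}\operatorname{Hom}_{\mathrm{H}^0(A)}(M,N) \cong 0$.
   Context: Gradings are cohomological. A non-positive DG-ring $A = \bigoplus_{n=-\infty}^0 A^n$ is a graded (unital, associative) ring with a differential $d : A \to A$ of degree $+1$ satisfying the graded Leibniz rule; all DG-rings here are non-positive. A DG-ring $A$ is commutative if it is graded-commutative and every homogeneous element $a$ of odd degree satisfies $a^2 = 0$. $A$ has bounded cohomology if $\mathrm{H}^n(A) = 0$ for all $n \ll 0$. $\mathsf{D}(A)$ is the unbounded derived category of DG-modules over $A$. The forgetful functor $S$ is restriction of scalars along the natural map of DG-rings $A \to \mathrm{H}^0(A)$. *)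

(* Defs.v *)
From HB Require Import structures.
From mathcomp Require Import all_boot all_order all_algebra.
From mathcomp Require Import boolp functions.
From mathcomp Require Import freeg zify.

Set Implicit Arguments.
Unset Strict Implicit.
Unset Printing Implicit Defensive.

Import Order.TTheory GRing.Theory Num.Theory.
Local Open Scope ring_scope.

(* (-1)^n x *)
Definition ksgn (V : zmodType) (n : int) (x : V) : V :=
  if odd `|n|%N then - x else x.

Lemma odd_abszM (m n : int) : odd `|(m * n)%R|%N = odd `|m|%N && odd `|n|%N.
Proof. by rewrite abszM oddM. Qed.

Lemma odd_abszD (m n : int) : odd `|(m + n)%R|%N = odd `|m|%N (+) odd `|n|%N.
Proof. by lia. Qed.

Lemma ksgn0 (V : zmodType) n : ksgn n (0 : V) = 0.
Proof. by rewrite /ksgn oppr0 if_same. Qed.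

Lemma ksgnD (V : zmodType) n (x y : V) : ksgn n (x + y) = ksgn n x + ksgn n y.
Proof. by rewrite /ksgn; case: ifP; rewrite ?opprD. Qed.

Lemma raddf_ksgn (U V : zmodType) (f : {additive U -> V}) n x :
  f (ksgn n x) = ksgn n (f x).
Proof. by rewrite /ksgn; case: ifP; rewrite ?raddfN. Qed.

Lemma scaler_ksgn (R : pzRingType) (V : lmodType R) n (a : R) (x : V) :
  a *: ksgn n x = ksgn n (a *: x).
Proof. by rewrite /ksgn; case: ifP; rewrite ?scalerN. Qed.

Lemma scale_ksgn (R : pzRingType) (V : lmodType R) n (a : R) (x : V) :
  ksgn n a *: x = ksgn n (a *: x).
Proof. by rewrite /ksgn; case: ifP; rewrite ?scaleNr. Qed.

Definition mk_additive (U V : zmodType) (f : U -> V) (fB : zmod_morphism f) :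
  {additive U -> V} := HB.pack f (GRing.isZmodMorphism.Build U V f fB).

Lemma zmod_morphD (U V : zmodType) (f : U -> V) :
  {morph f : x y / x + y} -> zmod_morphism f.
Proof.
move=> fD x y; apply: (addIr (f y)); rewrite -fD !subrK //.
Qed.

(* V = (+)_n V^n, where V^n is the image of the projection [gcomp n]. *)
Record grading (V : zmodType) := Grading {
  gcomp : int -> {additive V -> V};
  gcompK : forall m n x, gcomp m (gcomp n x) = if m == n then gcomp n x else 0;
  gcomp_sum : forall x,
    exists2 s : seq int, uniq s & x = \sum_(n <- s) gcomp n x }.

Definition homog (V : zmodType) (X : grading V) (n : int) (x : V) : Prop :=
  gcomp X n x = x.

Record dgStruct (V : zmodType) := DGStruct {
  dg_grading :> grading V;
  dif : {additive V -> V};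
  dif_homog : forall n x,
    homog dg_grading n x -> homog dg_grading (n + 1) (dif x);
  difK : forall x, dif (dif x) = 0 }.

Lemma sum_cover (I : eqType) (V : zmodType) (F : I -> V) (s t : seq I) :
  uniq s -> uniq t -> (forall i, F i != 0 -> i \in s) ->
  (forall i, F i != 0 -> i \in t) -> \sum_(i <- s) F i = \sum_(i <- t) F i.
Proof.
move=> us ut hs ht.
have cut u : \sum_(i <- u) F i = \sum_(i <- [seq i <- u | F i != 0]) F i.
  rewrite big_filter [LHS](bigID (fun i => F i != 0)) /= addrC big1 ?add0r //.
  by move=> i /negPn/eqP.
rewrite cut [RHS]cut; apply/perm_big/uniq_perm; rewrite ?filter_uniq //.
move=> i; rewrite !mem_filter; case: (boolP (F i != 0)) => //= Fi.
by rewrite hs ?ht.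
Qed.

Lemma sum_cover_decompD (V : zmodType) (c : int -> {additive V -> V})
    (cK : forall m n x, c m (c n x) = if m == n then c n x else 0) x y :
  (exists2 s : seq int, uniq s & x = \sum_(n <- s) c n x) ->
  (exists2 s : seq int, uniq s & y = \sum_(n <- s) c n y) ->
  exists2 s : seq int, uniq s & x + y = \sum_(n <- s) c n (x + y).
Proof.
have cov z s : uniq s -> z = \sum_(n <- s) c n z -> forall i, c i z != 0 -> i \in s.
  move=> us zE i; apply: contraR => iNs; rewrite zE raddf_sum big1_seq // => j /= js.
  by rewrite cK; case: eqP => // ij; rewrite ij js in iNs.
move=> [s us xE] [t ut yE]; exists (undup (s ++ t)); first exact: undup_uniq.
rewrite (eq_bigr (fun n => c n x + c n y)); last by move=> n _; rewrite raddfD.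
rewrite big_split /=; congr (_ + _).
  rewrite {1}xE; apply: sum_cover; rewrite ?undup_uniq //; first exact: cov.
  by move=> i /(cov _ _ us xE) h; rewrite mem_undup mem_cat h.
rewrite {1}yE; apply: sum_cover; rewrite ?undup_uniq //; first exact: cov.
by move=> i /(cov _ _ ut yE) h; rewrite mem_undup mem_cat h orbT.
Qed.

Section GradedSum.
Variables (V : zmodType) (X : grading V).

Lemma homog0 n : homog X n 0. Proof. by rewrite /homog raddf0. Qed.

Lemma homogB n x y : homog X n x -> homog X n y -> homog X n (x - y).
Proof. by rewrite /homog raddfB => -> ->. Qed.

Lemma homogD n x y : homog X n x -> homog X n y -> homog X n (x + y).
Proof. by rewrite /homog raddfD => -> ->. Qed.

Lemma homog_ksgn n k x : homog X n x -> homog X n (ksgn k x).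
Proof. by rewrite /homog raddf_ksgn => ->. Qed.

Lemma homog_gcomp n x : homog X n (gcomp X n x).
Proof. by rewrite /homog gcompK eqxx. Qed.

Lemma gcomp_homog m n x : homog X m x -> gcomp X n x = if n == m then x else 0.
Proof. by move=> hx; rewrite -{1}hx gcompK hx. Qed.

Lemma homog_ind (K : V -> Prop) :
  (forall x y, K x -> K y -> K (x + y)) -> (forall n x, homog X n x -> K x) ->
  forall x, K x.
Proof.
move=> KD Kh x; have [s _ ->] := gcomp_sum X x.
elim/big_ind: _ => //; first exact: (Kh 0 0 (homog0 0)).
by move=> n _; apply: Kh (homog_gcomp n x).
Qed.

Definition gsupp (x : V) : seq int := s2val (cid2 (gcomp_sum X x)).

Lemma gsupp_uniq x : uniq (gsupp x).
Proof. by rewrite /gsupp; case: cid2. Qed.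

Lemma gsuppE x : x = \sum_(n <- gsupp x) gcomp X n x.
Proof. by rewrite /gsupp; case: cid2. Qed.

Lemma mem_gsupp x i : gcomp X i x != 0 -> i \in gsupp x.
Proof.
apply: contraR => iNs; rewrite (gsuppE x) raddf_sum big1_seq // => j /= js.
by rewrite gcompK; case: eqP => // ij; rewrite ij js in iNs.
Qed.

Variables (W : zmodType) (f : int -> V -> W).

(* the map sum_n f_n : (+)_n V^n -> W *)
Definition gsum (x : V) : W := \sum_(n <- gsupp x) f n (gcomp X n x).

Hypothesis fD : forall n, {morph f n : x y / x + y}.

Lemma gsum_f0 n : f n 0 = 0.
Proof. by apply: (addIr (f n 0)); rewrite -fD !add0r. Qed.

Lemma gsum_cover x s : uniq s -> (forall i, gcomp X i x != 0 -> i \in s) ->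
  gsum x = \sum_(n <- s) f n (gcomp X n x).
Proof.
move=> us hs; apply: sum_cover => // [|i|i]; first exact: gsupp_uniq.
  by move=> h; apply: mem_gsupp; apply: contra_neq h => ->; rewrite gsum_f0.
by move=> h; apply: hs; apply: contra_neq h => ->; rewrite gsum_f0.
Qed.

Lemma gsumD : {morph gsum : x y / x + y}.
Proof.
move=> x y; set s := undup (gsupp x ++ gsupp y ++ gsupp (x + y)).
have us : uniq s by exact: undup_uniq.
rewrite !(gsum_cover us) => [|i h|i h|i h].
- by rewrite -big_split; apply: eq_bigr => i _; rewrite raddfD fD.
- by rewrite mem_undup !mem_cat (mem_gsupp h) orbT.
- by rewrite mem_undup !mem_cat (mem_gsupp h).
- by rewrite mem_undup !mem_cat (mem_gsupp h) !orbT.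
Qed.

Lemma gsum_homog n x : homog X n x -> gsum x = f n x.
Proof.
move=> hx; rewrite (@gsum_cover _ [:: n]) ?big_seq1 ?hx // => i.
by rewrite (gcomp_homog _ hx) inE; case: (i == n) => //; rewrite eqxx.
Qed.

End GradedSum.

Section Cohomology.
Variables (V : zmodType) (X : dgStruct V) (n : int).

Definition is_cocycle : {pred V} := [pred x | `[< homog X n x /\ dif X x = 0 >]].

Lemma is_cocycleP x : reflect (homog X n x /\ dif X x = 0) (x \in is_cocycle).
Proof. exact: asboolP. Qed.

Lemma is_cocycle_closed : zmod_closed is_cocycle.
Proof.
split; first by apply/is_cocycleP; rewrite /homog !raddf0.
move=> x y /is_cocycleP[hx dx] /is_cocycleP[hy dy]; apply/is_cocycleP.
by split; [exact: homogB | rewrite raddfB dx dy subrr].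
Qed.
HB.instance Definition _ := GRing.isZmodClosed.Build V is_cocycle is_cocycle_closed.

Record cocycle := Cocycle { cocycle_val : V; _ : cocycle_val \in is_cocycle }.
HB.instance Definition _ := [isSub for cocycle_val].
HB.instance Definition _ := [Choice of cocycle by <:].
HB.instance Definition _ := [SubChoice_isSubZmodule of cocycle by <:].

Lemma cocycleP (z : cocycle) : homog X n (val z) /\ dif X (val z) = 0.
Proof. exact/is_cocycleP/(valP z). Qed.

Definition is_coboundary : {pred cocycle} :=
  [pred z : cocycle | `[< exists2 y, homog X (n - 1) y & val z = dif X y >]].

Lemma is_coboundaryP (z : cocycle) :
  reflect (exists2 y, homog X (n - 1) y & val z = dif X y) (z \in is_coboundary).
Proof. exact: asboolP. Qed.

Lemma is_coboundary_closed : zmod_closed is_coboundary.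
Proof.
split; first by apply/is_coboundaryP; exists 0; rewrite /homog ?raddf0.
move=> x y /is_coboundaryP[u hu xu] /is_coboundaryP[v hv yv].
apply/is_coboundaryP; exists (u - v); first exact: homogB.
by rewrite [RHS]raddfB -xu -yv.
Qed.
HB.instance Definition _ :=
  GRing.isZmodClosed.Build cocycle is_coboundary is_coboundary_closed.

Definition cohom := Quotient.quot is_coboundary.
HB.instance Definition _ := GRing.Zmodule.on cohom.

Definition cohom_class : {additive cocycle -> cohom} :=
  \pi_(Quotient.quot is_coboundary)%qT.

Lemma cohom_class_surj (x : cohom) : exists z, x = cohom_class z.
Proof. by exists (repr x); rewrite /= reprK. Qed.

Lemma cohom_classP (z w : cocycle) : cohom_class z = cohom_class w <->
  exists2 y, homog X (n - 1) y & val z - val w = dif X y.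
Proof.
split=> [/eqP|h]; last apply/eqP.
  by rewrite -Quotient.idealrBE => /is_coboundaryP.
by rewrite -Quotient.idealrBE; apply/is_coboundaryP.
Qed.

End Cohomology.

Record dgRing := DGRing {
  dgr_sort :> pzRingType;
  dgr_str : dgStruct dgr_sort;
  dgr_homog1 : homog dgr_str 0 1;
  dgr_homogM : forall m n a b,
    homog dgr_str m a -> homog dgr_str n b -> homog dgr_str (m + n) (a * b);
  dgr_leibniz : forall m a b, homog dgr_str m a ->
    dif dgr_str (a * b) = dif dgr_str a * b + ksgn m (a * dif dgr_str b);
  dgr_nonpos : forall n a, 0 < n -> homog dgr_str n a -> a = 0 }.

Record cdgRing := CDGRing {
  cdgr_sort :> dgRing;
  cdgr_comm : forall m n (a b : cdgr_sort),
    homog (dgr_str cdgr_sort) m a -> homog (dgr_str cdgr_sort) n b ->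
    a * b = ksgn (m * n) (b * a);
  cdgr_odd : forall m (a : cdgr_sort),
    homog (dgr_str cdgr_sort) m a -> odd `|m|%N -> a ^+ 2 = 0 }.

Record dgRingHom (A B : dgRing) := DGRingHom {
  dgrh_fun :> {rmorphism A -> B};
  dgrh_homog : forall n a,
    homog (dgr_str A) n a -> homog (dgr_str B) n (dgrh_fun a);
  dgrh_dif : forall a, dgrh_fun (dif (dgr_str A) a) = dif (dgr_str B) (dgrh_fun a) }.

Record dgMod (A : dgRing) := DGMod {
  dgm_sort :> lmodType A;
  dgm_str : dgStruct dgm_sort;
  dgm_homogZ : forall m n (a : A) x, homog (dgr_str A) m a ->
    homog dgm_str n x -> homog dgm_str (m + n) (a *: x);
  dgm_leibniz : forall m (a : A) x, homog (dgr_str A) m a ->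
    dif dgm_str (a *: x) = dif (dgr_str A) a *: x + ksgn m (a *: dif dgm_str x) }.

Record dgHom (A : dgRing) (M N : dgMod A) := DGHom {
  dgh_fun :> {linear M -> N};
  dgh_homog : forall n x,
    homog (dgm_str M) n x -> homog (dgm_str N) n (dgh_fun x);
  dgh_dif : forall x, dgh_fun (dif (dgm_str M) x) = dif (dgm_str N) (dgh_fun x) }.

Lemma gcompZ (A : dgRing) (M : dgMod A) k n (a : A) (x : M) :
  homog (dgr_str A) k a ->
  gcomp (dgm_str M) n (a *: x) = a *: gcomp (dgm_str M) (n - k) x.
Proof.
move=> ha; elim/(homog_ind (X := dgm_str M)): x => [x y IHx IHy|m x hx].
  by rewrite scalerDr [LHS]raddfD IHx IHy raddfD scalerDr.
rewrite (gcomp_homog _ (dgm_homogZ ha hx)) (gcomp_homog _ hx).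
have -> : (n - k == m) = (n == k + m) by lia.
by case: eqP; rewrite ?scaler0.
Qed.

Section CohomMap.
Variables (A : dgRing) (M N : dgMod A) (f : dgHom M N) (n : int).

Lemma cocycle_map_subproof (z : cocycle (dgm_str M) n) :
  f (val z) \in is_cocycle (dgm_str N) n.
Proof.
have [hz dz] := cocycleP z; apply/is_cocycleP; split; first exact: dgh_homog.
by rewrite -dgh_dif dz raddf0.
Qed.

Definition cocycle_map (z : cocycle (dgm_str M) n) : cocycle (dgm_str N) n :=
  Cocycle (cocycle_map_subproof z).

Definition cohom_map (x : cohom (dgm_str M) n) : cohom (dgm_str N) n :=
  cohom_class _ _ (cocycle_map (repr x)).

Lemma cohom_mapE z :
  cohom_map (cohom_class _ _ z) = cohom_class _ _ (cocycle_map z).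
Proof.
apply/cohom_classP; have : cohom_class _ _ (repr (cohom_class _ _ z)) = cohom_class _ _ z.
  by rewrite /= reprK.
move=> /cohom_classP[y hy zy]; exists (f y); first exact: dgh_homog.
by rewrite -dgh_dif -zy raddfB.
Qed.

End CohomMap.
Arguments cohom_map {A M N} f n x.

Definition quasi_iso (A : dgRing) (M N : dgMod A) (f : dgHom M N) : Prop :=
  forall n, bijective (cohom_map f n).

Definition acyclic (A : dgRing) (M : dgMod A) : Prop :=
  forall n (x : cohom (dgm_str M) n), x = 0.

(* The objects of D(A) are the DG-modules over A; two of them are isomorphic in
   D(A) iff they are joined by a roof of quasi-isomorphisms. *)
Definition D_iso (A : dgRing) (M N : dgMod A) : Prop :=
  exists (Z : dgMod A) (f : dgHom Z M) (g : dgHom Z N), quasi_iso f /\ quasi_iso g.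

Section ZeroModule.
Variable A : dgRing.

Lemma zero_grading_subproof1 m n (x : 'rV[A]_0) :
  idfun (idfun x) = if m == n :> int then idfun x else 0.
Proof. by case: ifP => // _; exact: thinmx0. Qed.

Lemma zero_grading_subproof2 (x : 'rV[A]_0) :
  exists2 s : seq int, uniq s & x = \sum_(n <- s) idfun x.
Proof. by exists [::]; rewrite // big_nil; exact: thinmx0. Qed.

Definition zero_grading : grading 'rV[A]_0 :=
  @Grading _ (fun=> idfun) zero_grading_subproof1 zero_grading_subproof2.

Definition zero_str : dgStruct 'rV[A]_0.
Proof.
by apply: (@DGStruct _ zero_grading \0) => // n x _; rewrite /homog raddf0.
Defined.

Definition D_zero : dgMod A.
Proof.
apply: (@DGMod A 'rV[A]_0 zero_str) => // m a x _.
by rewrite [LHS]thinmx0 [RHS]thinmx0.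
Defined.

End ZeroModule.

Section Restriction.
Variables (A B : dgRing) (phi : dgRingHom A B) (M : dgMod B).

Definition restr_sort : Type := dgm_sort M.
HB.instance Definition _ := GRing.Zmodule.on restr_sort.

Definition restr_scale (a : A) (x : restr_sort) : restr_sort := phi a *: (x : M).

Lemma restr_scaleA a b x : restr_scale a (restr_scale b x) = restr_scale (a * b) x.
Proof. by rewrite /restr_scale scalerA rmorphM. Qed.
Lemma restr_scale1 : left_id 1 restr_scale.
Proof. by move=> x; rewrite /restr_scale rmorph1 scale1r. Qed.
Lemma restr_scaleDr : right_distributive restr_scale +%R.
Proof. by move=> a x y; rewrite /restr_scale scalerDr. Qed.
Lemma restr_scaleDl x : {morph restr_scale^~ x : a b / a + b}.
Proof. by move=> a b; rewrite /restr_scale rmorphD scalerDl. Qed.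

HB.instance Definition _ := GRing.Zmodule_isLmodule.Build A restr_sort
  restr_scaleA restr_scale1 restr_scaleDr restr_scaleDl.

Definition restr_scalars : dgMod A.
Proof.
apply: (@DGMod A restr_sort (dgm_str M)) => [m n a x ha|m a x ha].
  exact/dgm_homogZ/dgrh_homog.
have := dgm_leibniz x (dgrh_homog phi ha).
by rewrite -dgrh_dif.
Defined.

End Restriction.

(* a commutative ring, as a DG-ring concentrated in degree 0 *)
Section ConcentratedRing.
Variable R : comPzRingType.

Definition conc_comp (n : int) : {additive R -> R} :=
  if n == 0 then (idfun : {additive R -> R}) else (\0 : {additive R -> R}).

Lemma conc_compE n x : conc_comp n x = if n == 0 then x else 0.
Proof. by rewrite /conc_comp; case: ifP. Qed.

Lemma conc_compK m n x :
  conc_comp m (conc_comp n x) = if m == n then conc_comp n x else 0.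
Proof.
rewrite !conc_compE; case: (n =P 0) => [->|_]; last by rewrite !if_same.
by case: (m == 0).
Qed.

Lemma conc_comp_sum x :
  exists2 s : seq int, uniq s & x = \sum_(n <- s) conc_comp n x.
Proof. by exists [:: 0]; rewrite // big_seq1. Qed.

Definition conc_str : dgStruct R.
Proof.
apply: (@DGStruct _ (Grading conc_compK conc_comp_sum) \0) => // n x _.
exact: homog0.
Defined.

Lemma homog_conc n (x : R) : homog conc_str n x <-> (n = 0 \/ x = 0).
Proof.
rewrite /homog /= conc_compE; case: eqP => [->|n0]; split=> //; first by left.
- by right.
- by case.
Qed.

Definition conc_dgRing : dgRing.
Proof.
apply: (@DGRing R conc_str).
- by apply/homog_conc; left.
- move=> m n a b /homog_conc ha /homog_conc hb; apply/homog_conc.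
  case: ha => [->|->]; last by right; rewrite mul0r.
  by case: hb => [->|->]; [left | right; rewrite mulr0].
- by move=> m a b _; rewrite /= mul0r mulr0 /ksgn oppr0 if_same addr0.
- by move=> n a n0 /homog_conc[n0'|//]; rewrite n0' ltxx in n0.
Defined.

Definition conc : cdgRing.
Proof.
apply: (@CDGRing conc_dgRing) => [m n a b|m a].
  move=> /homog_conc[->|->] /homog_conc[->|->] /=.
  - by rewrite mulr0 /ksgn /= mulrC.
  - by rewrite !(mul0r, mulr0) ksgn0.
  - by rewrite !(mul0r, mulr0) ksgn0.
  - by rewrite !(mul0r, mulr0) ksgn0.
by move=> /homog_conc[->|->] // _; rewrite expr0n.
Defined.

End ConcentratedRing.

Section H0.
Variable A : cdgRing.
Local Notation str := (dgr_str A).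
Local Notation Z0 := (cocycle str 0).
Local Notation cls := (cohom_class str 0).

Lemma dif_homog0 (a : A) : homog str 0 a -> dif str a = 0.
Proof. by move=> /dif_homog; apply: dgr_nonpos. Qed.

Lemma Z0_subproof (a : A) : homog str 0 a -> a \in is_cocycle str 0.
Proof. by move=> ha; apply/is_cocycleP; split => //; exact: dif_homog0. Qed.

Lemma Z0_homog (z : Z0) : homog str 0 (val z).
Proof. by have [] := cocycleP z. Qed.

Definition Z0_of (a : A) (ha : homog str 0 a) : Z0 := Cocycle (Z0_subproof ha).

Definition Z0_one : Z0 := Z0_of (dgr_homog1 A).
Definition Z0_mul (z w : Z0) : Z0 := Z0_of (dgr_homogM (Z0_homog z) (Z0_homog w)).

Definition H0 : Type := cohom str 0.
HB.instance Definition _ := GRing.Zmodule.on H0.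

Definition H0_one : H0 := cls Z0_one.
Definition H0_mul (x y : H0) : H0 := cls (Z0_mul (repr x) (repr y)).

Lemma Z0_comm (z w : Z0) : val z * val w = val w * val z.
Proof. by rewrite (cdgr_comm (Z0_homog z) (Z0_homog w)). Qed.

Lemma H0_mulE z w : H0_mul (cls z) (cls w) = cls (Z0_mul z w).
Proof.
have eqv u : exists2 y, homog str (0 - 1) y & val (repr (cls u)) - val u = dif str y.
  by apply/cohom_classP; rewrite /= reprK.
have [y hy zy] := eqv z; have [t ht wt] := eqv w.
set z' := repr (cls z) in zy *; set w' := repr (cls w) in wt *.
have ez : val z' = val z + dif str y by rewrite -zy addrC subrK.
have ew : val w' = val w + dif str t by rewrite -wt addrC subrK.
have hz := Z0_homog z; have hw' := Z0_homog w'.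
apply/cohom_classP; exists (y * val w' + val z * t).
  apply: homogD; first by have := dgr_homogM hy hw'; rewrite addr0.
  exact: dgr_homogM hz ht.
rewrite raddfD /= (dgr_leibniz _ hy) (dgr_leibniz _ hz) (dif_homog0 hz).
rewrite (dif_homog0 hw') mulr0 ksgn0 addr0 mul0r add0r /ksgn /=.
by rewrite ez mulrDl ew mulrDr addrAC [val z * val w + _]addrC addrK addrC.
Qed.

Lemma H0_mulA : associative H0_mul.
Proof.
move=> x y z; have [a ->] := cohom_class_surj x.
have [b ->] := cohom_class_surj y; have [c ->] := cohom_class_surj z.
by rewrite !H0_mulE; congr (cls _); apply: val_inj; rewrite /= mulrA.
Qed.

Lemma H0_mulC : commutative H0_mul.
Proof.
move=> x y; have [a ->] := cohom_class_surj x.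
have [b ->] := cohom_class_surj y.
by rewrite !H0_mulE; congr (cls _); apply: val_inj; exact: Z0_comm.
Qed.

Lemma H0_mul1 : left_id H0_one H0_mul.
Proof.
move=> x; have [a ->] := cohom_class_surj x.
by rewrite !H0_mulE; congr (cls _); apply: val_inj; rewrite /= mul1r.
Qed.

Lemma H0_mulDl : left_distributive H0_mul +%R.
Proof.
move=> x y z; have [a ->] := cohom_class_surj x.
have [b ->] := cohom_class_surj y; have [c ->] := cohom_class_surj z.
rewrite -[cls a + cls b](raddfD cls) !H0_mulE -[RHS](raddfD cls).
congr (cls _); apply: val_inj; rewrite [RHS]raddfD /= -mulrDl.
by congr (_ * _); exact: (raddfD val).
Qed.

HB.instance Definition _ :=
  GRing.Zmodule_isComPzRing.Build H0 H0_mulA H0_mulC H0_mul1 H0_mulDl.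

Definition H0_proj (a : A) : conc_dgRing H0 :=
  cls (Z0_of (homog_gcomp str 0 a)).

Lemma H0_proj_zmod : zmod_morphism H0_proj.
Proof.
move=> a b; rewrite /H0_proj -[RHS](raddfB cls).
by congr (cls _); apply: val_inj; rewrite /= !raddfB.
Qed.

Lemma gcomp0M (a b : A) : gcomp str 0 (a * b) = gcomp str 0 a * gcomp str 0 b.
Proof.
elim/(homog_ind (X := str)): a => [x y IHx IHy|m a ha].
  by rewrite mulrDl !raddfD /= mulrDl IHx IHy.
elim/(homog_ind (X := str)): b => [x y IHx IHy|n b hb].
  by rewrite mulrDr !raddfD /= mulrDr IHx IHy.
rewrite (gcomp_homog _ (dgr_homogM ha hb)) (gcomp_homog _ ha) (gcomp_homog _ hb).
have [m0|m0] := ltP 0 m; first by rewrite (dgr_nonpos m0 ha) !mul0r !if_same mul0r.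
have [n0|n0] := ltP 0 n; first by rewrite (dgr_nonpos n0 hb) !mulr0 !if_same mulr0.
have -> : (0 == m + n) = (0 == m) && (0 == n) by lia.
by case: eqP => _; case: eqP => _; rewrite ?mul0r ?mulr0.
Qed.

Lemma H0_proj_monoid : monoid_morphism H0_proj.
Proof.
split.
  rewrite /H0_proj; congr (cls _); apply: val_inj; exact: dgr_homog1.
move=> a b; rewrite /H0_proj [RHS]H0_mulE.
congr (cls _); apply: val_inj; exact: gcomp0M.
Qed.

Definition H0_proj_rmorphism : {rmorphism A -> conc_dgRing H0} :=
  HB.pack H0_proj
    (GRing.isZmodMorphism.Build A (conc_dgRing H0) H0_proj H0_proj_zmod)
    (GRing.isMonoidMorphism.Build A (conc_dgRing H0) H0_proj H0_proj_monoid).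

Definition to_H0 : dgRingHom A (conc H0).
Proof.
apply: (@DGRingHom A (conc H0) H0_proj_rmorphism) => [n a ha|a].
  apply/homog_conc; case: (n =P 0) => [|/eqP n0]; [by left | right].
  rewrite -[RHS](raddf0 cls); congr (cls _); apply: val_inj.
  by rewrite /= (gcomp_homog _ ha) eq_sym (negPf n0).
rewrite -[RHS](raddf0 cls); apply/cohom_classP.
exists (gcomp str (0 - 1) a); first exact: homog_gcomp.
rewrite /= subr0; elim/(homog_ind (X := str)): a => [x y IHx IHy|m a ha].
  by rewrite !raddfD /= IHx IHy.
rewrite (gcomp_homog _ (dif_homog ha)) (gcomp_homog _ ha).
have -> : (0 == m + 1) = (0 - 1 == m) by lia.
by case: ifP; rewrite ?raddf0.
Defined.

End H0.

Definition bounded_cohomology (A : dgRing) : Prop :=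
  exists m : int, forall n, n < m -> forall x : cohom (dgr_str A) n, x = 0.

Definition is_ideal (R : comPzRingType) (I : R -> Prop) : Prop :=
  [/\ I 0, forall x y, I x -> I y -> I (x + y) & forall a x, I x -> I (a * x)].

Definition noetherian (R : comPzRingType) : Prop :=
  forall I : R -> Prop, is_ideal I -> exists (n : nat) (g : 'I_n -> R),
    forall x, I x <-> exists c : 'I_n -> R, x = \sum_(i < n) c i * g i.

Definition forget (A : cdgRing) (M : dgMod (conc (H0 A))) : dgMod A :=
  restr_scalars (to_H0 A) M.

(* the additive subgroup generated by G *)
Section Span.
Variables (V : zmodType) (G : V -> Prop).

Definition span : {pred V} := [pred x | `[< forall S : V -> Prop,
  S 0 -> (forall u v, S u -> S v -> S (u - v)) -> (forall u, G u -> S u) -> S x >]].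

Lemma span_closed : zmod_closed span.
Proof.
split; first by apply/asboolP.
move=> x y /asboolP hx /asboolP hy; apply/asboolP => S S0 SB SG.
by apply: (SB); [exact: hx | exact: hy].
Qed.
HB.instance Definition _ := GRing.isZmodClosed.Build V span span_closed.

Lemma mem_span x : G x -> x \in span.
Proof. by move=> Gx; apply/asboolP => S _ _; apply. Qed.

Lemma span_ind (S : V -> Prop) : S 0 -> (forall u v, S u -> S v -> S (u - v)) ->
  (forall u, G u -> S u) -> forall x, x \in span -> S x.
Proof. by move=> S0 SB SG x /asboolP; apply. Qed.

End Span.

Section Tensor.
Variables (A : cdgRing) (P N : dgMod A).
Local Notation sA := (dgr_str A).
Local Notation sP := (dgm_str P).
Local Notation sN := (dgm_str N).
Local Notation free := {freeg (P * N)%type}.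
Local Notation sym p q := (<< (p, q) >> : free).

(* P (x)_A N is the quotient of the free abelian group on P * N by these
   relations; the last one is (p a) (x) q = p (x) (a q), where the right action
   on P is p a = (-1)^{|a||p|} a p. *)
Inductive tensor_rel : free -> Prop :=
| Tensor_addl p p' q : tensor_rel (sym (p + p') q - sym p q - sym p' q)
| Tensor_addr p q q' : tensor_rel (sym p (q + q') - sym p q - sym p q')
| Tensor_bal k l (a : A) p q of homog sA k a & homog sP l p :
    tensor_rel (sym (ksgn (k * l) (a *: p)) q - sym p (a *: q)).

Definition tensor : Type := Quotient.quot (span tensor_rel).
HB.instance Definition _ := GRing.Zmodule.on tensor.

Definition tensor_pi : {additive free -> tensor} :=
  \pi_(Quotient.quot (span tensor_rel))%qT.

Definition pure (p : P) (q : N) : tensor := tensor_pi (sym p q).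

Lemma tensor_pi_rel u : tensor_rel u -> tensor_pi u = 0.
Proof.
move=> hu; rewrite -(raddf0 tensor_pi); apply/eqP.
by rewrite -Quotient.idealrBE subr0 mem_span.
Qed.

Lemma pureDl q : {morph pure^~ q : p p' / p + p'}.
Proof.
move=> p p'; apply/eqP; rewrite -subr_eq0 opprD addrA /pure -!raddfB.
exact/eqP/tensor_pi_rel/Tensor_addl.
Qed.

Lemma pureDr p : {morph pure p : q q' / q + q'}.
Proof.
move=> q q'; apply/eqP; rewrite -subr_eq0 opprD addrA /pure -!raddfB.
exact/eqP/tensor_pi_rel/Tensor_addr.
Qed.

Definition pure_l q : {additive P -> tensor} :=
  mk_additive (zmod_morphD (pureDl q)).
Definition pure_r p : {additive N -> tensor} :=
  mk_additive (zmod_morphD (pureDr p)).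

Lemma pure0l q : pure 0 q = 0. Proof. exact: raddf0 (pure_l q). Qed.
Lemma pure0r p : pure p 0 = 0. Proof. exact: raddf0 (pure_r p). Qed.
Lemma pureNl p q : pure (- p) q = - pure p q.
Proof. exact: raddfN (pure_l q) p. Qed.
Lemma pureNr p q : pure p (- q) = - pure p q.
Proof. exact: raddfN (pure_r p) q. Qed.
Lemma pure_ksgnl n p q : pure (ksgn n p) q = ksgn n (pure p q).
Proof. exact: raddf_ksgn (pure_l q) n p. Qed.
Lemma pure_ksgnr n p q : pure p (ksgn n q) = ksgn n (pure p q).
Proof. exact: raddf_ksgn (pure_r p) n q. Qed.

Lemma pure_bal k l (a : A) p q : homog sA k a -> homog sP l p ->
  pure p (a *: q) = ksgn (k * l) (pure (a *: p) q).
Proof.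
move=> ha hp; apply/eqP; rewrite eq_sym -subr_eq0 -pure_ksgnl /pure -raddfB.
exact/eqP/tensor_pi_rel/Tensor_bal.
Qed.

Lemma tensor_ind (K : tensor -> Prop) :
  (forall x y, K x -> K y -> K (x + y)) ->
  (forall m n p q, homog sP m p -> homog sN n q -> K (pure p q)) ->
  forall x, K x.
Proof.
move=> KD Kh; have Kp p q : K (pure p q).
  elim/(homog_ind (X := sP)): p => [x y Kx Ky|m p hp]; first by rewrite pureDl; apply: KD.
  elim/(homog_ind (X := sN)): q => [x y Kx Ky|n q hq]; first by rewrite pureDr; apply: KD.
  exact: Kh hp hq.
have K0 : K 0 by rewrite -(pure0l 0).
move=> x; have -> : x = tensor_pi (repr x) by rewrite /= reprK.
rewrite -(freeg_sumE (repr x)) raddf_sum; elim/big_ind: _ => //= -[p q] _.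
set k := coeff _ _; have -> : << k *g (p, q) >> = << (p, q) >> *~ k :> free.
  by rewrite freeg_mulz intz.
rewrite raddfMz; case: k => k; rewrite ?NegzE ?mulrNz -pmulrn.
  elim: k => [|k IH]; first by rewrite mulr0n.
  rewrite mulrS; apply: KD => //; exact: Kp.
rewrite -mulNrn -[- _]pureNl; elim: k => [|k IH]; first exact: Kp.
by rewrite mulrS; apply: KD => //; exact: Kp.
Qed.

Section Lift.
Variables (W : zmodType) (b : P -> N -> W).
Hypothesis bDl : forall q, {morph b^~ q : p p' / p + p'}.
Hypothesis bDr : forall p, {morph b p : q q' / q + q'}.
Hypothesis b_bal : forall k l (a : A) p q, homog sA k a -> homog sP l p ->
  b p (a *: q) = ksgn (k * l) (b (a *: p) q).

Definition free_lift (u : free) : W :=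
  fglift (fun pq : P * N => b pq.1 pq.2 : zmodule W) u.

Lemma free_lift_zmod : zmod_morphism free_lift.
Proof.
move=> x y; rewrite /free_lift.
exact: (@lift_is_additive _ _ (zmodule W) (fun pq : P * N => b pq.1 pq.2) x y).
Qed.
HB.instance Definition _ :=
  GRing.isZmodMorphism.Build free W free_lift free_lift_zmod.

Lemma free_lift_sym p q : free_lift (sym p q) = b p q.
Proof. by rewrite /free_lift liftU scale1r. Qed.

Lemma free_lift_span u : u \in span tensor_rel -> free_lift u = 0.
Proof.
apply: (@span_ind _ _ (fun u => free_lift u = 0)) => [|x y hx hy|_ [p p' q|p q q'|k l a p q ha hp]].
- exact: raddf0.
- by rewrite raddfB /= hx hy subrr.
- by rewrite !raddfB /= !free_lift_sym bDl addrAC addrK subrr.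
- by rewrite !raddfB /= !free_lift_sym bDr addrAC addrK subrr.
have bN x : b (- x) q = - b x q.
  exact: (raddfN (mk_additive (zmod_morphD (bDl q)))).
rewrite raddfB /= !free_lift_sym (b_bal _ ha hp); apply/eqP; rewrite subr_eq0.
by rewrite /ksgn; case: ifP; rewrite ?bN.
Qed.

Definition tensor_lift (t : tensor) : W := free_lift (repr t).

Lemma tensor_lift_pi u : tensor_lift (tensor_pi u) = free_lift u.
Proof.
apply/eqP; rewrite -subr_eq0 /tensor_lift -(raddfB free_lift) /= free_lift_span //.
by rewrite Quotient.idealrBE /= reprK.
Qed.

Lemma tensor_liftE p q : tensor_lift (pure p q) = b p q.
Proof. by rewrite tensor_lift_pi free_lift_sym. Qed.

Lemma tensor_lift_zmod : zmod_morphism tensor_lift.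
Proof.
move=> x y; have E z : z = tensor_pi (repr z) by rewrite /= reprK.
rewrite (E x) (E y) -(raddfB tensor_pi) !tensor_lift_pi.
exact: (raddfB free_lift).
Qed.

Definition tensor_liftA : {additive tensor -> W} := mk_additive tensor_lift_zmod.

End Lift.

(* (P (x) N)^n is spanned by the p (x) q with |p| + |q| = n. *)
Section TensorComp.
Variable n : int.
Let b (p : P) (q : N) := gsum sP (fun i p' => pure p' (gcomp sN (n - i) q)) p.

Let bD q i : {morph (fun p' => pure p' (gcomp sN (n - i) q)) : x y / x + y}.
Proof. exact: pureDl. Qed.

Lemma tensor_comp_Dl q : {morph b^~ q : p p' / p + p'}.
Proof. exact: gsumD (bD q). Qed.

Lemma tensor_comp_Dr p : {morph b p : q q' / q + q'}.
Proof.
move=> q q'; rewrite /b /gsum -big_split; apply: eq_bigr => i _.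
by rewrite raddfD pureDr.
Qed.

Lemma tensor_comp_bal k l (a : A) p q : homog sA k a -> homog sP l p ->
  b p (a *: q) = ksgn (k * l) (b (a *: p) q).
Proof.
move=> ha hp; rewrite /b (gsum_homog (bD _) hp).
rewrite (gsum_homog (bD _) (dgm_homogZ ha hp)) (gcompZ _ _ ha).
by rewrite (pure_bal _ ha hp) -addrA -opprD addrC [l + k]addrC addrC.
Qed.

Definition tensor_comp : {additive tensor -> tensor} :=
  tensor_liftA tensor_comp_Dl tensor_comp_Dr tensor_comp_bal.

Lemma tensor_compE l r p q : homog sP l p -> homog sN r q ->
  tensor_comp (pure p q) = if n == l + r then pure p q else 0.
Proof.
move=> hp hq; transitivity (b p q).
  exact: (tensor_liftE tensor_comp_Dl tensor_comp_Dr tensor_comp_bal).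
rewrite /b (gsum_homog (bD _) hp) (gcomp_homog _ hq).
have -> : (n - l == r) = (n == l + r) by lia.
by case: ifP; rewrite ?pure0r.
Qed.

End TensorComp.

Lemma tensor_compK m n x :
  tensor_comp m (tensor_comp n x) = if m == n then tensor_comp n x else 0.
Proof.
elim/tensor_ind: x => [x y IHx IHy|l r p q hp hq].
  by rewrite !raddfD IHx IHy; case: ifP; rewrite ?addr0.
rewrite !(tensor_compE _ hp hq); case: (n =P l + r) => [->|_].
  by rewrite [LHS](tensor_compE _ hp hq).
by rewrite [LHS]raddf0 if_same.
Qed.

Lemma tensor_comp_sum x :
  exists2 s : seq int, uniq s & x = \sum_(n <- s) tensor_comp n x.
Proof.
elim/tensor_ind: x => [x y|l r p q hp hq].
  exact: sum_cover_decompD tensor_compK x y.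
by exists [:: l + r]; rewrite // big_seq1 (tensor_compE _ hp hq) eqxx.
Qed.

Definition tensor_grading : grading tensor := Grading tensor_compK tensor_comp_sum.

Lemma homog_pure l r p q : homog sP l p -> homog sN r q ->
  homog tensor_grading (l + r) (pure p q).
Proof. by move=> hp hq; rewrite /homog [LHS](tensor_compE _ hp hq) eqxx. Qed.

Lemma tensor_homog_ind (K : int -> tensor -> Prop) :
  (forall n x y, K n x -> K n y -> K n (x + y)) ->
  (forall n, K n 0) ->
  (forall l r p q, homog sP l p -> homog sN r q -> K (l + r) (pure p q)) ->
  forall n x, homog tensor_grading n x -> K n x.
Proof.
move=> KD K0 Kh n x <-; elim/tensor_ind: x => [x y Kx Ky|l r p q hp hq].
  by rewrite raddfD; apply: KD.
have -> : gcomp tensor_grading n (pure p q) = if n == l + r then pure p q else 0.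
  exact: tensor_compE.
by case: eqP => [->|_]; [exact: Kh hp hq | exact: K0].
Qed.

(* d(p (x) q) = dp (x) q + (-1)^{|p|} p (x) dq *)
Section TensorDif.
Let c (q : N) i p' := ksgn i (pure p' (dif sN q)).
Let b (p : P) (q : N) := pure (dif sP p) q + gsum sP (c q) p.

Let cD q i : {morph c q i : x y / x + y}.
Proof. by move=> x y; rewrite /c pureDl ksgnD. Qed.

Lemma tensor_dif_Dl q : {morph b^~ q : p p' / p + p'}.
Proof.
by move=> p p'; rewrite /b (gsumD sP (cD q)) raddfD pureDl addrACA.
Qed.

Lemma tensor_dif_Dr p : {morph b p : q q' / q + q'}.
Proof.
move=> q q'; rewrite /b pureDr addrACA; congr (_ + _).
by rewrite /gsum -big_split; apply: eq_bigr => i _; rewrite /c raddfD pureDr ksgnD.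
Qed.

Lemma tensor_dif_bal k l (a : A) p q : homog sA k a -> homog sP l p ->
  b p (a *: q) = ksgn (k * l) (b (a *: p) q).
Proof.
move=> ha hp; rewrite /b (gsum_homog (cD _) hp) (gsum_homog (cD _) (dgm_homogZ ha hp)).
rewrite /c (dgm_leibniz _ ha) (dgm_leibniz _ ha) pureDl pureDr pure_ksgnl pure_ksgnr.
rewrite (pure_bal _ ha (dif_homog hp)) (pure_bal _ (dif_homog ha) hp) (pure_bal _ ha hp).
rewrite !ksgnD addrCA addrA /ksgn !(odd_abszD, odd_abszM) /=.
by case: (odd `|k|%N); case: (odd `|l|%N); rewrite /= ?opprK.
Qed.

Definition tensor_dif : {additive tensor -> tensor} :=
  tensor_liftA tensor_dif_Dl tensor_dif_Dr tensor_dif_bal.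

Lemma tensor_difE l p q : homog sP l p ->
  tensor_dif (pure p q) = pure (dif sP p) q + ksgn l (pure p (dif sN q)).
Proof.
move=> hp; transitivity (b p q).
  exact: (tensor_liftE tensor_dif_Dl tensor_dif_Dr tensor_dif_bal).
by rewrite /b (gsum_homog (cD _) hp).
Qed.

End TensorDif.

Definition tensor_str : dgStruct tensor.
Proof.
apply: (@DGStruct _ tensor_grading tensor_dif).
  apply: tensor_homog_ind => [n x y hx hy|n|l r p q hp hq].
  - by rewrite raddfD; apply: homogD.
  - by rewrite raddf0; apply: homog0.
  rewrite (tensor_difE _ hp); apply: homogD.
    by rewrite addrAC; apply: homog_pure (dif_homog hp) hq.
  by rewrite -addrA; apply/homog_ksgn/homog_pure/dif_homog.
move=> x; elim/tensor_ind: x => [x y hx hy|l r p q hp hq].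
  by rewrite !raddfD hx hy addr0.
rewrite (tensor_difE _ hp) raddfD raddf_ksgn (tensor_difE _ (dif_homog hp)).
rewrite (tensor_difE _ hp) !difK pure0l pure0r add0r ksgn0 addr0.
by rewrite /ksgn odd_abszD addbT if_neg; case: ifP; rewrite (addrN, addNr).
Defined.

(* a (p (x) q) = (a p) (x) q *)
Section TensorScale.
Variable a : A.
Let b (p : P) (q : N) := pure (a *: p) q.

Lemma tensor_scale_Dl q : {morph b^~ q : p p' / p + p'}.
Proof. by move=> p p'; rewrite /b scalerDr pureDl. Qed.

Lemma tensor_scale_Dr p : {morph b p : q q' / q + q'}.
Proof. exact: pureDr. Qed.

Lemma tensor_scale_bal k l (c : A) p q : homog sA k c -> homog sP l p ->
  b p (c *: q) = ksgn (k * l) (b (c *: p) q).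
Proof.
move=> hc hp; rewrite /b.
elim/(homog_ind (X := sA)): (a) => [x y IHx IHy|m x hx].
  by rewrite !scalerDl !pureDl IHx IHy ksgnD.
rewrite (pure_bal _ hc (dgm_homogZ hx hp)) !scalerA (cdgr_comm hx hc).
rewrite scale_ksgn pure_ksgnl /ksgn !(odd_abszD, odd_abszM) /=.
by case: (odd _); case: (odd _); case: (odd _); rewrite /= ?opprK.
Qed.

Definition tensor_scale : {additive tensor -> tensor} :=
  tensor_liftA tensor_scale_Dl tensor_scale_Dr tensor_scale_bal.

Lemma tensor_scaleE p q : tensor_scale (pure p q) = pure (a *: p) q.
Proof.
exact: (tensor_liftE tensor_scale_Dl tensor_scale_Dr tensor_scale_bal).
Qed.

End TensorScale.

Lemma tensor_scaleA a c x :
  tensor_scale a (tensor_scale c x) = tensor_scale (a * c) x.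
Proof.
elim/tensor_ind: x => [x y IHx IHy|l r p q _ _]; first by rewrite !raddfD IHx IHy.
by rewrite !tensor_scaleE scalerA.
Qed.
Lemma tensor_scale1 : left_id 1 (fun a => tensor_scale a : tensor -> tensor).
Proof.
elim/tensor_ind => [x y IHx IHy|l r p q _ _]; first by rewrite raddfD IHx IHy.
by rewrite tensor_scaleE scale1r.
Qed.
Lemma tensor_scaleDr :
  right_distributive (fun a => tensor_scale a : tensor -> tensor) +%R.
Proof. by move=> a x y; exact: raddfD. Qed.
Lemma tensor_scaleDl x : {morph (fun a => tensor_scale a x) : a c / a + c}.
Proof.
move=> a c; elim/tensor_ind: x => [x y IHx IHy|l r p q _ _].
  by rewrite !raddfD IHx IHy addrACA.
by rewrite !tensor_scaleE scalerDl pureDl.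
Qed.

HB.instance Definition _ := GRing.Zmodule_isLmodule.Build A tensor
  tensor_scaleA tensor_scale1 tensor_scaleDr tensor_scaleDl.

Definition tensor_dgMod : dgMod A.
Proof.
apply: (@DGMod A tensor tensor_str) => [m n a x ha|m a x ha].
  move: n x; apply: tensor_homog_ind => [n x y hx hy|n|l r p q hp hq].
  - by rewrite scalerDr; apply: homogD.
  - by rewrite scaler0; apply: homog0.
  rewrite [a *: _]tensor_scaleE addrA; apply: homog_pure hq.
  exact: dgm_homogZ.
elim/tensor_ind: x => [x y IHx IHy|l r p q hp hq].
  rewrite scalerDr ![dif tensor_str (_ + _)]raddfD IHx IHy !scalerDr ksgnD.
  exact: addrACA.
have dE t : dif tensor_str t = tensor_dif t by [].
have sE c u v : c *: (pure u v : tensor) = pure (c *: u) v by exact: tensor_scaleE.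
rewrite !dE sE (tensor_difE _ hp) (tensor_difE _ (dgm_homogZ ha hp)).
rewrite scalerDr scaler_ksgn !sE (dgm_leibniz _ ha) pureDl pure_ksgnl.
rewrite ksgnD addrA /ksgn !odd_abszD.
by case: (odd `|m|%N); case: (odd `|l|%N); rewrite /= ?opprK.
Defined.

End Tensor.

Section Hom.
Variables (A : cdgRing) (P N : dgMod A).
Local Notation sA := (dgr_str A).
Local Notation sP := (dgm_str P).
Local Notation sN := (dgm_str N).

(* the A-linear maps of degree n from P to N *)
Definition hom_deg (n : int) (f : P -> N) : Prop :=
  [/\ {morph f : x y / x + y},
      forall i x, homog sP i x -> homog sN (i + n) (f x) &
      forall k (a : A) x, homog sA k a -> f (a *: x) = ksgn (n * k) (a *: f x)].

Lemma hom_deg0 n : hom_deg n (0 : P -> N).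
Proof.
split=> [x y|i x _|k a x _]; first by rewrite [RHS]addr0.
  exact: homog0.
by rewrite scaler0 ksgn0.
Qed.

Lemma hom_degD n (f g : P -> N) : hom_deg n f -> hom_deg n g -> hom_deg n (f + g).
Proof.
move=> [fD fh fZ] [gD gh gZ]; split=> [x y|i x hx|k a x ha].
- by rewrite addrfctE fD gD addrACA.
- by apply: homogD; [exact: fh | exact: gh].
- by rewrite addrfctE (fZ _ _ _ ha) (gZ _ _ _ ha) -ksgnD scalerDr.
Qed.

Lemma hom_degN n (f : P -> N) : hom_deg n f -> hom_deg n (- f).
Proof.
move=> [fD fh fZ]; split=> [x y|i x hx|k a x ha].
- by rewrite opprfctE fD opprD.
- by rewrite -sub0r; apply: homogB; [exact: homog0 | exact: fh].
- by rewrite opprfctE (fZ _ _ _ ha) scalerN /ksgn; case: ifP.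
Qed.

Lemma hom_deg_ksgn k n (f : P -> N) : hom_deg n f -> hom_deg n (ksgn k f).
Proof. by move=> hf; rewrite /ksgn; case: ifP => // _; exact: hom_degN. Qed.

Lemma hom_degZ k n (a : A) (f : P -> N) : homog sA k a -> hom_deg n f ->
  hom_deg (k + n) (a *: f).
Proof.
move=> ha [fD fh fZ]; split=> [x y|i x hx|j c x hc].
- by rewrite scalrfctE fD scalerDr.
- by rewrite addrCA; apply: dgm_homogZ ha (fh _ _ hx).
rewrite scalrfctE (fZ _ _ _ hc) scaler_ksgn !scalerA (cdgr_comm ha hc) scale_ksgn.
rewrite /ksgn !(odd_abszD, odd_abszM) /=.
by case: (odd `|j|%N); case: (odd `|k|%N); case: (odd `|n|%N); rewrite /= ?opprK.
Qed.

Definition is_hom : {pred P -> N} := [pred f | `[< exists2 s : seq int, uniq s &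
  exists2 g : int -> P -> N, (forall n, hom_deg n (g n)) & f = \sum_(n <- s) g n >]].

Lemma is_hom_deg n f : hom_deg n f -> f \in is_hom.
Proof.
move=> hf; apply/asboolP; exists [:: n] => //.
exists (fun i => if i == n then f else 0); last by rewrite big_seq1 eqxx.
by move=> i; case: eqP => [->//|_]; exact: hom_deg0.
Qed.

Lemma is_homD f g : f \in is_hom -> g \in is_hom -> f + g \in is_hom.
Proof.
move=> /asboolP[s us [u hu ->]] /asboolP[t ut [v hv ->]]; apply/asboolP.
pose u' n := if n \in s then u n else 0; pose v' n := if n \in t then v n else 0.
exists (undup (s ++ t)); first exact: undup_uniq.
exists (fun n => u' n + v' n).
  by move=> n; apply: hom_degD; rewrite /u' /v'; case: ifP => // _; exact: hom_deg0.
rewrite big_split /=; congr (_ + _).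
  rewrite (eq_big_seq u'); last by move=> i; rewrite /u' => ->.
  apply: sum_cover; rewrite ?undup_uniq // => i; rewrite /u'.
    by case: ifP => //; rewrite eqxx.
  by rewrite mem_undup mem_cat; case: ifP => //; rewrite eqxx.
rewrite (eq_big_seq v'); last by move=> i; rewrite /v' => ->.
apply: sum_cover; rewrite ?undup_uniq // => i; rewrite /v'.
  by case: ifP => //; rewrite eqxx.
by rewrite mem_undup mem_cat orbC; case: ifP => //; rewrite eqxx.
Qed.

Lemma is_hom_ind (K : (P -> N) -> Prop) :
  (forall f g, K f -> K g -> K (f + g)) -> (forall n f, hom_deg n f -> K f) ->
  forall f, f \in is_hom -> K f.
Proof.
move=> KD Kh f /asboolP[s _ [g hg ->]]; elim/big_ind: _ => //.
  exact: Kh (hom_deg0 0).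
by move=> n _; exact: Kh (hg n).
Qed.

Lemma is_homZ (a : A) f : f \in is_hom -> a *: f \in is_hom.
Proof.
move: f; apply: is_hom_ind => [f g hf hg|n f hf]; first by rewrite scalerDr is_homD.
elim/(homog_ind (X := sA)): a => [x y hx hy|k a ha].
  by rewrite scalerDl is_homD.
exact: is_hom_deg (hom_degZ ha hf).
Qed.

Lemma is_hom_closed : submod_closed is_hom.
Proof.
split; first exact: is_hom_deg (hom_deg0 0).
by move=> a f g hf hg; apply: is_homD => //; exact: is_homZ.
Qed.
HB.instance Definition _ := GRing.isSubmodClosed.Build A (P -> N) is_hom is_hom_closed.

(* Hom_A(P, N) is the direct sum of the hom_deg n; this sum is realized
   inside the functions from P to N, where it is direct. *)
Record Hom := MkHom { Hom_val : P -> N; _ : Hom_val \in is_hom }.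
HB.instance Definition _ := [isSub for Hom_val].
HB.instance Definition _ := [Choice of Hom by <:].
HB.instance Definition _ := [SubChoice_isSubLmodule of Hom by <:].

Lemma Hom_ind (K : Hom -> Prop) :
  (forall f g, K f -> K g -> K (f + g)) -> (forall n f, hom_deg n (val f) -> K f) ->
  forall f, K f.
Proof.
move=> KD Kh [f hf].
suff [] : f \in is_hom /\ forall h : f \in is_hom, K (MkHom h) by [].
move: f hf; apply: is_hom_ind => [f g [hf Kf] [hg Kg]|n f hf].
  split=> [|h]; first exact: is_homD.
  have -> : MkHom h = MkHom hf + MkHom hg by apply: val_inj; rewrite raddfD.
  exact: KD.
by split=> [|h]; [exact: is_hom_deg hf | exact: (Kh n (MkHom h) hf)].
Qed.

Section HomComp.
Variable n : int.

Definition Hom_comp_fun (f : P -> N) (p : P) : N :=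
  gsum sP (fun i p' => gcomp sN (i + n) (f p')) p.

Lemma Hom_comp_funD (f g : P -> N) :
  Hom_comp_fun (f + g) = Hom_comp_fun f + Hom_comp_fun g.
Proof.
apply/funext => p.
change (Hom_comp_fun (f + g) p = Hom_comp_fun f p + Hom_comp_fun g p).
rewrite /Hom_comp_fun /gsum -big_split; apply: eq_bigr => i _.
exact: raddfD.
Qed.

Lemma Hom_comp_fun_deg m f : hom_deg m f ->
  Hom_comp_fun f = if n == m then f else 0.
Proof.
move=> [fD fh fZ]; apply/funext => p.
have D i : {morph (fun p' => gcomp sN (i + n) (f p')) : x y / x + y}.
  by move=> x y; rewrite fD raddfD.
rewrite /Hom_comp_fun; elim/(homog_ind (X := sP)): p => [x y IHx IHy|i x hx].
  rewrite (gsumD sP D) IHx IHy; case: ifP => _; first by rewrite fD.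
  by rewrite addr0.
rewrite (gsum_homog D hx) (gcomp_homog _ (fh _ _ hx)).
have -> : (i + n == i + m) = (n == m) by lia.
by case: ifP.
Qed.

Lemma Hom_comp_fun_hom f : f \in is_hom -> hom_deg n (Hom_comp_fun f).
Proof.
move: f; apply: is_hom_ind => [f g hf hg|m f hf].
  by rewrite Hom_comp_funD; exact: hom_degD.
by rewrite (Hom_comp_fun_deg hf); case: eqP => [->//|_]; exact: hom_deg0.
Qed.

Definition Hom_comp_map (x : Hom) : Hom :=
  MkHom (is_hom_deg (Hom_comp_fun_hom (valP x))).

Lemma Hom_comp_zmod : zmod_morphism Hom_comp_map.
Proof.
apply: zmod_morphD => x y; apply: val_inj; rewrite [RHS]raddfD.
transitivity (Hom_comp_fun (val x + val y)); last exact: Hom_comp_funD.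
by rewrite -(raddfD val).
Qed.

Definition Hom_comp : {additive Hom -> Hom} := mk_additive Hom_comp_zmod.

Lemma Hom_compE m x : hom_deg m (val x) -> Hom_comp x = if n == m then x else 0.
Proof.
move=> hx; apply: val_inj; rewrite [LHS](Hom_comp_fun_deg hx).
by case: ifP => // _; rewrite raddf0.
Qed.

End HomComp.

Lemma Hom_compK m n x : Hom_comp m (Hom_comp n x) = if m == n then Hom_comp n x else 0.
Proof.
exact: (@Hom_compE m n (Hom_comp n x) (Hom_comp_fun_hom n (valP x))).
Qed.

Lemma Hom_comp_sum x : exists2 s : seq int, uniq s & x = \sum_(n <- s) Hom_comp n x.
Proof.
elim/Hom_ind: x => [x y|n x hx]; first exact: sum_cover_decompD Hom_compK x y.
by exists [:: n]; rewrite // big_seq1 (Hom_compE _ hx) eqxx.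
Qed.

Definition Hom_grading : grading Hom := Grading Hom_compK Hom_comp_sum.

Lemma homog_HomP n x : homog Hom_grading n x <-> hom_deg n (val x).
Proof.
split=> [<-|hx]; first exact: Hom_comp_fun_hom (valP x).
by rewrite /homog [LHS](Hom_compE _ hx) eqxx.
Qed.

(* d(f) = d o f - (-1)^{|f|} f o d *)
Definition Hom_dif_post (x : Hom) : P -> N := fun p => dif sN (val x p).
Definition Hom_dif_pre (n : int) (x : Hom) : P -> N :=
  ksgn n (fun p => val x (dif sP p)).
Definition Hom_dif_fun (x : Hom) : P -> N :=
  Hom_dif_post x - gsum Hom_grading Hom_dif_pre x.

Lemma Hom_valD (x y : Hom) p : val (x + y) p = val x p + val y p.
Proof. by rewrite (raddfD val). Qed.

Lemma Hom_dif_preD n : {morph Hom_dif_pre n : x y / x + y}.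
Proof.
move=> x y; by rewrite /Hom_dif_pre -ksgnD; congr (ksgn _ _).
Qed.

Lemma Hom_dif_funD : {morph Hom_dif_fun : x y / x + y}.
Proof.
move=> x y; rewrite /Hom_dif_fun (gsumD Hom_grading Hom_dif_preD).
rewrite opprD addrACA; congr (_ + _); apply/funext => p.
by rewrite /Hom_dif_post Hom_valD raddfD.
Qed.

Lemma Hom_dif_funE n x : hom_deg n (val x) ->
  Hom_dif_fun x = fun p => dif sN (val x p) - ksgn n (val x (dif sP p)).
Proof.
move=> /homog_HomP hx; rewrite /Hom_dif_fun (gsum_homog Hom_dif_preD hx).
by apply/funext => p; rewrite /Hom_dif_pre /ksgn; case: ifP.
Qed.

Lemma Hom_dif_fun_deg n x : hom_deg n (val x) -> hom_deg (n + 1) (Hom_dif_fun x).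
Proof.
move=> hx; rewrite (Hom_dif_funE hx); case: hx => fD fh fZ; split.
- move=> u v; rewrite raddfD !fD !raddfD /= ksgnD opprD addrACA //.
- move=> i u hu; apply: homogB; first by rewrite addrA; apply/dif_homog/fh.
  apply: homog_ksgn; have := fh _ _ (dif_homog hu).
  by rewrite -addrA [1 + n]addrC.
move=> k a u ha; rewrite (dgm_leibniz _ ha) fD (fZ _ _ _ ha) (fZ _ _ _ (dif_homog ha)).
rewrite raddf_ksgn (dgm_leibniz _ ha).
have fN v : val x (- v) = - val x v.
  exact: (raddfN (mk_additive (zmod_morphD fD))).
have -> : val x (ksgn k (a *: dif sP u)) = ksgn k (val x (a *: dif sP u)).
  by rewrite /ksgn; case: ifP.
rewrite (fZ _ _ _ ha) scalerBr scaler_ksgn.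
rewrite /ksgn !(odd_abszD, odd_abszM) /=.
move: (dif sA a *: _) (a *: dif _ _) (a *: val x _) => X Y Z.
case: (odd `|k|%N); case: (odd `|n|%N);
  rewrite /= ?opprB ?opprD ?opprK; try by rewrite addrACA subrr add0r.
  by rewrite addrA subrK.
by rewrite addrC addrA subrK.
Qed.

Lemma Hom_dif_fun_hom x : Hom_dif_fun x \in is_hom.
Proof.
elim/Hom_ind: x => [x y hx hy|n x hx]; first by rewrite Hom_dif_funD is_homD.
exact: is_hom_deg (Hom_dif_fun_deg hx).
Qed.

Definition Hom_dif_map (x : Hom) : Hom := MkHom (Hom_dif_fun_hom x).

Lemma Hom_dif_zmod : zmod_morphism Hom_dif_map.
Proof.
apply: zmod_morphD => x y; apply: val_inj; rewrite [RHS]raddfD.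
exact: Hom_dif_funD.
Qed.

Definition Hom_dif : {additive Hom -> Hom} := mk_additive Hom_dif_zmod.

Lemma Hom_difE n x p : hom_deg n (val x) ->
  val (Hom_dif x) p = dif sN (val x p) - ksgn n (val x (dif sP p)).
Proof. by move=> hx; rewrite [LHS](congr1 (fun f => f p) (Hom_dif_funE hx)). Qed.

Definition Hom_str : dgStruct Hom.
Proof.
apply: (@DGStruct _ Hom_grading Hom_dif).
  by move=> n x /homog_HomP hx; apply/homog_HomP; exact: Hom_dif_fun_deg.
move=> x; elim/Hom_ind: x => [x y hx hy|n x hx].
  by rewrite !raddfD hx hy addr0.
apply: val_inj; apply/funext => p.
have h0 : val x 0 = 0 by case: hx => fD _ _; apply: (addIr (val x 0)); rewrite -fD !add0r.
rewrite (Hom_difE _ (Hom_dif_fun_deg hx : hom_deg _ (val (Hom_dif x)))) !(Hom_difE _ hx).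
rewrite raddfB raddf_ksgn !difK h0 ksgn0 subr0 sub0r /ksgn odd_abszD addbT if_neg.
by rewrite raddf0; case: ifP; rewrite ?opprK ?addNr ?subrr.
Defined.

Definition Hom_dgMod : dgMod A.
Proof.
apply: (@DGMod A Hom Hom_str) => [m n a x ha /homog_HomP hx|m a x ha].
  by apply/homog_HomP; rewrite linearZ; exact: hom_degZ.
elim/Hom_ind: x => [x y IHx IHy|n x hx].
  rewrite scalerDr ![dif Hom_str (_ + _)]raddfD IHx IHy !scalerDr ksgnD.
  exact: addrACA.
have dE t : dif Hom_str t = Hom_dif t by [].
have vZ c y p : val (c *: y : Hom) p = c *: val y p by rewrite linearZ.
have hax : hom_deg (m + n) (val (a *: x)) by rewrite linearZ; exact: hom_degZ.
apply: val_inj; apply/funext => p; rewrite !dE Hom_valD.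
have kE (y : Hom) : val (ksgn m y) p = ksgn m (val y p).
  by rewrite /ksgn; case: ifP => // _; rewrite raddfN.
rewrite kE !vZ (Hom_difE _ hax) (Hom_difE _ hx) !vZ (dgm_leibniz _ ha).
rewrite scalerBr scaler_ksgn -addrA; congr (_ + _).
rewrite /ksgn odd_abszD.
case: (odd `|m|%N); case: (odd `|n|%N); rewrite /= ?opprB ?opprD ?opprK //.
  exact: addrC.
exact: addrC.
Defined.

End Hom.

Definition K_flat (A : cdgRing) (P : dgMod A) : Prop :=
  forall N : dgMod A, acyclic N -> acyclic (tensor_dgMod P N).

Definition K_projective (A : cdgRing) (P : dgMod A) : Prop :=
  forall N : dgMod A, acyclic N -> acyclic (Hom_dgMod P N).

(* [is_LTensor M N T]: T represents the derived tensor product of M and N over A;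
   it determines T up to isomorphism in D(A). *)
Definition is_LTensor (A : cdgRing) (M N T : dgMod A) : Prop :=
  exists (P : dgMod A) (f : dgHom P M),
    [/\ K_flat P, quasi_iso f & D_iso T (tensor_dgMod P N)].

(* [is_RHom M N T]: T represents RHom_A(M, N), an object of D(A). *)
Definition is_RHom (A : cdgRing) (M N T : dgMod A) : Prop :=
  exists (P : dgMod A) (f : dgHom P M),
    [/\ K_projective P, quasi_iso f & D_iso T (Hom_dgMod P N)].

(* Main.v *)
(* Call a prime p of a noetherian ring R in the support of a complex X if k(p) (x) X is
   not acyclic, where X is K-flat. An ideal maximal among those I for which R/I (x) X is
   not acyclic is a prime p, and the elements outside p act bijectively on the cohomology
   of R/p (x) X, which therefore survives localization: so only acyclic complexes have
   empty support. Likewise, RHom(k(p), W) is nonzero for some p unless W is acyclic.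
   As k(p) is a retract, up to a shift, of k(p) (x) X for every p in the support of X, it
   follows that X (x) Y is acyclic iff X and Y have disjoint supports, and that the
   vanishing of RHom(X, N) depends only on the support of X.

   Now let R = H^0(A), let P -> SM be a resolution over A and let P' = R (x)_A P. By
   adjunction SM (x)_A SN = P' (x)_R N and RHom_A(SM, SN) = RHom_R(P', N) in the derived
   category, so it is enough that P' and M have the same support. With G -> S k(p) a
   resolution over A, one has k(p) (x)_R P' = S k(p) (x)_A SM = (R (x)_A G) (x)_R M, and
   the support of R (x)_A G is {p}: an element of exactly one of p, q acts on the
   cohomology of S k(q) (x)_A S k(p) both as zero and bijectively. *)

From HB Require Import structures.
From mathcomp Require Import all_boot all_order all_algebra.
From mathcomp Require Import boolp classical_sets functions zify ring generic_quotient.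
Require Import Defs.

Set Implicit Arguments.
Unset Strict Implicit.
Unset Printing Implicit Defensive.

Import Order.TTheory GRing.Theory Num.Theory.
Local Open Scope ring_scope.

(** * Graded modules and quasi-isomorphisms *)

(** The derived category is never formed: both claims become acyclicity of explicit complexes, and
    as arbitrary resolutions are allowed, independence of the choice is proved on chains. A single
    semifree construction, K-projective and K-flat at once, supplies resolutions over [A] and over R
    = H^0(A). Two steps need a reason. First, R (x)_A G is not acyclic: otherwise, being
    K-projective, it would be contractible, and by the adjunction of extension and restriction the
    resolution G -> S k(p) would be null-homotopic, although it hits 1 in cohomology. So some prime
    lies in the support of R (x)_A G, and only p can. Second, let supp Y lie in supp X and RHom(X,
    N) = 0. For p in supp X, RHom(k(p), N) is up to shift a retract of RHom(k(p) (x) X, N) =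
    RHom(k(p), RHom(X, N)), hence 0. If RHom(Y, N) were nonzero, some RHom(k(p), RHom(Y, N)) would
    be nonzero; but it is RHom(k(p) (x) Y, N), which vanishes for p outside supp Y, and also RHom(Y,
    RHom(k(p), N)), which vanishes for p in supp X. *)

Notation dm M := (dif (dgm_str M)).
Notation hmg M := (homog (dgm_str M)).

Section Sign.
Variable V : zmodType.
Implicit Types x : V.

Lemma ksgnK n : involutive (@ksgn V n).
Proof. by move=> x; rewrite /ksgn; case: (odd _); rewrite ?opprK. Qed.

Lemma ksgnN n x : ksgn n (- x) = - ksgn n x.
Proof. by rewrite /ksgn; case: ifP. Qed.

Lemma ksgnB n x y : ksgn n (x - y) = ksgn n x - ksgn n y.
Proof. by rewrite ksgnD ksgnN. Qed.

Lemma ksgn_comp m n x : ksgn m (ksgn n x) = ksgn (m + n) x.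
Proof.
by rewrite /ksgn odd_abszD; case: (odd `|m|%N); case: (odd `|n|%N); rewrite /= ?opprK.
Qed.

Lemma ksgn_eq m n x : odd `|m|%N = odd `|n|%N -> ksgn m x = ksgn n x.
Proof. by rewrite /ksgn => ->. Qed.

Lemma ksgn1 n x : ksgn (n + 1) x = - ksgn n x.
Proof. by rewrite -ksgn_comp ksgnN. Qed.

Lemma ksgn1B n x : ksgn (n - 1) x = - ksgn n x.
Proof. by rewrite -[n in RHS](subrK 1) ksgn1 opprK. Qed.

Lemma ksgn_id x : ksgn 0 x = x. Proof. by []. Qed.

Lemma ksgn_eq0 n x : ksgn n x = 0 -> x = 0.
Proof. by move=> h; rewrite -[x](ksgnK n) h ksgn0. Qed.

End Sign.

Section Elementwise.
Variables (V : zmodType) (X : dgStruct V).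

Lemma gcomp_dif n x : gcomp X n (dif X x) = dif X (gcomp X (n - 1) x).
Proof.
elim/(homog_ind (X := X)): x => [x y IHx IHy|m x hx]; first by rewrite !raddfD IHx IHy.
rewrite (gcomp_homog _ (dif_homog hx)) (gcomp_homog _ hx).
have -> : (n == m + 1) = (n - 1 == m) by lia.
by case: ifP; rewrite ?raddf0.
Qed.

Lemma homog_eq m n x : m = n -> homog X m x -> homog X n x.
Proof. by move=> ->. Qed.

Lemma boundary_homog n z y : homog X n z -> z = dif X y ->
  exists2 y', homog X (n - 1) y' & z = dif X y'.
Proof.
move=> hz zy; exists (gcomp X (n - 1) y); first exact: homog_gcomp.
by rewrite -gcomp_dif -zy hz.
Qed.

Lemma boundary_sum z : (forall n, exists y, gcomp X n z = dif X y) ->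
  exists y, z = dif X y.
Proof.
move=> h; have [s _ zE] := gcomp_sum X z.
exists (\sum_(n <- s) sval (cid (h n))); rewrite {1}zE raddf_sum.
by apply: eq_bigr => n _; case: cid.
Qed.

Lemma gcomp_cocycle n z : dif X z = 0 -> dif X (gcomp X n z) = 0.
Proof. by move=> dz; rewrite -[n](addrK 1) -gcomp_dif dz raddf0. Qed.

End Elementwise.

(** The module is the direct sum of its components and the differential is homogeneous, so
    components of a cocycle are cocycles and finitely many primitives add up. Most diagram chases
    can then ignore degrees. *)
Lemma acyclicP (A : dgRing) (M : dgMod A) :
  acyclic M <-> forall z, dm M z = 0 -> exists y, z = dm M y.
Proof.
split=> [aM z dz|h n x].
  apply: boundary_sum => n.
  have hz : gcomp (dgm_str M) n z \in is_cocycle (dgm_str M) n.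
    by apply/is_cocycleP; split; [exact: homog_gcomp | exact: gcomp_cocycle].
  have := aM n (cohom_class _ _ (Cocycle hz)).
  rewrite -(raddf0 (cohom_class _ _)) => /cohom_classP[y _].
  by rewrite /= subr0 => ->; exists y.
have [z ->] := cohom_class_surj x; have [hz dz] := cocycleP z.
rewrite -(raddf0 (cohom_class _ _)); apply/cohom_classP.
have [y zy] := h _ dz; have [y' hy' zy'] := boundary_homog hz zy.
by exists y'; rewrite //= subr0.
Qed.

Lemma gcomp_dgHom (A : dgRing) (M N : dgMod A) (f : dgHom M N) n x :
  gcomp (dgm_str N) n (f x) = f (gcomp (dgm_str M) n x).
Proof.
elim/(homog_ind (X := dgm_str M)): x => [x y IHx IHy|m x hx].
  by rewrite !raddfD IHx IHy.
rewrite (gcomp_homog _ (dgh_homog f hx)) (gcomp_homog _ hx).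
by case: ifP; rewrite ?raddf0.
Qed.

Lemma quasi_isoP (A : dgRing) (M N : dgMod A) (f : dgHom M N) :
  quasi_iso f <->
  (forall z y, dm M z = 0 -> f z = dm N y -> exists x, z = dm M x) /\
  (forall w, dm N w = 0 -> exists z y, dm M z = 0 /\ w = f z + dm N y).
Proof.
split=> [qf|[inj sur] n].
  split=> [z y dz fz|w dw].
    apply: boundary_sum => n.
    have hz : gcomp (dgm_str M) n z \in is_cocycle (dgm_str M) n.
      by apply/is_cocycleP; split; [exact: homog_gcomp | exact: gcomp_cocycle].
    have /cohom_classP[x _] : cohom_class _ _ (Cocycle hz) = cohom_class _ _ 0.
      apply: (bij_inj (qf n)); rewrite !cohom_mapE; apply/cohom_classP.
      exists (gcomp (dgm_str N) (n - 1) y); first exact: homog_gcomp.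
      by rewrite /= raddf0 subr0 -gcomp_dgHom fz gcomp_dif.
    by rewrite /= subr0 => ->; exists x.
  have [s _ wE] := gcomp_sum (dgm_str N) w.
  have h n : exists zy : M * N, dm M zy.1 = 0 /\
      gcomp (dgm_str N) n w = f zy.1 + dm N zy.2.
    have hw : gcomp (dgm_str N) n w \in is_cocycle (dgm_str N) n.
      by apply/is_cocycleP; split; [exact: homog_gcomp | exact: gcomp_cocycle].
    have [g _ gK] := qf n.
    have [z zE] := cohom_class_surj (g (cohom_class _ _ (Cocycle hw))).
    have := gK (cohom_class _ _ (Cocycle hw)); rewrite zE cohom_mapE.
    move=> /esym/cohom_classP[y _ /= wy]; exists (val z, y) => /=.
    by have [_ dz] := cocycleP z; split; rewrite // -wy addrC subrK.
  exists (\sum_(n <- s) (sval (cid (h n))).1), (\sum_(n <- s) (sval (cid (h n))).2).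
  split; first by rewrite raddf_sum big1 // => n _; case: cid => ? [].
  rewrite {1}wE !raddf_sum -big_split; apply: eq_bigr => n _ /=.
  by case: cid => ? [].
have inj' : injective (cohom_map f n).
  move=> a b; have [z ->] := cohom_class_surj a; have [w ->] := cohom_class_surj b.
  rewrite !cohom_mapE => /cohom_classP[y _ /= zw]; apply/cohom_classP.
  have [hz dz] := cocycleP z; have [hw dw] := cocycleP w.
  have [x zx] : exists x, val z - val w = dm M x.
    by apply: (inj _ y); rewrite raddfB ?dz ?dw ?subrr.
  have [x' hx' ->] := boundary_homog (homogB hz hw) zx; by exists x'.
have sur' b : exists a, cohom_map f n a == b.
  have [w ->] := cohom_class_surj b; have [hw dw] := cocycleP w.
  have [z [y [dz wE]]] := sur _ dw.
  have hz : gcomp (dgm_str M) n z \in is_cocycle (dgm_str M) n.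
    by apply/is_cocycleP; split; [exact: homog_gcomp | exact: gcomp_cocycle].
  exists (cohom_class _ _ (Cocycle hz)); rewrite cohom_mapE; apply/eqP/cohom_classP.
  exists (- gcomp (dgm_str N) (n - 1) y); last first.
    by rewrite /= -[val w]hw wE raddfD gcomp_dif gcomp_dgHom opprD addrA subrr add0r raddfN.
  by rewrite -sub0r; apply: homogB; [exact: homog0 | exact: homog_gcomp].
exists (fun b => xchoose (sur' b)) => [a|b]; last exact/eqP/(xchooseP (sur' b)).
by apply: inj'; apply/eqP/(xchooseP (sur' _)).
Qed.

Section DgHomMorph.
Variables (A : dgRing) (M N : dgMod A) (f : dgHom M N).

Lemma dgHomD x y : f (x + y) = f x + f y. Proof. exact: raddfD. Qed.
Lemma dgHom0 : f 0 = 0. Proof. exact: raddf0. Qed.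
Lemma dgHomN x : f (- x) = - f x. Proof. exact: raddfN. Qed.
Lemma dgHomB x y : f (x - y) = f x - f y. Proof. exact: raddfB. Qed.
Lemma dgHomZ a x : f (a *: x) = a *: f x. Proof. exact: linearZ. Qed.
Lemma dgHom_ksgn n x : f (ksgn n x) = ksgn n (f x). Proof. exact: raddf_ksgn. Qed.

End DgHomMorph.

Lemma acyclic_qi (A : dgRing) (M N : dgMod A) (f : dgHom M N) :
  quasi_iso f -> acyclic M <-> acyclic N.
Proof.
move=> /quasi_isoP[inj sur]; split=> /acyclicP h; apply/acyclicP => z dz.
  have [w [y [/h[x ->] ->]]] := sur _ dz; exists (f x + y).
  by rewrite raddfD /= dgh_dif.
have [|y fz] := h (f z); first by rewrite -dgh_dif dz raddf0.
exact: inj fz.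
Qed.

Lemma D_iso_acyclic (A : dgRing) (M N : dgMod A) : D_iso M N -> acyclic M <-> acyclic N.
Proof.
by move=> [Z [f [g [/acyclic_qi <- /acyclic_qi <-]]]].
Qed.

Lemma acyclic_zero (A : dgRing) : acyclic (D_zero A).
Proof. by apply/acyclicP => z _; exists 0; rewrite [LHS]thinmx0 [RHS]thinmx0. Qed.

Definition id_dgHom (A : dgRing) (M : dgMod A) : dgHom M M.
Proof. by apply: (@DGHom A M M (idfun : {linear M -> M})). Defined.

Definition zero_dgHom (A : dgRing) (M N : dgMod A) : dgHom M N.
Proof.
apply: (@DGHom A M N (\0 : {linear M -> N})) => [n x _|x] /=; first exact: homog0.
by rewrite raddf0.
Defined.

(** For acyclic [M] the roof has apex [M], with the identity and the zero map as legs. *)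
Lemma D_iso_zeroP (A : dgRing) (M : dgMod A) : D_iso M (D_zero A) <-> acyclic M.
Proof.
split=> [/D_iso_acyclic[_]|/acyclicP aM]; first by apply; exact: acyclic_zero.
exists M, (id_dgHom M), (zero_dgHom M (D_zero A)); split; apply/quasi_isoP; split.
- by move=> z y _ /= zy; exists y.
- by move=> w dw; exists w, 0; split; rewrite //= raddf0 addr0.
- by move=> z y dz _; exact: aM.
- by move=> w _; exists 0, 0; split; [rewrite raddf0 | rewrite [LHS]thinmx0 [RHS]thinmx0].
Qed.

(** The inverse is a bare function commuting with the differentials; [g 0 = 0] is what makes it
    preserve cocycles, so no linear structure has to be built on it. *)
Lemma iso_qi (A : dgRing) (M N : dgMod A) (f : dgHom M N) (g : N -> M) :
  {morph g : x / dm N x >-> dm M x} -> g 0 = 0 -> cancel f g -> cancel g f -> quasi_iso f.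
Proof.
move=> gd g0 fK gK; apply/quasi_isoP; split=> [z y dz fz|w dw].
  by exists (g y); rewrite -gd -fz fK.
by exists (g w), 0; rewrite raddf0 addr0 gK -gd dw g0.
Qed.

Section HomogInd.
Variables (A : dgRing) (M : dgMod A).

Lemma dgm_ind (K : M -> Prop) : (forall x y, K x -> K y -> K (x + y)) ->
  (forall n x, hmg M n x -> K x) -> forall x, K x.
Proof. exact: homog_ind. Qed.

End HomogInd.

Section Parity.
Variables (A : dgRing) (M : dgMod A).
Implicit Types x y : M.

Lemma parity_morph n : {morph (fun x : M => ksgn n x) : x y / x + y}.
Proof. exact: ksgnD. Qed.

(** The involution x -> (-1)^|x| x, which carries Koszul signs to inhomogeneous elements. It is
    locked to keep the underlying sum from unfolding. *)
Definition parity : {additive M -> M} :=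
  locked (mk_additive (zmod_morphD (gsumD (dgm_str M) parity_morph))).

Lemma parityD x y : parity (x + y) = parity x + parity y.
Proof. exact: (raddfD parity). Qed.

Lemma parityE n x : hmg M n x -> parity x = ksgn n x.
Proof. by rewrite /parity -lock; exact: gsum_homog parity_morph n x. Qed.

Lemma parityK : involutive parity.
Proof.
move=> x; elim/dgm_ind: x => [x y IHx IHy|m x hx].
  by rewrite !parityD IHx IHy.
by rewrite (parityE hx) (parityE (homog_ksgn _ hx)) ksgnK.
Qed.

Lemma parity_dif x : parity (dm M x) = - dm M (parity x).
Proof.
elim/dgm_ind: x => [x y IHx IHy|m x hx].
  by rewrite !raddfD IHx IHy.
by rewrite (parityE hx) (parityE (dif_homog hx)) ksgn1 raddf_ksgn.
Qed.

Lemma parity_homog n x : hmg M n x -> hmg M n (parity x).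
Proof. by move=> hx; rewrite (parityE hx); exact: homog_ksgn. Qed.

Lemma parityZ k a x : homog (dgr_str A) k a -> parity (a *: x) = ksgn k (a *: parity x).
Proof.
move=> ha; elim/dgm_ind: x => [x y IHx IHy|m x hx].
  by rewrite scalerDr !parityD IHx IHy scalerDr ksgnD.
by rewrite (parityE (dgm_homogZ ha hx)) (parityE hx) scaler_ksgn ksgn_comp.
Qed.

End Parity.

(** * Homogeneous maps and cones *)

Section HomCalculus.
Variable A : cdgRing.
Implicit Types M N P L W : dgMod A.

(** The differential of the Hom complex on bare functions of a declared degree [n], so that
    homotopies can be computed pointwise without packing maps into [Hom]. *)
Definition Dh P N (n : int) (f : P -> N) (x : P) : N :=
  dm N (f x) - ksgn n (f (dm P x)).

Definition hom_add P N n (f : P -> N) (hf : hom_deg n f) : {additive P -> N} :=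
  mk_additive (zmod_morphD (let: And3 fD _ _ := hf in fD)).

Section Morph.
Variables (P N : dgMod A) (n : int) (f : P -> N).
Hypothesis hf : hom_deg n f.

Lemma homgD x y : f (x + y) = f x + f y. Proof. by case: hf. Qed.
Lemma homg0 : f 0 = 0. Proof. exact: (raddf0 (hom_add hf)). Qed.
Lemma homgN x : f (- x) = - f x. Proof. exact: (raddfN (hom_add hf)). Qed.
Lemma homgB x y : f (x - y) = f x - f y. Proof. by rewrite homgD homgN. Qed.
Lemma homg_ksgn k x : f (ksgn k x) = ksgn k (f x).
Proof. exact: (raddf_ksgn (hom_add hf)). Qed.
Lemma homgZ k a x : homog (dgr_str A) k a -> f (a *: x) = ksgn (n * k) (a *: f x).
Proof. by case: hf => _ _; apply. Qed.
Lemma homgh i x : hmg P i x -> hmg N (i + n) (f x).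
Proof. by case: hf => _ h _; exact: h. Qed.

Lemma Dh_deg : hom_deg (n + 1) (Dh n f).
Proof.
have := Hom_dif_fun_deg (x := MkHom (is_hom_deg hf)) hf.
by rewrite (@Hom_dif_funE _ _ _ _ (MkHom (is_hom_deg hf)) hf).
Qed.

End Morph.

Lemma hom_deg_comp P N L m n (g : N -> L) (f : P -> N) :
  hom_deg m g -> hom_deg n f -> hom_deg (n + m) (g \o f).
Proof.
move=> hg hf; split=> [x y|i x hx|k a x ha] /=.
- by rewrite (homgD hf) (homgD hg).
- by rewrite addrA; apply/(homgh hg)/(homgh hf).
rewrite (homgZ hf _ ha) (homg_ksgn hg) (homgZ hg _ ha) ksgn_comp.
by rewrite mulrDl.
Qed.

Lemma hom_degB P N n (f g : P -> N) : hom_deg n f -> hom_deg n g ->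
  hom_deg n (fun x => f x - g x).
Proof. by move=> hf hg; apply: (hom_degD hf (hom_degN hg)). Qed.

Lemma DhD P N n (f g : P -> N) x : Dh n (fun x => f x + g x) x = Dh n f x + Dh n g x.
Proof. by rewrite /Dh raddfD ksgnD opprD addrACA. Qed.

Lemma DhN P N n (f : P -> N) x : Dh n (fun x => - f x) x = - Dh n f x.
Proof. by rewrite /Dh raddfN ksgnN opprB opprK addrC. Qed.

Lemma Dh_ksgn P N k n (f : P -> N) x : Dh n (fun x => ksgn k (f x)) x = ksgn k (Dh n f x).
Proof. by rewrite /Dh raddf_ksgn ksgnB !ksgn_comp [k + n]addrC. Qed.

Lemma DhB P N n (f g : P -> N) x : Dh n (fun x => f x - g x) x = Dh n f x - Dh n g x.
Proof. by rewrite DhD DhN. Qed.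

Lemma Dh_comp P N L m n (g : N -> L) (f : P -> N) x : hom_deg m g ->
  Dh (n + m) (g \o f) x = Dh m g (f x) + ksgn m (g (Dh n f x)).
Proof.
move=> hg; rewrite /Dh /= (homgB hg) (homg_ksgn hg) ksgnB ksgn_comp addrA subrK.
by rewrite [m + n]addrC.
Qed.

Lemma Dh_dgHom M N (f : dgHom M N) n x : odd `|n|%N = false -> Dh n f x = 0.
Proof. by move=> h; rewrite /Dh dgh_dif /ksgn h subrr. Qed.

Lemma dgHom_deg M N (f : dgHom M N) : hom_deg 0 f.
Proof.
split=> [x y|i x hx|k a x ha]; first exact: raddfD.
  by rewrite addr0; exact: dgh_homog.
by rewrite linearZ mul0r.
Qed.

Lemma deg0_scalable M N (f : M -> N) (hf : hom_deg 0 f) : scalable f.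
Proof.
move=> a x; elim/(homog_ind (X := dgr_str A)): a => [b c IHb IHc|k a ha].
  by rewrite !scalerDl (homgD hf) IHb IHc.
by rewrite (homgZ hf _ ha) mul0r.
Qed.

Definition deg0_dgHom M N (f : M -> N) (hf : hom_deg 0 f) (df : forall x, Dh 0 f x = 0) :
  dgHom M N.
Proof.
pose g : {linear M -> N} := HB.pack f
  (GRing.isZmodMorphism.Build M N f (zmod_morphD (homgD hf)))
  (GRing.isScalable.Build A M N *:%R f (deg0_scalable hf)).
apply: (@DGHom A M N g) => [n x hx|x].
  by have := homgh hf hx; rewrite addr0.
by have /subr0_eq := df x.
Defined.

(** A cocycle of the Hom complex is a finite sum of homogeneous ones, so null-homotopies are only
    needed for maps of a fixed degree. *)
Lemma Hom_acyclicP P N : acyclic (Hom_dgMod P N) <->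
  forall n (f : P -> N), hom_deg n f -> (forall x, Dh n f x = 0) ->
  exists2 g : P -> N, hom_deg (n - 1) g & forall x, f x = Dh (n - 1) g x.
Proof.
split=> [/acyclicP h n f hf df|h]; last first.
  apply/acyclicP => z dz; apply: boundary_sum => n.
  set f := gcomp _ n z; have hf : homog (Hom_grading P N) n f by exact: homog_gcomp.
  have df := gcomp_cocycle n dz; rewrite -/f in df.
  have hf' : hom_deg n (val f) by exact/homog_HomP.
  have [g hg fE] : exists2 g : P -> N, hom_deg (n - 1) g & forall x, val f x = Dh (n - 1) g x.
    apply: h => // x; rewrite /Dh -(Hom_difE x hf').
    by rewrite [LHS](congr1 (fun u : Hom P N => val u x) df) raddf0.
  exists (MkHom (is_hom_deg hg)); apply: val_inj; apply/funext => x.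
  by rewrite fE [RHS](Hom_difE (x := MkHom (is_hom_deg hg)) x hg).
pose F : Hom P N := MkHom (is_hom_deg hf).
have hF : homog (dgm_str (Hom_dgMod P N)) n F by exact/homog_HomP.
have dF : dm (Hom_dgMod P N) F = 0.
  apply: val_inj; apply/funext => x.
  by rewrite [LHS](Hom_difE (x := F) x hf) [LHS]df raddf0.
have [y Fy] := h _ dF; have [y' /homog_HomP hy' Fy'] := boundary_homog hF Fy.
exists (val y') => // x.
rewrite [LHS](congr1 (fun u : Hom P N => val u x) Fy').
exact: (Hom_difE (x := y') x hy').
Qed.

End HomCalculus.
Arguments Dh {A P N} n f x.

Lemma pairDE (U V : zmodType) (u v : U * V) : u + v = (u.1 + v.1, u.2 + v.2).
Proof. by []. Qed.

(* Since the shifted copy of M carries the same scalar action, the cone of f is N x M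
   with the sign of the shift moved into the differential, through the parity. *)
Section Cone.
Variables (A : cdgRing) (M N : dgMod A) (f : dgHom M N).
Let C : lmodType A := (N * M)%type.

Definition cone_comp_fun n (c : C) : C := (gcomp (dgm_str N) n c.1, gcomp (dgm_str M) (n + 1) c.2).

Lemma cone_comp_zmod n : zmod_morphism (cone_comp_fun n).
Proof. by move=> x y; rewrite /cone_comp_fun /= !raddfB. Qed.

Definition cone_comp n : {additive C -> C} := mk_additive (cone_comp_zmod n).

Lemma cone_compK m n x : cone_comp m (cone_comp n x) = if m == n then cone_comp n x else 0.
Proof.
rewrite /= /cone_comp_fun /= !gcompK (inj_eq (addIr 1)).
by case: ifP.
Qed.

Lemma cone_comp_sum x : exists2 s : seq int, uniq s & x = \sum_(n <- s) cone_comp n x.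
Proof.
have -> : x = (x.1, 0) + (0, x.2) by rewrite pairDE /= addr0 add0r; case: x.
apply: sum_cover_decompD cone_compK _ _ _ _.
  have [s us xE] := gcomp_sum (dgm_str N) x.1; exists s => //.
  rewrite /= /cone_comp_fun /=.
  rewrite (eq_bigr (fun n => (gcomp (dgm_str N) n x.1, 0))); last by move=> n _; rewrite raddf0.
  rewrite {1}xE; elim/big_rec2: _ => // n y1 y2 _ <-.
  by rewrite pairDE /= addr0.
have [s us xE] := gcomp_sum (dgm_str M) x.2; exists [seq n - 1 | n <- s].
  by rewrite map_inj_uniq //; exact: addIr.
rewrite big_map /= /cone_comp_fun /=.
rewrite (eq_bigr (fun n => (0, gcomp (dgm_str M) n x.2))); last by move=> n _; rewrite raddf0 subrK.
rewrite {1}xE; elim/big_rec2: _ => // n y1 y2 _ <-.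
by rewrite pairDE /= addr0.
Qed.

Definition cone_grading : grading C := Grading cone_compK cone_comp_sum.

Lemma homog_coneP n (c : C) : homog cone_grading n c <-> hmg N n c.1 /\ hmg M (n + 1) c.2.
Proof. by case: c => a b; rewrite /homog /= /cone_comp_fun /=; split=> [[-> ->]|[-> ->]]. Qed.

Definition cone_dif_fun (c : C) : C := (dm N c.1 + f (parity M c.2), dm M c.2).

Lemma cone_dif_zmod : zmod_morphism cone_dif_fun.
Proof.
move=> x y; rewrite /cone_dif_fun /= !raddfB /=.
by rewrite pairDE /= opprD addrACA.
Qed.

Definition cone_dif : {additive C -> C} := mk_additive cone_dif_zmod.

Definition cone_str : dgStruct C.
Proof.
apply: (@DGStruct _ cone_grading cone_dif) => [n x /homog_coneP[h1 h2]|x].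
  apply/homog_coneP; split; last exact: dif_homog.
  apply: homogD; first exact: dif_homog.
  exact/dgh_homog/parity_homog.
rewrite /= /cone_dif_fun /= raddfD !difK add0r -dgh_dif parity_dif raddfN /=.
by rewrite addrN.
Defined.

Definition cone : dgMod A.
Proof.
apply: (@DGMod A C cone_str) => [m n a x ha /homog_coneP[h1 h2]|m a x ha].
  apply/homog_coneP; split; first exact: dgm_homogZ.
  by rewrite -addrA; exact: dgm_homogZ.
rewrite /= /cone_dif_fun /= (dgm_leibniz _ ha) (dgm_leibniz _ ha) (parityZ _ ha) dgHom_ksgn.
rewrite dgHomZ /=.
have kE (u v : C) : u + ksgn m v = (u.1 + ksgn m v.1, u.2 + ksgn m v.2).
  by rewrite /ksgn; case: ifP.
by rewrite kE /= scalerDr ksgnD addrA.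
Defined.

(** The maps [cone_j] and [cone_pi] are cycles; [cone_rho] and [cone_sigma] are only graded, and
    their derivatives recover [f]: they are - f pi and j f. Most arguments about cones use only
    these identities. *)
Definition cone_j (x : N) : cone := (x, 0).
Definition cone_rho (c : cone) : N := c.1.
Definition cone_pi (c : cone) : M := parity M c.2.
Definition cone_sigma (x : M) : cone := (0, parity M x).

Lemma coneDE (u v : cone) : u + v = (u.1 + v.1, u.2 + v.2). Proof. by []. Qed.
Lemma coneksgnE n (u : cone) : ksgn n u = (ksgn n u.1, ksgn n u.2).
Proof. by rewrite /ksgn; case: ifP => //; case: u. Qed.
Lemma coneZE a (u : cone) : a *: u = (a *: u.1, a *: u.2). Proof. by []. Qed.
Lemma cone_difE (u : cone) : dm cone u = (dm N u.1 + f (parity M u.2), dm M u.2).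
Proof. by []. Qed.

Lemma cone_j_deg : hom_deg 0 cone_j.
Proof.
split=> [x y|i x hx|k a x ha]; rewrite /cone_j.
- by rewrite coneDE addr0.
- by apply/homog_coneP; rewrite addr0; split => //; exact: homog0.
- by rewrite mul0r ksgn_id coneZE scaler0.
Qed.

Lemma cone_rho_deg : hom_deg 0 cone_rho.
Proof.
split=> [x y|i x /homog_coneP[hx _]|k a x ha] //; first by rewrite addr0.
by rewrite mul0r.
Qed.

Lemma cone_pi_deg : hom_deg 1 cone_pi.
Proof.
split=> [x y|i x /homog_coneP[_ hx]|k a x ha]; rewrite /cone_pi.
- exact: raddfD.
- exact: parity_homog.
- by rewrite mul1r coneZE (parityZ _ ha).
Qed.

Lemma cone_sigma_deg : hom_deg (-1) cone_sigma.
Proof.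
split=> [x y|i x hx|k a x ha]; rewrite /cone_sigma.
- by rewrite raddfD coneDE addr0.
- by apply/homog_coneP; rewrite subrK; split; [exact: homog0 | exact: parity_homog].
rewrite (parityZ _ ha) coneksgnE coneZE scaler0 ksgn0; congr (_, _).
by apply: ksgn_eq; rewrite mulN1r abszN.
Qed.

Lemma cone_rhoj x : cone_rho (cone_j x) = x. Proof. by []. Qed.
Lemma cone_rhosigma x : cone_rho (cone_sigma x) = 0. Proof. by []. Qed.
Lemma cone_pij x : cone_pi (cone_j x) = 0. Proof. exact: raddf0. Qed.
Lemma cone_pisigma x : cone_pi (cone_sigma x) = x. Proof. exact: parityK. Qed.
Lemma cone_split c : cone_j (cone_rho c) + cone_sigma (cone_pi c) = c.
Proof. by case: c => a b; rewrite coneDE /cone_pi /= parityK addr0 add0r. Qed.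

Lemma Dh_j x : Dh 0 cone_j x = 0.
Proof. by rewrite /Dh cone_difE /= !raddf0 /= addr0 ksgn_id subrr. Qed.
Lemma Dh_rho c : Dh 0 cone_rho c = - f (cone_pi c).
Proof. by rewrite /Dh ksgn_id /cone_rho cone_difE /= opprD addrA subrr add0r. Qed.
Lemma Dh_pi c : Dh 1 cone_pi c = 0.
Proof. by rewrite /Dh /cone_pi cone_difE /= parity_dif /ksgn /= opprK subrr. Qed.
Lemma Dh_sigma x : Dh (-1) cone_sigma x = cone_j (f x).
Proof.
rewrite /Dh /cone_sigma cone_difE /= raddf0 add0r parityK parity_dif.
by rewrite /ksgn /= opprK coneDE addr0 addrN.
Qed.

End Cone.

Section HomTriangle.
Variable A : cdgRing.
Implicit Types P M N L W : dgMod A.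

Lemma hom_deg_compE P N L k m n (g : N -> L) (f : P -> N) : n + m = k ->
  hom_deg m g -> hom_deg n f -> hom_deg k (fun x => g (f x)).
Proof. by move=> <- hg hf; exact: hom_deg_comp hg hf. Qed.

Lemma Dh_compE P N L k m n (g : N -> L) (f : P -> N) x : n + m = k -> hom_deg m g ->
  Dh k (fun x => g (f x)) x = Dh m g (f x) + ksgn m (g (Dh n f x)).
Proof. by move=> <- hg; exact: Dh_comp hg. Qed.

Lemma hom_deg_ksgnE P N k n (f : P -> N) : hom_deg n f ->
  hom_deg n (fun x => ksgn k (f x)).
Proof. by move=> hf; rewrite /ksgn; case: (odd _) => //; exact: hom_degN. Qed.

Section Post.
Variables (P M N : dgMod A) (f : dgHom M N).
Hypothesis aC : acyclic (Hom_dgMod P (cone f)).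
Let hj := cone_j_deg f. Let hrho := cone_rho_deg f.
Let hpi := cone_pi_deg f. Let hsigma := cone_sigma_deg f.

(** If [f v] is the derivative of [u], then sigma v - j u is a cycle with values in the cone. It
    bounds some [w'], and - pi w' bounds [v]. *)
Lemma Hom_cone_inj n (v : P -> M) (u : P -> N) : hom_deg n v -> (forall x, Dh n v x = 0) ->
  hom_deg (n - 1) u -> (forall x, f (v x) = Dh (n - 1) u x) ->
  exists2 u' : P -> M, hom_deg (n - 1) u' & forall x, v x = Dh (n - 1) u' x.
Proof.
move=> hv dv hu fv.
pose w x := cone_sigma f (v x) - cone_j f (u x).
have hs : hom_deg (n - 1) (fun x => cone_sigma f (v x)) by apply: hom_deg_compE hsigma hv.
have hju : hom_deg (n - 1) (fun x => cone_j f (u x)) by apply: hom_deg_compE hj hu; rewrite addr0.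
have dw x : Dh (n - 1) w x = 0.
  rewrite DhB (Dh_compE (n := n) v x _ hsigma) // (Dh_compE (n := n - 1) u x _ hj) ?addr0 //.
  by rewrite dv (homg0 hsigma) ksgn0 addr0 Dh_sigma Dh_j add0r fv subrr.
have [w' hw' wE] := (Hom_acyclicP _ _).1 aC _ w (hom_degB hs hju) dw.
have hpw : hom_deg (n - 1) (fun x => cone_pi (w' x)).
  by apply: hom_deg_compE hpi hw'; rewrite subrK.
exists (fun x => - cone_pi (w' x)) => [|x]; first exact: (hom_degN hpw).
rewrite DhN (Dh_compE (n := n - 1 - 1) w' x _ hpi) ?subrK // Dh_pi add0r -wE /w.
by rewrite (homgB hpi) cone_pij subr0 cone_pisigma /ksgn /= opprK.
Qed.

(** The cycle j w bounds some [c], whose components pi c and rho c are the required [v] and [u]. *)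
Lemma Hom_cone_surj n (w : P -> N) : hom_deg n w -> (forall x, Dh n w x = 0) ->
  exists v : P -> M, exists2 u : P -> N,
  [/\ hom_deg n v, (forall x, Dh n v x = 0) & hom_deg (n - 1) u] &
  forall x, w x = f (v x) + Dh (n - 1) u x.
Proof.
move=> hw dw.
have hjw : hom_deg n (fun x => cone_j f (w x)) by apply: hom_deg_compE hj hw; rewrite addr0.
have djw x : Dh n (fun x => cone_j f (w x)) x = 0.
  by rewrite (Dh_compE (n := n) w x _ hj) ?addr0 // Dh_j dw (homg0 hj) ksgn0 addr0.
have [c hc wE] := (Hom_acyclicP _ _).1 aC _ _ hjw djw.
exists (fun x => cone_pi (c x)), (fun x => cone_rho (c x)); first split.
- by apply: hom_deg_compE hpi hc; rewrite subrK.
- move=> x; rewrite (Dh_compE (n := n - 1) c x _ hpi) ?subrK // Dh_pi add0r -wE cone_pij.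
  by rewrite ksgn0.
- by apply: hom_deg_compE hrho hc; rewrite addr0.
move=> x; rewrite (Dh_compE (n := n - 1) c x _ hrho) ?addr0 // Dh_rho -wE cone_rhoj.
by rewrite addrA subrr add0r.
Qed.

End Post.

Section Pre.
Variables (M N W : dgMod A) (f : dgHom M N).
Let hj := cone_j_deg f. Let hrho := cone_rho_deg f.
Let hpi := cone_pi_deg f. Let hsigma := cone_sigma_deg f.
Let hf := dgHom_deg f.

(** A primitive [b1] is found first on the summand [N]. What remains on the summand [M] is [v], a
    cycle because the derivative of [cone_sigma] is [cone_j] after [f]; its primitive [b2] completes
    the homotopy. *)
Lemma acyclic_Hom_cone : acyclic (Hom_dgMod M W) -> acyclic (Hom_dgMod N W) ->
  acyclic (Hom_dgMod (cone f) W).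
Proof.
move=> /Hom_acyclicP aM /Hom_acyclicP aN; apply/Hom_acyclicP => n u hu du.
have huj : hom_deg n (fun x => u (cone_j f x)) by apply: hom_deg_compE hu hj; rewrite add0r.
have [|b1 hb1 ujE] := aN _ _ huj.
  by move=> x; rewrite (Dh_compE (n := 0) _ x _ hu) ?add0r // Dh_j du (homg0 hu) ksgn0 addr0.
pose v x := u (cone_sigma f x) + ksgn (n - 1) (b1 (f x)).
have hv : hom_deg (n - 1) v.
  apply: hom_degD; first by apply: hom_deg_compE hu hsigma; rewrite addrC.
  by apply: (hom_deg_ksgnE (n - 1)); apply: hom_deg_compE hb1 hf; rewrite add0r.
have [|b2 hb2 vE] := aM _ _ hv.
  move=> x; rewrite DhD (Dh_compE (n := -1) _ x _ hu) 1?addrC // du add0r Dh_sigma.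
  rewrite Dh_ksgn (Dh_compE (n := 0) _ x _ hb1) ?add0r // -ujE (Dh_dgHom f) //.
  by rewrite (homg0 hb1) ksgn0 addr0 ksgn1B addNr.
have h1 : hom_deg (n - 1) (fun c => b1 (@cone_rho _ _ _ f c)).
  by apply: hom_deg_compE hb1 hrho; rewrite add0r.
have h2 : hom_deg (n - 1) (fun c => b2 (@cone_pi _ _ _ f c)).
  by apply: hom_deg_compE hb2 hpi; rewrite addrC subrK.
exists (fun c => b1 (cone_rho c) + b2 (cone_pi c)) => [|c]; first exact: hom_degD h1 h2.
rewrite DhD (Dh_compE (n := 0) _ c _ hb1) ?add0r // -ujE Dh_rho.
rewrite (Dh_compE (n := 1) _ c _ hb2) 1?addrC ?subrK // -vE /v Dh_pi (homg0 hb2) ksgn0 addr0.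
rewrite (homgN hb1) ksgnN -{1}[c]cone_split (homgD hu) -!addrA.
by rewrite [X in _ = _ + X]addrCA addrN addr0 addrC.
Qed.

Hypothesis aC : acyclic (Hom_dgMod (cone f) W).

Lemma pre_cone_inj n (x : N -> W) (y : M -> W) : hom_deg n x -> (forall z, Dh n x z = 0) ->
  hom_deg (n - 1) y -> (forall z, x (f z) = Dh (n - 1) y z) ->
  exists2 v : N -> W, hom_deg (n - 1) v & forall z, x z = Dh (n - 1) v z.
Proof.
move=> hx dx hy xf; pose w c := x (@cone_rho _ _ _ f c) + ksgn n (y (cone_pi c)).
have hw : hom_deg n w.
  apply: hom_degD; first by apply: hom_deg_compE hx hrho; rewrite add0r.
  by apply: (hom_deg_ksgnE n); apply: hom_deg_compE hy hpi; rewrite addrC subrK.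
have [|v hv wE] := (Hom_acyclicP _ _).1 aC _ _ hw.
  move=> c; rewrite DhD (Dh_compE (n := 0) _ c _ hx) ?add0r // dx add0r Dh_rho.
  rewrite Dh_ksgn (Dh_compE (n := 1) _ c _ hy) 1?addrC ?subrK // -xf Dh_pi (homg0 hy).
  by rewrite ksgn0 addr0 (homgN hx) ksgnN addrN.
exists (fun z => v (cone_j f z)); first by apply: hom_deg_compE hv hj; rewrite add0r.
move=> z; rewrite (Dh_compE (n := 0) _ z _ hv) ?add0r // -wE /w cone_pij (homg0 hy).
by rewrite Dh_j (homg0 hv) !ksgn0 !addr0.
Qed.

Lemma pre_cone_surj n (y : M -> W) : hom_deg n y -> (forall z, Dh n y z = 0) ->
  exists x : N -> W, exists2 v : M -> W,
  [/\ hom_deg n x, (forall z, Dh n x z = 0) & hom_deg (n - 1) v] &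
  forall z, y z = x (f z) + Dh (n - 1) v z.
Proof.
move=> hy dy.
have hyp : hom_deg (n + 1) (fun c => y (@cone_pi _ _ _ f c)).
  by apply: hom_deg_compE hy hpi; rewrite addrC.
have [|w] := (Hom_acyclicP _ _).1 aC _ _ hyp.
  move=> c; rewrite (Dh_compE (n := 1) _ c _ hy) 1?addrC // dy Dh_pi (homg0 hy).
  by rewrite ksgn0 addr0.
rewrite addrK => hw wE.
have hwj : hom_deg n (fun z => ksgn n (w (cone_j f z))).
  by apply: (hom_deg_ksgnE n); apply: hom_deg_compE hw hj; rewrite add0r.
exists (fun z => - ksgn n (w (cone_j f z))), (fun z => w (cone_sigma f z)); first split.
- exact: hom_degN hwj.
- move=> z; rewrite DhN Dh_ksgn (Dh_compE (n := 0) _ z _ hw) ?add0r // -wE cone_pij Dh_j.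
  by rewrite (homg0 hy) (homg0 hw) ksgn0 addr0 ksgn0 oppr0.
- by apply: hom_deg_compE hw hsigma; rewrite addrC.
move=> z; rewrite (Dh_compE (n := -1) _ z _ hw) 1?addrC // -wE cone_pisigma Dh_sigma.
by rewrite addrK.
Qed.

End Pre.

Lemma cone_acyclic M N (f : dgHom M N) : quasi_iso f -> acyclic (cone f).
Proof.
move=> /quasi_isoP[inj sur]; apply/acyclicP => c; rewrite cone_difE => -[dc1 dc2].
have [x c2E] : exists x, c.2 = dm M x.
  apply: (inj _ (parity N c.1)) => //.
  apply: (can_inj (@parityK _ N)); move/eqP: dc1; rewrite addr_eq0 => /eqP dc1.
  have fp y : parity N (f y) = f (parity M y).
    elim/(homog_ind (X := dgm_str M)): y => [y z IHy IHz|i y hy].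
      by rewrite !raddfD IHy IHz.
    by rewrite (parityE hy) (parityE (dgh_homog f hy)) dgHom_ksgn.
  by rewrite fp parity_dif parityK dc1 opprK.
(* Subtracting the differential of (0, x) kills the second entry and leaves a cocycle of [N] in the
   first. *)
have [|z [y [dz wE]]] := sur (c.1 - f (parity M x)).
  rewrite raddfB -dgh_dif; move/eqP: dc1; rewrite addr_eq0 => /eqP ->.
  by rewrite c2E parity_dif dgHomN opprK subrr.
exists (y, parity M z + x); rewrite cone_difE /= !raddfD -c2E parityK.
have -> : dm M (parity M z) = 0 by rewrite -[LHS]opprK -parity_dif dz raddf0 oppr0.
rewrite addrA [dm N y + _]addrC -wE subrK add0r.
by rewrite -surjective_pairing.
Qed.

(** With the next lemma: maps out of a K-projective module see a quasi-isomorphism as a bijection on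
    homotopy classes, since Hom into its acyclic cone is acyclic. *)
Lemma Hom_post_inj P M N (f : dgHom M N) : K_projective P -> quasi_iso f ->
  forall n (v : P -> M) (u : P -> N), hom_deg n v -> (forall x, Dh n v x = 0) ->
  hom_deg (n - 1) u -> (forall x, f (v x) = Dh (n - 1) u x) ->
  exists2 u' : P -> M, hom_deg (n - 1) u' & forall x, v x = Dh (n - 1) u' x.
Proof. by move=> kP /cone_acyclic/kP; exact: Hom_cone_inj. Qed.

Lemma Hom_post_surj P M N (f : dgHom M N) : K_projective P -> quasi_iso f ->
  forall n (w : P -> N), hom_deg n w -> (forall x, Dh n w x = 0) ->
  exists v : P -> M, exists2 u : P -> N,
  [/\ hom_deg n v, (forall x, Dh n v x = 0) & hom_deg (n - 1) u] &
  forall x, w x = f (v x) + Dh (n - 1) u x.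
Proof. by move=> kP /cone_acyclic/kP; exact: Hom_cone_surj. Qed.

Lemma cone_K_projective M N (f : dgHom M N) : K_projective M -> K_projective N ->
  K_projective (cone f).
Proof. by move=> kM kN W aW; apply: acyclic_Hom_cone; [exact: kM | exact: kN]. Qed.

(** The maps [j] and [r] lift to maps [J] and [R] between the resolutions, and R J is homotopic to
    the identity because it is so after the quasi-isomorphism [e']. Thus a cycle [c] on [S] is
    homotopic to c R J, and c R bounds. *)
Lemma acyclic_Hom_retract (S T Y Z W : dgMod A) (e : dgHom T Y) (e' : dgHom S Z)
    i (j : Z -> Y) (r : Y -> Z) :
  K_projective T -> K_projective S -> quasi_iso e -> quasi_iso e' ->
  hom_deg i j -> hom_deg (- i) r -> (forall x, Dh i j x = 0) -> (forall x, Dh (- i) r x = 0) ->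
  cancel j r -> acyclic (Hom_dgMod T W) -> acyclic (Hom_dgMod S W).
Proof.
move=> kT kS qe qe' hj hr dj dr jr /Hom_acyclicP aT; apply/Hom_acyclicP => n c hc dc.
have he := dgHom_deg e; have he' := dgHom_deg e'.
have hje : hom_deg i (fun s => j (e' s)) by apply: hom_deg_compE hj he'; rewrite add0r.
have [|J [u [hJ dJ hu] JE]] := Hom_post_surj kS qe hje.
  by move=> x; rewrite (Dh_compE (n := 0) _ x _ hj) ?add0r // dj Dh_dgHom // (homg0 hj) ksgn0 addr0.
have hre : hom_deg (- i) (fun t => r (e t)) by apply: hom_deg_compE hr he; rewrite add0r.
have [|R [v [hR dR hv] RE]] := Hom_post_surj kT qe' hre.
  by move=> x; rewrite (Dh_compE (n := 0) _ x _ hr) ?add0r // dr Dh_dgHom // (homg0 hr) ksgn0 addr0.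
pose RJ s := R (J s) - s.
have hRJ0 : hom_deg 0 (fun s => R (J s)) by apply: hom_deg_compE hR hJ; rewrite subrr.
have hRJ : hom_deg 0 RJ.
  by apply: (hom_degB hRJ0); split=> // [k x|k a x _]; rewrite ?addr0 ?mul0r.
have dRJ0 x : Dh 0 (fun s => R (J s)) x = 0.
  by rewrite (Dh_compE (n := i) _ x _ hR) ?subrr // dR dJ (homg0 hR) ksgn0 addr0.
have did x : Dh 0 (fun s : S => s) x = 0 by rewrite /Dh ksgn_id subrr.
have hvJ : hom_deg (0 - 1) (fun s => v (J s)) by apply: hom_deg_compE hv hJ; lia.
have hru : hom_deg (0 - 1) (fun s => ksgn (- i) (r (u s))).
  by apply: (hom_deg_ksgnE (- i)); apply: hom_deg_compE hr hu; lia.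
have hh : hom_deg (0 - 1) (fun s => - v (J s) - ksgn (- i) (r (u s))).
  exact: hom_degB (hom_degN hvJ) hru.
(* The homotopy after [e'] collects the defects of both lifts: [v] evaluated at [J], and [u] pushed
   through [r]. *)
have [|x|b hb bE] := Hom_post_inj kS qe' hRJ _ hh.
- by move=> x; rewrite DhB dRJ0 did subrr.
- rewrite DhB DhN Dh_ksgn (Dh_compE (n := i) _ x _ hv); last by lia.
  rewrite (Dh_compE (n := i - 1) _ x _ hr); last by lia.
  rewrite dr add0r ksgnK dJ (homg0 hv) ksgn0 addr0 /RJ dgHomB.
  have -> : e' (R (J x)) = r (e (J x)) - Dh (- i - 1) v (J x) by rewrite RE addrK.
  have -> : e (J x) = j (e' x) - Dh (i - 1) u x by rewrite JE addrK.
  by rewrite (homgB hr) jr addrAC [_ - _ - e' x]addrAC subrr add0r addrC.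
have hcR : hom_deg (n - i) (fun t => c (R t)) by apply: hom_deg_compE hc hR; rewrite addrC.
have [|d hd dE] := aT _ _ hcR.
  move=> x; rewrite (Dh_compE (n := - i) _ x _ hc); last by rewrite addrC.
  by rewrite dc dR (homg0 hc) ksgn0 addr0.
have h1 : hom_deg (n - 1) (fun s => d (J s)) by apply: hom_deg_compE hd hJ; lia.
have h2 : hom_deg (n - 1) (fun s => ksgn n (c (b s))).
  by apply: (hom_deg_ksgnE n); apply: hom_deg_compE hc hb; lia.
exists (fun s => d (J s) - ksgn n (c (b s))) => [|s]; first exact: hom_degB h1 h2.
rewrite DhB Dh_ksgn (Dh_compE (n := i) _ s _ hd); last by lia.
rewrite (Dh_compE (n := 0 - 1) _ s _ hc); last by lia.
rewrite dJ (homg0 hd) ksgn0 addr0 dc add0r ksgnK -dE -bE /RJ (homgB hc).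
by rewrite opprB addrCA subrr addr0.
Qed.

Lemma acyclic_Hom_indep (S T M W : dgMod A) (e : dgHom T M) (e' : dgHom S M) :
  K_projective T -> K_projective S -> quasi_iso e -> quasi_iso e' ->
  acyclic (Hom_dgMod T W) -> acyclic (Hom_dgMod S W).
Proof.
move=> kT kS qe qe'.
have h0 : hom_deg 0 (fun s : M => s) by split=> // [k x|k a x _]; rewrite ?addr0 ?mul0r.
apply: (acyclic_Hom_retract kT kS qe qe' h0 h0) => //.
- by move=> x; rewrite /Dh ksgn_id subrr.
- by move=> x; rewrite /Dh ksgn_id subrr.
Qed.

End HomTriangle.

(** * Tensor products *)

Section TensorMaps.
Variable A : cdgRing.
Implicit Types M N G P : dgMod A.

Lemma pure_dif M N l (p : M) (q : N) : hmg M l p ->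
  dm (tensor_dgMod M N) (pure p q) = pure (dm M p) q + ksgn l (pure p (dm N q)).
Proof. exact: tensor_difE. Qed.

Lemma pureZ M N a (p : M) (q : N) : a *: (pure p q : tensor_dgMod M N) = pure (a *: p) q.
Proof. exact: tensor_scaleE. Qed.

Lemma pureBl M N (p p' : M) (q : N) : pure (p - p') q = pure p q - pure p' q.
Proof. by rewrite pureDl pureNl. Qed.

Section Left.
Variables (M N G : dgMod A).

(** This is u (x) id; no sign occurs, as [u] acts on the left factor. It takes a bare function and
    is meaningful once [u] has a degree. *)
Definition tmap (u : M -> N) : tensor M G -> tensor N G :=
  tensor_lift (fun p q => pure (u p) q).

Variables (n : int) (u : M -> N).
Hypothesis hu : hom_deg n u.

Lemma tmap_Dl q : {morph (fun p => pure (u p) q : tensor N G) : x y / x + y}.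
Proof. by move=> x y; rewrite (homgD hu) pureDl. Qed.
Lemma tmap_Dr p : {morph (fun q : G => pure (u p) q) : x y / x + y}.
Proof. exact: pureDr. Qed.
Lemma tmap_bal k l (a : A) p (q : G) : homog (dgr_str A) k a -> hmg M l p ->
  pure (u p) (a *: q) = ksgn (k * l) (pure (u (a *: p)) q).
Proof.
move=> ha hp; rewrite (pure_bal _ ha (homgh hu hp)) (homgZ hu _ ha) pure_ksgnl ksgn_comp.
by apply: ksgn_eq; rewrite mulrDr [n * k]mulrC !odd_abszD addbC.
Qed.

Definition tmapA : {additive tensor M G -> tensor N G} :=
  tensor_liftA tmap_Dl tmap_Dr tmap_bal.

Lemma tmap_pure p q : tmap u (pure p q) = pure (u p) q.
Proof. exact: (tensor_liftE tmap_Dl tmap_Dr tmap_bal). Qed.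
Lemma tmapD x y : tmap u (x + y) = tmap u x + tmap u y.
Proof. exact: (raddfD tmapA). Qed.
Lemma tmap0 : tmap u 0 = 0. Proof. exact: (raddf0 tmapA). Qed.
Lemma tmapB x y : tmap u (x - y) = tmap u x - tmap u y.
Proof. exact: (raddfB tmapA). Qed.
Lemma tmap_ksgn k x : tmap u (ksgn k x) = ksgn k (tmap u x).
Proof. exact: (raddf_ksgn tmapA). Qed.

End Left.

Lemma tmap_homog M N G n (u : M -> N) : hom_deg n u -> forall i t,
  hmg (tensor_dgMod M G) i t -> hmg (tensor_dgMod N G) (i + n) (tmap u t).
Proof.
move=> hu; apply: tensor_homog_ind => [i x y hx hy|i|l r p q hp hq].
- by rewrite (tmapD hu); exact: homogD.
- by rewrite (tmap0 _ hu); exact: homog0.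
rewrite (tmap_pure hu) addrAC; apply: homog_pure hq; exact: homgh hp.
Qed.

Lemma tmap_dif M N G n (u : M -> N) (t : tensor_dgMod M G) : hom_deg n u ->
  dm (tensor_dgMod N G) (tmap u t) =
  tmap (Dh n u) t + ksgn n (tmap u (dm (tensor_dgMod M G) t)).
Proof.
move=> hu; have hd := Dh_deg hu.
elim/tensor_ind: t => [x y IHx IHy|l r p q hp hq].
  rewrite (tmapD hu) [LHS]raddfD IHx IHy (tmapD hd) [dm _ (_ + _)]raddfD (tmapD hu) ksgnD.
  exact: addrACA.
rewrite (tmap_pure hu) (pure_dif _ (homgh hu hp)) (tmap_pure hd) (pure_dif _ hp).
rewrite (tmapD hu) (tmap_pure hu) (tmap_ksgn hu) (tmap_pure hu) /Dh pureBl pure_ksgnl.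
by rewrite ksgnD ksgn_comp [n + l]addrC addrA subrK.
Qed.

Lemma tmap_comp M N P G m n (v : N -> P) (u : M -> N) t : hom_deg n u -> hom_deg m v ->
  tmap v (tmap u t : tensor N G) = tmap (fun x => v (u x)) t.
Proof.
move=> hu hv; have hvu : hom_deg (n + m) (fun x => v (u x)) by exact: hom_deg_comp.
elim/tensor_ind: t => [x y IHx IHy|l r p q hp hq].
  by rewrite (tmapD hu) (tmapD hv) (tmapD hvu) IHx IHy.
by rewrite (tmap_pure hu) (tmap_pure hv) (tmap_pure hvu).
Qed.

Lemma tmap_id M G (u : M -> M) (t : tensor M G) : u =1 id -> tmap u t = t.
Proof.
move=> uid; have -> : u = id by apply/funext.
have h0 : hom_deg 0 (@id M) by split=> // [k x|k a x _]; rewrite ?addr0 ?mul0r.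
by elim/tensor_ind: t => [x y IHx IHy|l r p q hp hq];
  rewrite ?(tmapD h0) ?(tmap_pure h0) ?IHx ?IHy.
Qed.

Lemma tmap_eq0 M N G (u : M -> N) (t : tensor M G) : u =1 (fun=> 0) -> tmap u t = 0.
Proof.
move=> u0; have -> : u = (fun=> 0) by apply/funext.
have h0 : hom_deg 0 (fun _ : M => 0 : N).
  by split=> [x y|i x _|k a x _]; rewrite ?addr0 ?scaler0 ?ksgn0 //; exact: homog0.
elim/tensor_ind: t => [x y IHx IHy|l r p q hp hq].
  by rewrite (tmapD h0) IHx IHy addr0.
by rewrite (tmap_pure h0) pure0l.
Qed.

Lemma tmap_add M N G n (u v : M -> N) (t : tensor M G) : hom_deg n u -> hom_deg n v ->
  tmap (fun x => u x + v x) t = tmap u t + tmap v t.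
Proof.
move=> hu hv; have huv : hom_deg n (fun x => u x + v x) by exact: hom_degD hu hv.
elim/tensor_ind: t => [x y IHx IHy|l r p q hp hq].
  by rewrite (tmapD hu) (tmapD hv) (tmapD huv) IHx IHy addrACA.
by rewrite (tmap_pure hu) (tmap_pure hv) (tmap_pure huv) pureDl.
Qed.

Lemma tmapZ M N G (f : dgHom M N) a (t : tensor_dgMod M G) :
  tmap f (a *: t) = a *: (tmap f t : tensor_dgMod N G).
Proof.
have hf := dgHom_deg f; elim/tensor_ind: t => [x y IHx IHy|l r p q hp hq].
  by rewrite scalerDr !(tmapD hf) IHx IHy scalerDr.
by rewrite pureZ !(tmap_pure hf) pureZ dgHomZ.
Qed.

Definition tensor_l M N (f : dgHom M N) G : dgHom (tensor_dgMod M G) (tensor_dgMod N G).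
Proof.
pose g : {linear tensor_dgMod M G -> tensor_dgMod N G} := HB.pack (tmap f)
  (GRing.isZmodMorphism.Build _ _ (tmap f) (zmod_morphD (tmapD (dgHom_deg f))))
  (GRing.isScalable.Build A _ _ *:%R (tmap f) (@tmapZ M N G f)).
apply: (@DGHom A _ _ g) => [n x hx|x].
  by have := tmap_homog (dgHom_deg f) hx; rewrite addr0.
have := tmap_dif x (dgHom_deg f); rewrite (@tmap_eq0 _ _ _ (Dh 0 f)) ?add0r => [->//|y].
exact: Dh_dgHom.
Defined.

Lemma tensor_lE M N (f : dgHom M N) G t : tensor_l f G t = tmap f t.
Proof. by []. Qed.

(** The maps of the cone tensored with [G] satisfy the same identities, so the chase is that of
    [Hom_cone_inj] and [Hom_cone_surj] with [tmap] in place of composition. *)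
Lemma tensor_cone_qi M N (f : dgHom M N) G :
  acyclic (tensor_dgMod (cone f) G) -> quasi_iso (tensor_l f G).
Proof.
have hj := cone_j_deg f; have hrho := cone_rho_deg f.
have hpi := cone_pi_deg f; have hsigma := cone_sigma_deg f; have hf := dgHom_deg f.
move=> /acyclicP aC; apply/quasi_isoP; split=> [x y dx fx|y dy].
  pose w := tmap (cone_sigma f) x - tmap (cone_j f) y.
  have [|v wE] := aC w.
    rewrite raddfB (tmap_dif x hsigma) (tmap_dif y hj) dx (tmap0 _ hsigma) ksgn0 addr0.
    rewrite (tmap_eq0 _ (Dh_j f)) add0r -fx tensor_lE (tmap_comp _ hf hj).
    by rewrite (_ : Dh _ _ = fun x => cone_j f (f x)) ?subrr //; apply/funext/Dh_sigma.
  exists (- tmap (@cone_pi _ _ _ f) v); rewrite raddfN (tmap_dif v hpi).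
  rewrite (tmap_eq0 _ (Dh_pi (f := f))) add0r -wE /w (tmapB hpi) (tmap_comp _ hsigma hpi).
  rewrite (tmap_comp _ hj hpi) (tmap_eq0 _ (cone_pij f)) subr0.
  by rewrite (tmap_id _ (cone_pisigma f)) /ksgn /= opprK.
have [|w jy] := aC (tmap (cone_j f) y).
  by rewrite (tmap_dif y hj) (tmap_eq0 _ (Dh_j f)) add0r dy (tmap0 _ hj).
exists (tmap (@cone_pi _ _ _ f) w), (tmap (@cone_rho _ _ _ f) w); split.
  rewrite (tmap_dif w hpi) (tmap_eq0 _ (Dh_pi (f := f))) add0r -jy (tmap_comp _ hj hpi).
  by rewrite (tmap_eq0 _ (cone_pij f)) ksgn0.
rewrite tensor_lE (tmap_comp _ hpi hf) (tmap_dif w hrho) -jy (tmap_comp _ hj hrho).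
rewrite (tmap_id _ (cone_rhoj f)) ksgn_id addrA -[LHS]add0r; congr (_ + _).
have hfp : hom_deg 1 (fun c => f (@cone_pi _ _ _ f c)) by exact: hom_deg_compE hf hpi.
have hd : hom_deg 1 (Dh 0 (@cone_rho _ _ _ f)) by exact: Dh_deg hrho.
rewrite -(tmap_add _ hfp hd) tmap_eq0 // => c; rewrite Dh_rho; exact: subrr.
Qed.

Section Swap.
Variables M N : dgMod A.

(** The sign (-1)^(|p||q|) depends on both degrees, so both arguments are split into homogeneous
    components. *)
Let b (p : M) (q : N) : tensor N M :=
  gsum (dgm_str M) (fun i p' => gsum (dgm_str N) (fun j q' => ksgn (i * j) (pure q' p')) q) p.

Let bD1 p i : {morph (fun q' : N => ksgn i (pure q' p) : tensor N M) : x y / x + y}.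
Proof. by move=> x y; rewrite pureDl ksgnD. Qed.

Let bD2 q i : {morph (fun p' : M => gsum (dgm_str N) (fun j q' => ksgn (i * j) (pure q' p')) q)
  : x y / x + y}.
Proof.
move=> x y; rewrite /gsum -big_split; apply: eq_bigr => j _.
by rewrite pureDr ksgnD.
Qed.

Lemma swap_Dl q : {morph b^~ q : x y / x + y}.
Proof. exact: (gsumD (dgm_str M) (@bD2 q)). Qed.

Lemma swap_Dr p : {morph b p : x y / x + y}.
Proof.
move=> x y; rewrite /b /gsum -big_split; apply: eq_bigr => i _.
exact: (gsumD (dgm_str N) (fun j => @bD1 _ (i * j))).
Qed.

Lemma swap_b l r p q : hmg M l p -> hmg N r q -> b p q = ksgn (l * r) (pure q p).
Proof.
move=> hp hq; rewrite /b (gsum_homog (@bD2 q) hp).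
exact: (gsum_homog (fun j => @bD1 p (l * j)) hq).
Qed.

Lemma swap_bal k l (a : A) p q : homog (dgr_str A) k a -> hmg M l p ->
  b p (a *: q) = ksgn (k * l) (b (a *: p) q).
Proof.
move=> ha hp; elim/(homog_ind (X := dgm_str N)): q => [x y IHx IHy|r q hq].
  by rewrite scalerDr !swap_Dr IHx IHy ksgnD.
rewrite (swap_b hp (dgm_homogZ ha hq)) (swap_b (dgm_homogZ ha hp) hq).
rewrite (pure_bal _ ha hq) !ksgn_comp; apply: ksgn_eq; lia.
Qed.

Definition swap_fun : {additive tensor M N -> tensor N M} :=
  tensor_liftA swap_Dl swap_Dr swap_bal.

Definition swap_map : tensor_dgMod M N -> tensor_dgMod N M := swap_fun.

Lemma swap_pure l r p q : hmg M l p -> hmg N r q ->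
  swap_map (pure p q) = ksgn (l * r) (pure q p).
Proof.
by move=> hp hq; rewrite -(swap_b hp hq); exact: (tensor_liftE swap_Dl swap_Dr swap_bal).
Qed.

Lemma swapD x y : swap_map (x + y) = swap_map x + swap_map y.
Proof. exact: (raddfD swap_fun). Qed.

Lemma swapB : zmod_morphism swap_map.
Proof. exact: zmod_morphD swapD. Qed.

Lemma swap_ksgn k x : swap_map (ksgn k x) = ksgn k (swap_map x).
Proof. exact: (raddf_ksgn swap_fun). Qed.

Lemma swapZ : scalable swap_map.
Proof.
move=> a t; elim/tensor_ind: t => [x y IHx IHy|l r p q hp hq].
  by rewrite scalerDr !swapD IHx IHy scalerDr.
elim/(homog_ind (X := dgr_str A)): a => [x y IHx IHy|k a ha].
  by rewrite !scalerDl swapD IHx IHy.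
rewrite pureZ (swap_pure (dgm_homogZ ha hp) hq) (swap_pure hp hq) (pure_bal _ ha hq).
rewrite scaler_ksgn pureZ ksgn_comp; apply: ksgn_eq; lia.
Qed.

Lemma swap_homog n x : hmg (tensor_dgMod M N) n x -> hmg (tensor_dgMod N M) n (swap_map x).
Proof.
move: n x; apply: tensor_homog_ind => [n x y hx hy|n|l r p q hp hq].
- by rewrite swapD; exact: homogD.
- by rewrite [swap_map 0](raddf0 swap_fun); exact: homog0.
rewrite (swap_pure hp hq); apply: homog_ksgn; rewrite addrC; exact: homog_pure.
Qed.

Lemma swap_dif x : swap_map (dm (tensor_dgMod M N) x) = dm (tensor_dgMod N M) (swap_map x).
Proof.
elim/tensor_ind: x => [x y IHx IHy|l r p q hp hq].
  by rewrite raddfD !swapD IHx IHy raddfD.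
rewrite (pure_dif _ hp) swapD swap_ksgn (swap_pure (dif_homog hp) hq).
rewrite (swap_pure hp (dif_homog hq)) (swap_pure hp hq) raddf_ksgn (pure_dif _ hq) ksgnD.
rewrite !ksgn_comp addrC; congr (_ + _); apply: ksgn_eq; lia.
Qed.

Definition swap : dgHom (tensor_dgMod M N) (tensor_dgMod N M).
Proof.
pose g : {linear tensor_dgMod M N -> tensor_dgMod N M} := HB.pack swap_map
  (GRing.isZmodMorphism.Build _ _ swap_map swapB)
  (GRing.isScalable.Build A _ _ *:%R swap_map swapZ).
by apply: (@DGHom A _ _ g) => [n x|x]; [exact: swap_homog | exact: swap_dif].
Defined.

Lemma swapE t : swap t = swap_map t. Proof. by []. Qed.

End Swap.

Lemma swapK M N : cancel (swap M N) (swap N M).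
Proof.
move=> t; rewrite !swapE; elim/tensor_ind: t => [x y IHx IHy|l r p q hp hq].
  by rewrite !swapD IHx IHy.
rewrite (swap_pure hp hq) swap_ksgn (swap_pure hq hp) ksgn_comp.
by rewrite (@ksgn_eq _ _ 0) //; lia.
Qed.

Lemma swap_qi M N : quasi_iso (swap M N).
Proof.
apply: (@iso_qi _ _ _ _ (swap N M)); [|exact: dgHom0|exact: swapK|exact: swapK].
by move=> x; rewrite dgh_dif.
Qed.

Lemma acyclic_tensorC M N : acyclic (tensor_dgMod M N) <-> acyclic (tensor_dgMod N M).
Proof. exact: acyclic_qi (swap_qi M N). Qed.

Lemma acyclic_swap M N : acyclic (tensor_dgMod M N) -> acyclic (tensor_dgMod N M).
Proof. by rewrite acyclic_tensorC. Qed.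

Lemma K_flat_qi_l M N (f : dgHom M N) P : K_flat P -> quasi_iso f ->
  quasi_iso (tensor_l f P).
Proof. by move=> kP /cone_acyclic aC; apply/tensor_cone_qi/acyclic_swap/kP. Qed.

Lemma K_flat_acyclic M N (f : dgHom M N) P : K_flat P -> quasi_iso f ->
  acyclic (tensor_dgMod M P) <-> acyclic (tensor_dgMod N P).
Proof. by move=> kP qf; apply: acyclic_qi (K_flat_qi_l kP qf). Qed.

Definition comp_dgHom M N P (g : dgHom N P) (f : dgHom M N) : dgHom M P.
Proof.
apply: (@DGHom A M P (dgh_fun g \o dgh_fun f)) => [n x hx|x] /=.
  exact/dgh_homog/dgh_homog.
by rewrite !dgh_dif.
Defined.

Lemma comp_qi M N P (g : dgHom N P) (f : dgHom M N) :
  quasi_iso f -> quasi_iso g -> quasi_iso (comp_dgHom g f).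
Proof.
move=> /quasi_isoP[fi fs] /quasi_isoP[gi gs]; apply/quasi_isoP.
split=> [z y dz gfz|w dw].
  by have [|x /fi] := gi (f z) y _ gfz; [rewrite -dgh_dif dz raddf0 | apply].
have [z [y [dz ->]]] := gs _ dw; have [x [u [dx ->]]] := fs _ dz.
exists x, (g u + y); split=> //.
by rewrite dgHomD dgh_dif raddfD addrA.
Qed.

Definition tensor_r M N (f : dgHom M N) P : dgHom (tensor_dgMod P M) (tensor_dgMod P N) :=
  comp_dgHom (swap N P) (comp_dgHom (tensor_l f P) (swap P M)).

Lemma K_flat_qi_r M N (f : dgHom M N) P : K_flat P -> quasi_iso f ->
  quasi_iso (tensor_r f P).
Proof.
move=> kP qf; apply: comp_qi (swap_qi _ _); apply: comp_qi; first exact: swap_qi.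
exact: K_flat_qi_l.
Qed.

End TensorMaps.

(** * Associativity of the tensor product *)

Section Assoc.
Variable A : cdgRing.
Variables X Y Z : dgMod A.
Local Notation sA := (dgr_str A).
Local Notation XY := (tensor_dgMod X Y).
Local Notation YZ := (tensor_dgMod Y Z).

Let b1 (z : Z) (x : X) (y : Y) : tensor_dgMod X YZ := pure x (pure y z : YZ).

Let b1Dl z y : {morph (b1 z)^~ y : u v / u + v}.
Proof. by move=> u v; exact: pureDl. Qed.
Let b1Dr z x : {morph b1 z x : u v / u + v}.
Proof. by move=> u v; rewrite /b1 pureDl pureDr. Qed.
Let b1_bal z k l (a : A) x y : homog sA k a -> hmg X l x ->
  b1 z x (a *: y) = ksgn (k * l) (b1 z (a *: x) y).
Proof. by move=> ha hx; rewrite /b1 -[pure (a *: y) z]pureZ (pure_bal _ ha hx). Qed.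

Let b2 (t : XY) (z : Z) := tensor_lift (b1 z) t.

Let b2_pure x y z : b2 (pure x y) z = pure x (pure y z : YZ).
Proof. exact: (tensor_liftE (b1Dl z) (b1Dr z) (b1_bal z)). Qed.
Let b2Dl z : {morph b2^~ z : u v / u + v}.
Proof. exact: (raddfD (tensor_liftA (b1Dl z) (b1Dr z) (b1_bal z))). Qed.
Let b2Dr t : {morph b2 t : u v / u + v}.
Proof.
move=> u v; elim/tensor_ind: t => [x y IHx IHy|l r p q hp hq].
  by rewrite !b2Dl IHx IHy addrACA.
by rewrite !b2_pure pureDr pureDr.
Qed.
Let b2_bal k l (a : A) t z : homog sA k a -> hmg XY l t ->
  b2 t (a *: z) = ksgn (k * l) (b2 (a *: t) z).
Proof.
move=> ha; move: l t; apply: tensor_homog_ind => [n x y hx hy|n|l r p q hp hq].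
- by rewrite scalerDr !b2Dl hx hy ksgnD.
- rewrite scaler0; have b20 z' : b2 0 z' = 0 by apply: (addIr (b2 0 z')); rewrite -b2Dl !add0r.
  by rewrite !b20 ksgn0.
rewrite pureZ !b2_pure (pure_bal _ ha hq) pure_ksgnr -pureZ (pure_bal _ ha hp) ksgn_comp.
by apply: ksgn_eq; lia.
Qed.

Definition assoc_fun : {additive tensor XY Z -> tensor X YZ} := tensor_liftA b2Dl b2Dr b2_bal.

Lemma assoc_pure x y z : assoc_fun (pure (pure x y : XY) z) = pure x (pure y z : YZ).
Proof. by rewrite -b2_pure; exact: (tensor_liftE b2Dl b2Dr b2_bal). Qed.

Let c1 (x : X) (y : Y) (z : Z) : tensor_dgMod XY Z := pure (pure x y : XY) z.

Let c1Dl x z : {morph (c1 x)^~ z : u v / u + v}.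
Proof. by move=> u v; rewrite /c1 pureDr pureDl. Qed.
Let c1Dr x y : {morph c1 x y : u v / u + v}.
Proof. by move=> u v; exact: pureDr. Qed.

Let c1_bal_h i x k l (a : A) y z : hmg X i x -> homog sA k a -> hmg Y l y ->
  c1 x y (a *: z) = ksgn (k * l) (c1 x (a *: y) z).
Proof.
move=> hx ha hy; rewrite /c1 (pure_bal _ ha (homog_pure hx hy : hmg XY _ _)) pureZ (pure_bal _ ha hx).
by rewrite pure_ksgnl ksgn_comp; apply: ksgn_eq; lia.
Qed.
Let c1_bal x k l (a : A) y z : homog sA k a -> hmg Y l y ->
  c1 x y (a *: z) = ksgn (k * l) (c1 x (a *: y) z).
Proof.
move=> ha hy; elim/(homog_ind (X := dgm_str X)): x => [u v IHu IHv|i x hx].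
  by move: IHu IHv; rewrite /c1 !pureDl => -> ->; rewrite ksgnD.
exact: c1_bal_h hx ha hy.
Qed.

Let c2 (x : X) (t : YZ) := tensor_lift (c1 x) t.

Let c2_pure x y z : c2 x (pure y z) = pure (pure x y : XY) z.
Proof. exact: (tensor_liftE (c1Dl x) (c1Dr x) (c1_bal x)). Qed.
Let c2Dr x : {morph c2 x : u v / u + v}.
Proof. exact: (raddfD (tensor_liftA (c1Dl x) (c1Dr x) (c1_bal x))). Qed.
Let c2Dl t : {morph c2^~ t : u v / u + v}.
Proof.
move=> u v; elim/tensor_ind: t => [x y IHx IHy|l r p q hp hq].
  by rewrite !c2Dr IHx IHy addrACA.
by rewrite !c2_pure !pureDl.
Qed.
Let c2_bal k l (a : A) x t : homog sA k a -> hmg X l x ->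
  c2 x (a *: t) = ksgn (k * l) (c2 (a *: x) t).
Proof.
move=> ha hx; elim/tensor_ind: t => [u v IHu IHv|i r p q hp hq].
  by rewrite scalerDr !c2Dr IHu IHv ksgnD.
by rewrite pureZ !c2_pure (pure_bal _ ha hx) pure_ksgnl.
Qed.

Definition assoc_inv : {additive tensor X YZ -> tensor XY Z} := tensor_liftA c2Dl c2Dr c2_bal.

Lemma assoc_inv_pure x y z : assoc_inv (pure x (pure y z : YZ)) = pure (pure x y : XY) z.
Proof. by rewrite -c2_pure; exact: (tensor_liftE c2Dl c2Dr c2_bal). Qed.

Lemma assoc_ind (K : tensor_dgMod XY Z -> Prop) : (forall x y, K x -> K y -> K (x + y)) ->
  (forall i j l x y z, hmg X i x -> hmg Y j y -> hmg Z l z -> K (pure (pure x y : XY) z)) ->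
  forall x, K x.
Proof.
move=> KD Kp; apply: tensor_ind => // m n t z _ hz.
elim/tensor_ind: t => [x y hx hy|l r p q hp hq]; first by rewrite pureDl; exact: KD.
exact: Kp hp hq hz.
Qed.

Lemma assocD x y : assoc_fun (x + y) = assoc_fun x + assoc_fun y. Proof. exact: raddfD. Qed.
Lemma assoc_invD x y : assoc_inv (x + y) = assoc_inv x + assoc_inv y.
Proof. exact: raddfD. Qed.

Lemma assocK : cancel assoc_fun assoc_inv.
Proof.
elim/assoc_ind => [x y IHx IHy|i j l x y z _ _ _]; first by rewrite assocD assoc_invD IHx IHy.
by rewrite assoc_pure assoc_inv_pure.
Qed.

Lemma assoc_inv_ind (K : tensor_dgMod X YZ -> Prop) : (forall x y, K x -> K y -> K (x + y)) ->
  (forall i j l x y z, hmg X i x -> hmg Y j y -> hmg Z l z -> K (pure x (pure y z : YZ))) ->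
  forall x, K x.
Proof.
move=> KD Kp; apply: tensor_ind => // m n x t hx _.
elim/tensor_ind: t => [y y' hy hy'|l r p q hp hq]; first by rewrite pureDr; exact: KD.
exact: Kp hx hp hq.
Qed.

Lemma assoc_invK : cancel assoc_inv assoc_fun.
Proof.
elim/assoc_inv_ind => [x y IHx IHy|i j l x y z _ _ _].
  by rewrite assoc_invD assocD IHx IHy.
by rewrite assoc_inv_pure assoc_pure.
Qed.

Lemma assoc_dif (t : tensor_dgMod XY Z) :
  assoc_fun (dm (tensor_dgMod XY Z) t) = dm (tensor_dgMod X YZ) (assoc_fun t).
Proof.
elim/assoc_ind: t => [x y IHx IHy|i j l x y z hx hy hz].
  by rewrite raddfD !assocD IHx IHy raddfD.
rewrite assoc_pure (pure_dif _ (homog_pure hx hy : hmg XY _ _)) (pure_dif _ hx).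
rewrite (pure_dif _ hx) (pure_dif _ hy) pureDl pure_ksgnl assocD assocD raddf_ksgn !assoc_pure.
rewrite [assoc_fun (ksgn _ _)]raddf_ksgn assoc_pure !pureDr !pure_ksgnr ksgnD ksgn_comp.
by rewrite addrA.
Qed.

Lemma assoc_inv_dif (t : tensor_dgMod X YZ) :
  assoc_inv (dm (tensor_dgMod X YZ) t) = dm (tensor_dgMod XY Z) (assoc_inv t).
Proof. by rewrite -{1}[t]assoc_invK -assoc_dif assocK. Qed.

End Assoc.

(** The two base rings may differ, as comparisons across a change of rings require; hence the maps
    are only functions compatible with the differentials. *)
Lemma acyclic_transfer (A B : dgRing) (M : dgMod A) (N : dgMod B) (f : M -> N) (g : N -> M) :
  (forall x, f (dm M x) = dm N (f x)) -> (forall x, g (dm N x) = dm M (g x)) ->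
  g 0 = 0 -> cancel g f -> acyclic M -> acyclic N.
Proof.
move=> fd gd g0 gK /acyclicP aM; apply/acyclicP => z dz.
have [|y gz] := aM (g z); first by rewrite -gd dz.
by exists (f y); rewrite -fd -gz gK.
Qed.

Lemma acyclic_assoc (A : cdgRing) (X Y Z : dgMod A) :
  acyclic (tensor_dgMod (tensor_dgMod X Y) Z) <-> acyclic (tensor_dgMod X (tensor_dgMod Y Z)).
Proof.
split; [apply: (@acyclic_transfer A A (tensor_dgMod (tensor_dgMod X Y) Z)
          (tensor_dgMod X (tensor_dgMod Y Z)) (@assoc_fun A X Y Z) (@assoc_inv A X Y Z))
       |apply: (@acyclic_transfer A A (tensor_dgMod X (tensor_dgMod Y Z))
          (tensor_dgMod (tensor_dgMod X Y) Z) (@assoc_inv A X Y Z) (@assoc_fun A X Y Z))].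
- exact: assoc_dif.
- exact: assoc_inv_dif.
- exact: raddf0.
- exact: assoc_invK.
- exact: assoc_inv_dif.
- exact: assoc_dif.
- exact: raddf0.
- exact: assocK.
Qed.

Lemma K_flat_tensor (A : cdgRing) (X Y : dgMod A) : K_flat X -> K_flat Y ->
  K_flat (tensor_dgMod X Y).
Proof. by move=> kX kY Z aZ; apply/acyclic_assoc/kX/kY. Qed.

Section HomVal.
Variables (A : cdgRing) (P N : dgMod A).
Implicit Types x y : Hom_dgMod P N.

Lemma HomgD x y p : Hom_val (x + y) p = Hom_val x p + Hom_val y p.
Proof. exact: Hom_valD. Qed.
Lemma HomgN x p : Hom_val (- x) p = - Hom_val x p.
Proof. exact: (raddfN (mk_additive (zmod_morphD (fun x y => HomgD x y p))) x). Qed.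
Lemma HomgB x y p : Hom_val (x - y) p = Hom_val x p - Hom_val y p.
Proof. by rewrite HomgD HomgN. Qed.
Lemma Homg_ksgn k x p : Hom_val (ksgn k x) p = ksgn k (Hom_val x p).
Proof. by rewrite /ksgn; case: ifP => // _; exact: HomgN. Qed.
Lemma HomgZ a x p : Hom_val (a *: x) p = a *: Hom_val x p.
Proof. by []. Qed.
Lemma Hom_eq x y : (forall p, Hom_val x p = Hom_val y p) -> x = y.
Proof. by move=> h; apply: val_inj; apply/funext. Qed.

End HomVal.

(** * Tensor-Hom adjunction *)

Section Adjunction.
Variables (A : cdgRing) (T X W : dgMod A).
Local Notation TX := (tensor_dgMod T X).
Local Notation XW := (Hom_dgMod X W).

Section Curry.
Variables (n : int) (u : TX -> W).
Hypothesis hu : hom_deg n u.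

Let u_deg l t : hmg T l t -> hom_deg (l + n) (fun x => u (pure t x)).
Proof.
move=> ht; split=> [x y|i x hx|k a x ha].
- by rewrite pureDr (homgD hu).
- by have := homgh hu (homog_pure ht hx : hmg TX _ _); rewrite [l + i]addrC addrA.
rewrite (pure_bal _ ha ht) -pureZ (homg_ksgn hu) (homgZ hu _ ha) ksgn_comp.
by apply: ksgn_eq; lia.
Qed.

Let u_hom t : (fun x => u (pure t x)) \in is_hom (P := X) (N := W).
Proof.
elim/(homog_ind (X := dgm_str T)): t => [s t hs ht|l t ht]; last exact: is_hom_deg (u_deg ht).
have -> : (fun x => u (pure (s + t) x)) = (fun x => u (pure s x)) + (fun x => u (pure t x)).
  by apply/funext => x; rewrite pureDl (homgD hu).
exact: is_homD.
Qed.

Definition curry (t : T) : XW := MkHom (u_hom t).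

Lemma curryE t x : Hom_val (curry t) x = u (pure t x). Proof. by []. Qed.

Lemma curry_deg : hom_deg n curry.
Proof.
split=> [s t|i t ht|k a t ha].
- apply: Hom_eq => x; rewrite HomgD !curryE pureDl (homgD hu) //.
- exact/homog_HomP/u_deg.
apply: Hom_eq => x; rewrite curryE -pureZ (homgZ hu _ ha).
by rewrite Homg_ksgn HomgZ.
Qed.

Lemma curry_Dh t x : Hom_val (Dh n curry t) x = Dh n u (pure t x).
Proof.
have hd := Dh_deg hu; have hd' := Dh_deg curry_deg.
elim/(homog_ind (X := dgm_str T)): t => [s t hs ht|l t ht].
  by rewrite (homgD hd') HomgD hs ht pureDl (homgD hd).
rewrite [Dh n curry t]/Dh HomgB Homg_ksgn curryE.
rewrite [X in X - _](Hom_difE (x := curry t) x (u_deg ht)) /=.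
rewrite /Dh (pure_dif _ ht) (homgD hu) (homg_ksgn hu) ksgnD opprD.
by rewrite addrA addrAC ksgn_comp [n + l]addrC.
Qed.

End Curry.

Section Uncurry.
Variables (n : int) (v : T -> XW).
Hypothesis hv : hom_deg n v.

Let b (t : T) (x : X) : W := Hom_val (v t) x.

Let v_deg l t : hmg T l t -> hom_deg (l + n) (b t).
Proof. by move=> ht; exact/homog_HomP/(homgh hv). Qed.
Let bDl x : {morph b^~ x : s t / s + t}.
Proof. by move=> s t; rewrite /b (homgD hv) Hom_valD. Qed.
Let bDr t : {morph b t : x y / x + y}.
Proof.
move=> x y; elim/(homog_ind (X := dgm_str T)): t => [s t hs ht|l t ht].
  by rewrite !bDl hs ht addrACA.
by rewrite (homgD (v_deg ht)).
Qed.
Let b_bal k l (a : A) t x : homog (dgr_str A) k a -> hmg T l t ->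
  b t (a *: x) = ksgn (k * l) (b (a *: t) x).
Proof.
move=> ha ht; rewrite (homgZ (v_deg ht) _ ha) /b (homgZ hv _ ha).
rewrite Homg_ksgn HomgZ ksgn_comp; apply: ksgn_eq; lia.
Qed.

Definition uncurryA : {additive tensor T X -> W} := tensor_liftA bDl bDr b_bal.
Definition uncurry : TX -> W := uncurryA.

Lemma uncurryE t x : uncurry (pure t x) = Hom_val (v t) x.
Proof. exact: (tensor_liftE bDl bDr b_bal). Qed.

Lemma uncurryD s t : uncurry (s + t) = uncurry s + uncurry t.
Proof. exact: (raddfD uncurryA). Qed.
Lemma uncurry0 : uncurry 0 = 0. Proof. exact: (raddf0 uncurryA). Qed.

Lemma uncurry_deg : hom_deg n uncurry.
Proof.
split=> [|i t|k a t ha]; first exact: uncurryD.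
  move: i t; apply: tensor_homog_ind => [i x y hx hy|i|l r p q hp hq].
  - by rewrite uncurryD; exact: homogD.
  - by rewrite uncurry0; exact: homog0.
  rewrite uncurryE addrAC addrC; exact: (homgh (v_deg hp) hq).
elim/tensor_ind: t => [x y hx hy|l r p q hp hq].
  by rewrite scalerDr !uncurryD hx hy scalerDr ksgnD.
rewrite pureZ !uncurryE (homgZ hv _ ha).
by rewrite Homg_ksgn HomgZ.
Qed.

Lemma uncurry_Dh t x : Dh n uncurry (pure t x) = Hom_val (Dh n v t) x.
Proof.
have hd := Dh_deg uncurry_deg; have hd' := Dh_deg hv.
elim/(homog_ind (X := dgm_str T)): t => [s t hs ht|l t ht].
  by rewrite (homgD hd') HomgD -hs -ht pureDl (homgD hd).
rewrite [Dh n v t]/Dh HomgB Homg_ksgn [X in _ = X - _](Hom_difE (x := v t) x (v_deg ht)).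
rewrite /Dh (pure_dif _ ht) (homgD uncurry_deg) (homg_ksgn uncurry_deg) !uncurryE.
by rewrite ksgnD opprD addrA addrAC ksgn_comp [n + l]addrC.
Qed.

End Uncurry.

(** Currying and uncurrying are mutually inverse and commute with the differential of maps, so
    cycles and null-homotopies correspond. *)
Lemma acyclic_adjunction : acyclic (Hom_dgMod TX W) <-> acyclic (Hom_dgMod T XW).
Proof.
split=> /Hom_acyclicP h; apply/Hom_acyclicP => n f hf df.
  have [|g hg fE] := h n _ (uncurry_deg hf).
    elim/tensor_ind => [x y hx hy|l r p q hp hq]; last by rewrite uncurry_Dh df.
    by rewrite (homgD (Dh_deg (uncurry_deg hf))) hx hy addr0.
  exists (curry hg) => [|t]; first exact: curry_deg.
  by apply: Hom_eq => x; rewrite curry_Dh -fE uncurryE.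
have [|g hg fE] := h n _ (curry_deg hf).
  by move=> t; apply: Hom_eq => x; rewrite curry_Dh df.
exists (uncurry hg) => [|t]; first exact: uncurry_deg.
elim/tensor_ind: t => [x y hx hy|l r p q hp hq].
  by rewrite (homgD hf) (homgD (Dh_deg (uncurry_deg hg))) hx hy.
by rewrite uncurry_Dh -fE curryE.
Qed.

End Adjunction.

Lemma K_projective_tensor (A : cdgRing) (T X : dgMod A) : K_projective T -> K_projective X ->
  K_projective (tensor_dgMod T X).
Proof. by move=> kT kX W aW; apply/acyclic_adjunction/kT/kX. Qed.

Lemma acyclic_Hom_iso (A : cdgRing) (M N W : dgMod A) (f : dgHom M N) (g : dgHom N M) :
  cancel g f -> acyclic (Hom_dgMod M W) -> acyclic (Hom_dgMod N W).
Proof.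
move=> gK /Hom_acyclicP h; apply/Hom_acyclicP => n u hu du.
have [hf hg] := (dgHom_deg f, dgHom_deg g).
have huf : hom_deg n (fun x => u (f x)) by apply: hom_deg_compE hu hf; rewrite add0r.
have [|v hv vE] := h n _ huf.
  by move=> x; rewrite (Dh_compE (n := 0) _ x _ hu) ?add0r // du Dh_dgHom // (homg0 hu) ksgn0 addr0.
have hvg : hom_deg (n - 1) (fun x => v (g x)) by apply: hom_deg_compE hv hg; rewrite add0r.
exists (fun x => v (g x)) => // x.
rewrite (Dh_compE (n := 0) _ x _ hv) ?add0r // Dh_dgHom // (homg0 hv) ksgn0 addr0 -vE.
by rewrite gK.
Qed.

(** * Semifree resolutions *)

Section SelfModule.
Variable A : dgRing.

Definition self_dgMod : dgMod A.
Proof.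
apply: (@DGMod A A^o (dgr_str A)) => [m n a x|m a x]; first exact: dgr_homogM.
exact: dgr_leibniz.
Defined.

(** The scalar (-1)^(n|a|) a: the sign paid when a map of degree [n] moves past [a], in a form
    additive in [a]. *)
Definition twist (n : int) (a : A) : A := if odd `|n|%N then parity self_dgMod a else a.

Lemma twistD n : {morph twist n : a b / a + b}.
Proof. by move=> a b; rewrite /twist; case: ifP => // _; exact: (parityD (M := self_dgMod)). Qed.

Lemma twist0 n : twist n 0 = 0.
Proof. by apply: (addIr (twist n 0)); rewrite -twistD !add0r. Qed.

Lemma twistE n k a : homog (dgr_str A) k a -> twist n a = ksgn (n * k) a.
Proof.
move=> ha; rewrite /twist /ksgn odd_abszM; case: (odd `|n|%N) => //=.
exact: (parityE (M := self_dgMod) ha).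
Qed.

Lemma twist1 n : twist n 1 = 1.
Proof. by rewrite (twistE _ (dgr_homog1 A)) mulr0. Qed.

End SelfModule.

Section Semifree.
Variables (A : cdgRing) (N : dgMod A).
Local Notation sA := (dgr_str A).

(* A cell of degree n is attached along the cycle sum_i a_i [h_i] and is sent to x. *)
Inductive cell := Cell (n : int) (m : nat) (a : 'I_m -> A) (h : 'I_m -> cell) (x : N).

HB.instance Definition _ := gen_eqMixin cell.
HB.instance Definition _ := gen_choiceMixin cell.

Definition cdeg (g : cell) := let: Cell n _ _ _ _ := g in n.
Definition cval (g : cell) := let: Cell _ _ _ _ x := g in x.
Definition chld (g : cell) := let: Cell _ _ _ h _ := g in codom h.

Local Notation F := (cell -> A^o).

Definition sing (g : cell) (a : A) : F := fun g' => if g' == g then a else 0.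

Definition cbd (g : cell) : F :=
  let: Cell _ _ a h _ := g in fun g' => \sum_i sing (h i) (a i) g'.

(** The last two clauses say that sending cells to their values respects the differential and that
    the attaching chain is closed. Closedness is spelled out cell by cell, since the differential of
    the semifree module is only defined later, on valid cells. *)
Fixpoint valid (g : cell) : Prop :=
  let: Cell n m a h x := g in
  [/\ forall i, valid (h i), forall i, homog sA (n + 1 - cdeg (h i)) (a i),
      hmg N n x, dm N x = \sum_i a i *: cval (h i)
    & forall g', \sum_i (sing (h i) (dif sA (a i)) g' + twist 1 (a i) * cbd (h i) g') = 0].

Definition ord0_elim (T : Type) (i : 'I_0) : T :=
  False_rect T (Bool.diff_false_true (ltn_ord i)).

Definition cocell (n : int) (x : N) : cell := Cell n (@ord0_elim A) (@ord0_elim cell) x.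

Lemma valid_cocell n x : hmg N n x -> dm N x = 0 -> valid (cocell n x).
Proof.
by move=> hx dx; split=> //= [[]//|[]//||g']; rewrite big_ord0.
Qed.

(** Validity is required of the supporting cells only, which leaves [cell] a plain inductive type of
    finitely branching trees. *)
Definition is_sf : {pred F} := [pred f | `[< exists2 s : seq cell,
  forall g, g \in s -> valid g & forall g, g \notin s -> f g = 0 >]].

Lemma is_sfP f : reflect (exists2 s : seq cell,
  forall g, g \in s -> valid g & forall g, g \notin s -> f g = 0) (f \in is_sf).
Proof. exact: asboolP. Qed.

Lemma is_sf_closed : submod_closed is_sf.
Proof.
split; first by apply/is_sfP; exists [::].
move=> a f g /is_sfP[s vs fs] /is_sfP[t vt gt]; apply/is_sfP; exists (s ++ t).
  by move=> c; rewrite mem_cat => /orP[/vs|/vt].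
move=> c; rewrite mem_cat negb_or => /andP[/fs fc /gt gc].
by rewrite addrfctE scalrfctE fc gc scaler0 addr0.
Qed.
HB.instance Definition _ := GRing.isSubmodClosed.Build A F is_sf is_sf_closed.

Record sft := MkSf { sf_val : F; _ : sf_val \in is_sf }.
HB.instance Definition _ := [isSub for sf_val].
HB.instance Definition _ := [Choice of sft by <:].
HB.instance Definition _ := [SubChoice_isSubLmodule of sft by <:].

Implicit Types (f : sft) (g : cell).

Lemma sf_eq f f' : (forall g, sf_val f g = sf_val f' g) -> f = f'.
Proof. by move=> h; apply: val_inj; apply/funext. Qed.
Lemma sf_valD f f' g : sf_val (f + f') g = sf_val f g + sf_val f' g.
Proof. by []. Qed.
Lemma sf_valZ a f g : sf_val (a *: f) g = a * sf_val f g.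
Proof. by []. Qed.
Lemma sf_val0 g : sf_val 0 g = 0. Proof. by []. Qed.

Lemma sf_val_sum I (r : seq I) (P : pred I) (G : I -> sft) g :
  sf_val (\sum_(i <- r | P i) G i) g = \sum_(i <- r | P i) sf_val (G i) g.
Proof. exact: (raddf_sum (mk_additive (zmod_morphD (fun x y => sf_valD x y g)))). Qed.

Definition csupp f : seq cell := undup (s2val (cid2 (is_sfP _ (valP f)))).

Lemma csupp_uniq f : uniq (csupp f). Proof. exact: undup_uniq. Qed.

Lemma csupp_valid f g : g \in csupp f -> valid g.
Proof. by rewrite /csupp mem_undup; case: cid2 => s /= h _; exact: h. Qed.

Lemma mem_csupp f g : sf_val f g != 0 -> g \in csupp f.
Proof.
rewrite /csupp mem_undup; case: cid2 => s /= _ h.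
by apply: contraR => /h ->.
Qed.

Section FSum.
Variables (V : zmodType) (T : cell -> A -> V).
Hypothesis TD : forall g, {morph T g : a b / a + b}.

Definition fsum f : V := \sum_(g <- csupp f) T g (sf_val f g).

Lemma fsum_T0 g : T g 0 = 0.
Proof. by apply: (addIr (T g 0)); rewrite -TD !add0r. Qed.

Lemma fsum_cover f s : uniq s -> (forall g, sf_val f g != 0 -> g \in s) ->
  fsum f = \sum_(g <- s) T g (sf_val f g).
Proof.
move=> us hs; apply: sum_cover => // [|g|g]; first exact: csupp_uniq.
  by move=> h; apply: mem_csupp; apply: contra_neq h => ->; rewrite fsum_T0.
by move=> h; apply: hs; apply: contra_neq h => ->; rewrite fsum_T0.
Qed.

Lemma fsumD : {morph fsum : f f' / f + f'}.
Proof.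
move=> f f'; set s := undup (csupp f ++ csupp f' ++ csupp (f + f')).
have us : uniq s by exact: undup_uniq.
rewrite !(fsum_cover us) => [|i h|i h|i h].
- by rewrite -big_split; apply: eq_bigr => i _; rewrite sf_valD TD.
- by rewrite mem_undup !mem_cat (mem_csupp h) orbT.
- by rewrite mem_undup !mem_cat (mem_csupp h).
- by rewrite mem_undup !mem_cat (mem_csupp h) !orbT.
Qed.

End FSum.

Lemma sg_subproof g a : (if `[< valid g >] then sing g a else 0) \in is_sf.
Proof.
case: asboolP => vg; apply/is_sfP; last by exists [::].
exists [:: g] => [g'|g']; first by rewrite inE => /eqP ->.
by rewrite inE /sing => /negPf ->.
Qed.

(* the element a[g], which is 0 by convention when g is not valid *)
Definition sg g a : sft := MkSf (sg_subproof g a).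
Arguments sg : simpl never.

Lemma sgE g a g' : valid g -> sf_val (sg g a) g' = if g' == g then a else 0.
Proof. by move=> vg; rewrite /sg /=; case: asboolP. Qed.

Lemma sgN g a g' : ~ valid g -> sf_val (sg g a) g' = 0.
Proof. by move=> vg; rewrite /sg /=; case: asboolP. Qed.

Lemma sgD g a b : sg g (a + b) = sg g a + sg g b.
Proof.
apply: sf_eq => g'; rewrite sf_valD /sg /=; case: asboolP => _; last by rewrite addr0.
by rewrite /sing; case: ifP; rewrite ?addr0.
Qed.

Lemma sg0 g : sg g 0 = 0. Proof. by apply: (addIr (sg g 0)); rewrite -sgD !add0r. Qed.

Lemma sg_ksgn n g a : sg g (ksgn n a) = ksgn n (sg g a).
Proof. exact: (raddf_ksgn (mk_additive (zmod_morphD (sgD g)))). Qed.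

Lemma sgZ g a b : a *: sg g b = sg g (a * b).
Proof.
apply: sf_eq => g'; rewrite sf_valZ /sg /=; case: asboolP => _; last exact: mulr0.
by rewrite /sing; case: ifP; rewrite ?mulr0.
Qed.

Lemma fsum_sg (V : zmodType) (T : cell -> A -> V) g a : valid g ->
  (forall g, {morph T g : a b / a + b}) -> fsum T (sg g a) = T g a.
Proof.
move=> vg TD; rewrite (fsum_cover TD (s := [:: g])) // => [|g'].
  by rewrite big_seq1 sgE ?eqxx.
by rewrite sgE // inE; case: ifP => //; rewrite eqxx.
Qed.

Lemma sf_sum f : f = \sum_(g <- csupp f) sg g (sf_val f g).
Proof.
apply: sf_eq => g.
transitivity (\sum_(g' <- csupp f) sf_val (sg g' (sf_val f g')) g); last first.
  by rewrite sf_val_sum.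
have [gs|gs] := boolP (g \in csupp f).
  rewrite (bigD1_seq g) ?csupp_uniq // big1_seq ?addr0.
    by rewrite (sgE _ _ (csupp_valid gs)) eqxx [RHS]addr0.
  move=> g' /andP[gg' g's]; by rewrite (sgE _ _ (csupp_valid g's)) eq_sym (negPf gg').
rewrite big1_seq => [|g' /andP[_ g's]].
  by apply/eqP; apply: contraNT gs => /mem_csupp.
rewrite (sgE _ _ (csupp_valid g's)).
by case: eqP gs => // ->; rewrite g's.
Qed.

Lemma sf_ind (K : sft -> Prop) : (forall f f', K f -> K f' -> K (f + f')) ->
  (forall g k a, valid g -> homog sA k a -> K (sg g a)) -> forall f, K f.
Proof.
move=> KD Ks f; rewrite (sf_sum f).
have vg : valid (cocell 0 0) by apply: valid_cocell; rewrite ?raddf0 //; exact: homog0.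
have K0 : K 0.
  by rewrite -(scale0r (sg (cocell 0 0) 0)) sgZ mulr0; apply: (Ks _ 0) => //; exact: homog0.
rewrite big_seq; elim/big_ind: _ => // g /csupp_valid {}vg.
elim/(homog_ind (X := sA)): (sf_val f g) => [a b Ka Kb|k a ha]; first by rewrite sgD; exact: KD.
exact: Ks ha.
Qed.

Section Extension.
Variables (V : lmodType A) (n : int) (b : cell -> V).

Let T g a := twist n a *: b g.
Let TD g : {morph T g : x y / x + y}.
Proof. by move=> x y; rewrite /T twistD scalerDl. Qed.

Definition sext : sft -> V := fsum T.

Lemma sextD f f' : sext (f + f') = sext f + sext f'. Proof. exact: fsumD TD f f'. Qed.
Definition sextA : {additive sft -> V} := mk_additive (zmod_morphD sextD).
Lemma sext0 : sext 0 = 0. Proof. exact: (raddf0 sextA). Qed.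
Lemma sext_sum I (r : seq I) (P : pred I) (G : I -> sft) :
  sext (\sum_(i <- r | P i) G i) = \sum_(i <- r | P i) sext (G i).
Proof. exact: (raddf_sum sextA). Qed.
Lemma sext_sg g a : valid g -> sext (sg g a) = twist n a *: b g.
Proof. by move=> vg; rewrite /sext (fsum_sg _ vg TD). Qed.

Lemma sextZ k a f : homog sA k a -> sext (a *: f) = ksgn (n * k) (a *: sext f).
Proof.
move=> ha; elim/sf_ind: f => [x y IHx IHy|g l c vg hc].
  by rewrite scalerDr !sextD IHx IHy scalerDr ksgnD.
rewrite sgZ !sext_sg // (twistE _ hc) (twistE _ (dgr_homogM ha hc)) !scale_ksgn scaler_ksgn.
by rewrite scalerA ksgn_comp mulrDr.
Qed.

End Extension.

Section SfComp.
Variable n : int.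

Definition sf_comp_fun f : F := fun g => gcomp sA (n - cdeg g) (sf_val f g).

Lemma sf_comp_sub f : sf_comp_fun f \in is_sf.
Proof.
apply/is_sfP; exists (csupp f) => [g|g gs]; first exact: csupp_valid.
rewrite /sf_comp_fun (_ : sf_val f g = 0) ?raddf0 //.
by apply/eqP; apply: contraNT gs => /mem_csupp.
Qed.

Definition sf_comp_map f : sft := MkSf (sf_comp_sub f).

Lemma sf_comp_zmod : zmod_morphism sf_comp_map.
Proof. by move=> f f'; apply: sf_eq => g; exact: raddfB. Qed.

Definition sf_comp : {additive sft -> sft} := mk_additive sf_comp_zmod.

Lemma sf_compE f g : sf_val (sf_comp f) g = gcomp sA (n - cdeg g) (sf_val f g).
Proof. by []. Qed.

Lemma sf_comp_sg k g a : homog sA k a ->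
  sf_comp (sg g a) = if n == k + cdeg g then sg g a else 0.
Proof.
move=> ha; apply: sf_eq => g'; rewrite sf_compE.
have -> : sf_val (if n == k + cdeg g then sg g a else 0) g' =
    if n == k + cdeg g then sf_val (sg g a) g' else 0 by case: ifP.
have [vg|nvg] := EM (valid g); last by rewrite sgN // raddf0 if_same.
rewrite !sgE //; case: eqP => [->|_]; last by rewrite raddf0 if_same.
by rewrite (gcomp_homog _ ha); have -> : (n - cdeg g == k) = (n == k + cdeg g) by lia.
Qed.

End SfComp.

Lemma sf_compK m n f : sf_comp m (sf_comp n f) = if m == n then sf_comp n f else 0.
Proof.
apply: sf_eq => g; rewrite !sf_compE gcompK (inj_eq (addIr (- cdeg g))).
by case: ifP.
Qed.

Lemma sf_comp_sum f : exists2 s : seq int, uniq s & f = \sum_(n <- s) sf_comp n f.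
Proof.
elim/sf_ind: f => [x y|g k a vg ha]; first exact: sum_cover_decompD sf_compK x y.
by exists [:: k + cdeg g]; rewrite // big_seq1 (sf_comp_sg _ _ ha) eqxx.
Qed.

Definition sf_grading : grading sft := Grading sf_compK sf_comp_sum.

Lemma homog_sg k g a : homog sA k a -> homog sf_grading (k + cdeg g) (sg g a).
Proof. by move=> ha; rewrite /homog [LHS](sf_comp_sg _ _ ha) eqxx. Qed.

Lemma sf_homog_ind (K : int -> sft -> Prop) :
  (forall n f f', K n f -> K n f' -> K n (f + f')) -> (forall n, K n 0) ->
  (forall g k a, valid g -> homog sA k a -> K (k + cdeg g) (sg g a)) ->
  forall n f, homog sf_grading n f -> K n f.
Proof.
move=> KD K0 Kh n f <-; elim/sf_ind: f => [x y Kx Ky|g k a vg ha].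
  by rewrite raddfD; apply: KD.
have -> : gcomp sf_grading n (sg g a) = if n == k + cdeg g then sg g a else 0.
  exact: sf_comp_sg ha.
by case: eqP => [->|_]; [exact: Kh | exact: K0].
Qed.

Lemma cbd_sub g : valid g -> cbd g \in is_sf.
Proof.
case: g => n m a h x [vh _ _ _ _]; apply/is_sfP; exists (codom h) => g.
  by move=> /codomP[i ->]; exact: vh.
move=> gh; rewrite /= big1 // => i _; rewrite /sing; case: eqP gh => // ->.
by rewrite codom_f.
Qed.

Definition sbd g : sft := if pselect (valid g) is left vg then MkSf (cbd_sub vg) else 0.

Lemma sbdE n m (a : 'I_m -> A) h x : valid (Cell n a h x) ->
  sbd (Cell n a h x) = \sum_i sg (h i) (a i).
Proof.
move=> vg; rewrite /sbd; case: pselect => // {}vg; apply: sf_eq => g.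
transitivity (\sum_i sf_val (sg (h i) (a i)) g).
  by have [vh _ _ _ _] := vg; rewrite -[LHS]/(\sum_i sing (h i) (a i) g);
    apply: eq_bigr => i _; rewrite (sgE _ _ (vh i)).
by rewrite sf_val_sum.
Qed.

(** On a[g] this is d(a)[g] + (-1)^|a| a d[g], as the Leibniz rule dictates. *)
Definition sf_dif_fun f : sft :=
  fsum (fun g a => sg g (dif sA a)) f + sext 1 sbd f.

Let sgdD g : {morph (fun a => sg g (dif sA a)) : a b / a + b}.
Proof. by move=> a b; rewrite raddfD sgD. Qed.

Lemma sf_dif_funD f f' : sf_dif_fun (f + f') = sf_dif_fun f + sf_dif_fun f'.
Proof. by rewrite /sf_dif_fun (fsumD sgdD) sextD addrACA. Qed.

Definition sf_dif : {additive sft -> sft} := locked (mk_additive (zmod_morphD sf_dif_funD)).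

Lemma sf_difE f : sf_dif f = sf_dif_fun f.
Proof. by rewrite /sf_dif -lock. Qed.

Lemma sf_difD f f' : sf_dif (f + f') = sf_dif f + sf_dif f'. Proof. exact: raddfD. Qed.

Lemma sf_dif_sg g a : valid g -> sf_dif (sg g a) = sg g (dif sA a) + twist 1 a *: sbd g.
Proof. by move=> vg; rewrite sf_difE /sf_dif_fun (fsum_sg _ vg sgdD) sext_sg. Qed.

Lemma sf_dif_leibniz k a f : homog sA k a ->
  sf_dif (a *: f) = dif sA a *: f + ksgn k (a *: sf_dif f).
Proof.
move=> ha; elim/sf_ind: f => [x y IHx IHy|g l c vg hc].
  by rewrite scalerDr !sf_difD IHx IHy !scalerDr ksgnD; exact: addrACA.
rewrite sgZ !sf_dif_sg // (dgr_leibniz _ ha) sgD sgZ scalerDr ksgnD -addrA; congr (_ + _).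
rewrite (twistE _ hc) (twistE _ (dgr_homogM ha hc)) !scale_ksgn scaler_ksgn scalerA ksgn_comp.
congr (_ + _); last by apply: ksgn_eq; lia.
by rewrite sgZ sg_ksgn.
Qed.

Lemma sf_dif_cbd g : valid g -> sf_dif (sbd g) = 0.
Proof.
case: g => n m a h x vg; rewrite sbdE // raddf_sum; case: (vg) => vh ha hx dx dd.
apply: sf_eq => g; rewrite -[RHS](dd g).
transitivity (\sum_i sf_val (sf_dif (sg (h i) (a i))) g).
  by rewrite sf_val_sum.
apply: eq_bigr => i _; rewrite (sf_dif_sg _ (vh i)) sf_valD sf_valZ (sgE _ _ (vh i)) /sbd.
by case: pselect => // /(_ (vh i)).
Qed.

Lemma sbd_homog g : valid g -> homog sf_grading (cdeg g + 1) (sbd g).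
Proof.
case: g => n m a h x vg; rewrite sbdE //; case: vg => vh ha _ _ _ /=.
elim/big_ind: _ => [|y z hy hz|i _]; [exact: homog0|exact: homogD|].
by have := homog_sg (h i) (ha i); rewrite subrK.
Qed.

Lemma sf_homogZ m n a f : homog sA m a -> homog sf_grading n f ->
  homog sf_grading (m + n) (a *: f).
Proof.
move=> ha; move: n f; apply: sf_homog_ind => [n x y hx hy|n|g k b vg hb].
- by rewrite scalerDr; apply: homogD.
- by rewrite scaler0; apply: homog0.
by rewrite sgZ addrA; exact: homog_sg (dgr_homogM ha hb).
Qed.

Definition sf_str : dgStruct sft.
Proof.
apply: (@DGStruct _ sf_grading sf_dif).
  apply: sf_homog_ind => [n x y hx hy|n|g k a vg ha].
  - by rewrite sf_difD; apply: homogD.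
  - by rewrite raddf0; apply: homog0.
  rewrite sf_dif_sg //; apply: homogD.
    by rewrite addrAC; exact: homog_sg (dif_homog ha).
  rewrite (twistE _ ha) scale_ksgn; apply: homog_ksgn.
  by rewrite -addrA; exact: sf_homogZ (sbd_homog vg).
elim/sf_ind => [x y hx hy|g k a vg ha]; first by rewrite !sf_difD hx hy addr0.
rewrite sf_dif_sg // sf_difD sf_dif_sg // difK sg0 add0r.
rewrite (twistE _ ha) (twistE _ (dif_homog ha)) !mul1r !scale_ksgn raddf_ksgn.
rewrite (sf_dif_leibniz _ ha) (sf_dif_cbd vg) scaler0 ksgn0 addr0 ksgn1.
exact: addNr.
Defined.

Definition semifree : dgMod A.
Proof.
apply: (@DGMod A sft sf_str) => [m n a x|m a x]; first exact: sf_homogZ.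
exact: sf_dif_leibniz.
Defined.

Lemma sext_deg (W : dgMod A) n (b : cell -> W) :
  (forall g, valid g -> hmg W (cdeg g + n) (b g)) -> hom_deg n (sext n b : semifree -> W).
Proof.
move=> hb; split=> [x y|i f|k a f ha]; [exact: sextD| |exact: sextZ].
move: i f; apply: sf_homog_ind => [i x y hx hy|i|g k a vg ha].
- by rewrite sextD; exact: homogD.
- by rewrite sext0; exact: homog0.
rewrite sext_sg // (twistE _ ha) scale_ksgn; apply: homog_ksgn.
by rewrite -addrA; exact: dgm_homogZ ha (hb _ vg).
Qed.

Lemma sg1Z g a : sg g a = a *: sg g 1. Proof. by rewrite sgZ mulr1. Qed.

Lemma sf_difE1 g : valid g -> dm semifree (sg g 1) = sbd g.
Proof.
move=> vg; rewrite -[LHS]/(sf_dif _) sf_dif_sg // twist1 scale1r.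
have -> : dif sA 1 = 0.
  by have := dgr_leibniz (1 : A) (dgr_homog1 A); rewrite !mul1r mulr1 => /eqP;
    rewrite eq_sym addrC -subr_eq0 addrK => /eqP.
by rewrite sg0 add0r.
Qed.

Lemma homog_sg1 g : hmg semifree (cdeg g) (sg g 1).
Proof. by have := homog_sg g (dgr_homog1 A); rewrite add0r. Qed.

Lemma sf_hom_eq (W : dgMod A) n (u v : semifree -> W) : hom_deg n u -> hom_deg n v ->
  (forall g, valid g -> u (sg g 1) = v (sg g 1)) -> forall f, u f = v f.
Proof.
move=> hu hv uv; elim/sf_ind => [x y hx hy|g k a vg ha].
  by rewrite (homgD hu) (homgD hv) hx hy.
by rewrite sg1Z (homgZ hu _ ha) (homgZ hv _ ha) uv.
Qed.

Lemma valid_homog g : valid g -> hmg N (cdeg g) (cval g).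
Proof. by case: g => n m a h x []. Qed.

Lemma sf_map_deg : hom_deg 0 (sext 0 cval : semifree -> N).
Proof. by apply: sext_deg => g vg; rewrite addr0; exact: valid_homog. Qed.

Lemma sf_map_sbd g : valid g -> sext 0 cval (sbd g) = dm N (cval g).
Proof.
case: g => n m a h x vg; rewrite sbdE // sext_sum; case: (vg) => vh ha hx dx _.
by rewrite [RHS]dx; apply: eq_bigr => i _; rewrite (sext_sg _ _ _ (vh i)).
Qed.

Lemma sf_map_dif f : Dh 0 (sext 0 cval : semifree -> N) f = 0.
Proof.
have h0 : hom_deg (0 + 1) (fun _ : semifree => 0 : N).
  by split=> [x y|i x _|k a x _]; rewrite ?addr0 ?scaler0 ?ksgn0 //; exact: homog0.
apply: (sf_hom_eq (Dh_deg sf_map_deg) h0) => g vg.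
rewrite /Dh sf_difE1 // sf_map_sbd // ksgn_id sext_sg // twist1 scale1r.
exact: subrr.
Qed.

Definition semifree_map : dgHom semifree N := deg0_dgHom sf_map_deg sf_map_dif.

Lemma sf_mapE f : semifree_map f = sext 0 cval f. Proof. by []. Qed.

(** All stages of the usual step-by-step construction are present at once: a cell without boundary
    hits any given homogeneous cocycle, and a homogeneous cycle whose image bounds is itself the
    attaching chain of some cell. *)
Lemma semifree_qi : quasi_iso semifree_map.
Proof.
suff h : forall n, (forall f y, homog sf_grading n f -> dm semifree f = 0 -> semifree_map f = dm N y ->
     hmg N (n - 1) y -> exists x, f = dm semifree x) /\
    (forall w, hmg N n w -> dm N w = 0 -> exists2 f, dm semifree f = 0 & w = semifree_map f).
  apply/quasi_isoP; split=> [z y dz fz|w dw].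
    apply: boundary_sum => n; apply: (h n).1 (gcomp (dgm_str N) (n - 1) y) _ _ _ _.
    - exact: homog_gcomp.
    - exact: gcomp_cocycle.
    - by rewrite -gcomp_dgHom fz gcomp_dif.
    - exact: homog_gcomp.
  have [s _ wE] := gcomp_sum (dgm_str N) w.
  have hs n := (h n).2 _ (homog_gcomp _ n w) (gcomp_cocycle n dw).
  exists (\sum_(n <- s) s2val (cid2 (hs n))), 0; rewrite raddf0 addr0; split.
    by rewrite raddf_sum big1 // => n _; case: cid2.
  by rewrite {1}wE raddf_sum; apply: eq_bigr => n _; case: cid2.
move=> n; split=> [f y hf df fy hy|w hw dw]; last first.
  have vg := valid_cocell hw dw; exists (sg (cocell n w) 1).
    rewrite sf_difE1 // /sbd; case: pselect => // {}vg; apply: sf_eq => g.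
    by rewrite /= big_ord0.
  by rewrite sf_mapE sext_sg // twist1 scale1r.
pose m := size (csupp f).
pose h (i : 'I_m) := nth (cocell 0 0) (csupp f) i.
pose a (i : 'I_m) := sf_val f (h i).
have vh i : valid (h i) by apply: (@csupp_valid f); exact: mem_nth.
have fE : f = \sum_i sg (h i) (a i).
  by rewrite {1}(sf_sum f) (big_nth (cocell 0 0)) big_mkord.
have ha i : homog sA (n - 1 + 1 - cdeg (h i)) (a i).
  by rewrite /a subrK -[f in X in homog _ _ X]hf; exact: homog_gcomp.
(* The new cell is attached along [f] and sent to [y]; its validity amounts to the homogeneity of
   [f] and [y], the equation [fy] and the closedness of [f]. *)
have vg : valid (Cell (n - 1) a h y).
  split=> //; first by rewrite -fy sf_mapE {1}fE sext_sum; apply: eq_bigr => i _;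
    rewrite (sext_sg _ _ _ (vh i)).
  move=> g'; rewrite -[RHS](sf_val0 g') -df -[dm semifree f]/(sf_dif f) {1}fE raddf_sum sf_val_sum.
  apply: eq_bigr => i _; rewrite (sf_dif_sg _ (vh i)) sf_valD sf_valZ (sgE _ _ (vh i)) /sbd.
  by case: pselect => // /(_ (vh i)).
by exists (sg (Cell (n - 1) a h y) 1); rewrite sf_difE1 // sbdE.
Qed.

Section KProjective.
Variables (W : dgMod A) (aW : acyclic W) (n : int) (u : semifree -> W).
Hypotheses (hu : hom_deg n u) (du : forall f, Dh n u f = 0).

(* the value on g of a null-homotopy of u is found by recursion on the tree g *)
Fixpoint lift (g : cell) : W :=
  let: Cell d m a h x := g in
  let w := u (sg g 1) + ksgn (n - 1) (\sum_i twist (n - 1) (a i) *: lift (h i)) in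
  if pselect (exists2 y, hmg W (d + (n - 1)) y & w = dm W y) is left e
  then s2val (cid2 e) else 0.

Lemma lift_homog g : hmg W (cdeg g + (n - 1)) (lift g).
Proof.
case: g => d m a h x /=; case: pselect => [e|_]; last exact: homog0.
by case: cid2.
Qed.

Let B : semifree -> W := sext (n - 1) lift.
Let hB : hom_deg (n - 1) B.
Proof. by apply: sext_deg => g _; exact: lift_homog. Qed.
Let hdB : hom_deg n (Dh (n - 1) B).
Proof. by have := Dh_deg hB; rewrite subrK. Qed.

(** By induction the homotopy is correct on the cells to which [g] is attached, so the differential
    [w] prescribed for its value on [g] is a cocycle. As [W] is acyclic, [w] bounds, and the default
    value 0 in [lift] is not taken at a valid cell. *)
Lemma lift_spec g : valid g -> u (sg g 1) = Dh (n - 1) B (sg g 1).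
Proof.
elim: g => d m a h IH x vg; have [vh ha hx dx _] := vg.
set g := Cell d a h x in vg *.
pose L := \sum_i twist (n - 1) (a i) *: lift (h i).
have LE : B (sbd g) = L.
  by rewrite sbdE // /B sext_sum; apply: eq_bigr => i _;
    rewrite (sext_sg _ _ _ (vh i)).
have uL : u (sbd g) = dm W L.
  have -> : u (sbd g) = Dh (n - 1) B (sbd g).
    rewrite sbdE // -[u _]/(hom_add hu _) -[RHS]/(hom_add hdB _) !raddf_sum.
    apply: eq_bigr => i _; rewrite /= sg1Z (homgZ hu _ (ha i)) (homgZ hdB _ (ha i)).
    by rewrite (IH i (vh i)).
  have db : dm semifree (sbd g) = 0 by exact: sf_dif_cbd.
  by rewrite /Dh LE db (homg0 hB) ksgn0 subr0.
have dug : dm W (u (sg g 1)) = ksgn n (u (sbd g)).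
  by have := du (sg g 1); rewrite /Dh sf_difE1 // => /subr0_eq.
set w := u (sg g 1) + ksgn (n - 1) L.
have hw : hmg W (d + n) w.
  apply: homogD; first by have := homgh hu (homog_sg1 g).
  apply: homog_ksgn; rewrite -LE; have := homgh hB (sbd_homog vg).
  by apply: homog_eq; rewrite /=; lia.
have dw : dm W w = 0 by rewrite /w raddfD dug raddf_ksgn ksgn1B uL subrr.
have [y wy] := (acyclicP W).1 aW _ dw.
have e : exists2 y, hmg W (d + (n - 1)) y & w = dm W y.
  by have := boundary_homog hw wy; rewrite addrA.
have wE : w = dm W (lift g).
  by rewrite /=; case: pselect => // e'; case: cid2.
rewrite /Dh sf_difE1 // LE {1}/B sext_sg // twist1 scale1r -wE.
by rewrite /w addrK.
Qed.

Lemma lift_null : exists2 v : semifree -> W, hom_deg (n - 1) v & forall f, u f = Dh (n - 1) v f.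
Proof. by exists B => // f; apply: (sf_hom_eq hu hdB) => g /lift_spec. Qed.

End KProjective.

Lemma semifree_K_projective : K_projective semifree.
Proof.
by move=> W aW; apply/Hom_acyclicP => n u hu du; have [v hv uv] := lift_null aW hu du; exists v.
Qed.

End Semifree.

Section SfFlat.
Variables (A : cdgRing) (N W : dgMod A).
Hypothesis aW : acyclic W.
Local Notation sA := (dgr_str A).
Local Notation P := (semifree N).
Local Notation PW := (tensor_dgMod P W).
Local Notation cell := (cell N).
Implicit Types (g : cell) (s : seq cell).

(** Each cell is attached only to later ones, so the tails of the list span a finite filtration by
    submodules closed under the differential, with one new free generator at each step. *)
Fixpoint closed_cells s : Prop :=
  if s is g :: s' then
    [/\ valid g, g \notin s', {subset chld g <= s'} & closed_cells s']
  else True.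

Lemma closed_uniq s : closed_cells s -> uniq s.
Proof. by elim: s => //= g s IH [_ -> _ /IH]. Qed.

(** A cell is a finite tree, so closing up under children adds finitely many cells; the children are
    inserted before [g] is put in front. *)
Lemma closed_extend g s : valid g -> closed_cells s ->
  exists s', [/\ closed_cells s', {subset s <= s'} & g \in s'].
Proof.
elim: g s => n m a h IH x s vg cs; have [vh _ _ _ _] := vg.
have [s' [cs' ss' hs']] : exists s', [/\ closed_cells s', {subset s <= s'} &
    forall i, i \in enum 'I_m -> h i \in s'].
  elim: (enum 'I_m) => [|i l [s1 [cs1 ss1 hs1]]]; first by exists s; split.
  have [s2 [cs2 ss2 hi]] := IH i s1 (vh i) cs1.
  exists s2; split=> // [c /ss1/ss2|j] //.
  by rewrite inE => /orP[/eqP ->|/hs1/ss2].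
set g := Cell n a h x in vg *.
have [gs'|gs'] := boolP (g \in s'); first by exists s'.
exists (g :: s'); split=> [|c /ss' ss'c|]; last by rewrite mem_head.
  by split=> // c /codomP[i ->]; apply: hs'; rewrite mem_enum.
by rewrite inE ss'c orbT.
Qed.

Lemma closed_join s s1 : closed_cells s -> closed_cells s1 ->
  exists s', [/\ closed_cells s', {subset s <= s'} & {subset s1 <= s'}].
Proof.
move=> cs cs1; have : {in s1, forall g, valid g}.
  by elim: s1 cs1 => //= g s1 IH [vg _ _ /IH h] c; rewrite inE => /orP[/eqP ->|/h].
elim: s1 {cs1} => [|g s1 IH] vs; first by exists s; split.
have [|s2 [cs2 ss2 s12]] := IH; first by move=> c cs1; apply: vs; rewrite inE cs1 orbT.
have [s3 [cs3 ss3 gs3]] := closed_extend (vs g (mem_head _ _)) cs2.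
exists s3; split=> // c; first by move=> /ss2/ss3.
by rewrite inE => /orP[/eqP ->|/s12/ss3].
Qed.

Let term (w : cell -> W) g : PW := pure (sg g 1 : P) (w g).

Definition in_span s (t : PW) : Prop :=
  exists w : cell -> W, t = \sum_(g <- s) term w g.

Lemma in_spanD s t t' : in_span s t -> in_span s t' -> in_span s (t + t').
Proof.
move=> [w ->] [w' ->]; exists (fun g => w g + w' g).
by rewrite -big_split; apply: eq_bigr => g _; rewrite /term pureDr.
Qed.

Lemma in_span0 s : in_span s 0.
Proof. by exists (fun=> 0); rewrite big1 // => g _; rewrite /term pure0r. Qed.

Lemma in_spanN s t : in_span s t -> in_span s (- t).
Proof.
move=> [w ->]; exists (fun g => - w g); rewrite -sumrN.
by apply: eq_bigr => g _; rewrite /term pureNr.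
Qed.

Lemma in_span_ksgn n s t : in_span s t -> in_span s (ksgn n t).
Proof. by rewrite /ksgn; case: ifP => // _; exact: in_spanN. Qed.

Lemma in_span_sub s s' t : uniq s -> uniq s' -> {subset s <= s'} ->
  in_span s t -> in_span s' t.
Proof.
move=> us us' ss' [w ->]; exists (fun g => if g \in s then w g else 0).
rewrite (eq_big_seq (term (fun g => if g \in s then w g else 0))).
  apply: (@sum_cover _ PW) => // g; last first.
    by move=> h; apply: ss'; apply: contraR h; rewrite /term => /negPf ->; rewrite pure0r.
  by apply: contraR; rewrite /term => /negPf ->; rewrite pure0r.
by move=> g gs; rewrite /term gs.
Qed.

Lemma in_span1 k g (a : A) q s : homog sA k a -> g \in s -> uniq s ->
  in_span s (pure (sg g a : P) q).
Proof.
move=> ha gs us; exists (fun g' => if g' == g then ksgn (k * cdeg g) (a *: q) else 0).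
rewrite (bigD1_seq g) //= {1}/term eqxx big1 ?addr0; last first.
  by move=> g' /negPf g'g; rewrite /term g'g pure0r.
rewrite pure_ksgnr (pure_bal _ ha (homog_sg1 g)) ksgn_comp -sg1Z (@ksgn_eq _ _ 0) //.
by lia.
Qed.

Lemma span_exists t : exists2 s, closed_cells s & in_span s t.
Proof.
elim/tensor_ind: t => [t t' [s cs ts] [s' cs' ts']|l r p q _ _].
  have [s1 [cs1 ss1 ss1']] := closed_join cs cs'; exists s1 => //.
  apply: in_spanD; first exact: in_span_sub (closed_uniq cs) (closed_uniq cs1) ss1 ts.
  exact: in_span_sub (closed_uniq cs') (closed_uniq cs1) ss1' ts'.
elim/sf_ind: p => [p p' [s cs ts] [s' cs' ts']|g k a vg ha].
  have [s1 [cs1 ss1 ss1']] := closed_join cs cs'; exists s1 => //.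
  rewrite pureDl; apply: in_spanD.
    exact: in_span_sub (closed_uniq cs) (closed_uniq cs1) ss1 ts.
  exact: in_span_sub (closed_uniq cs') (closed_uniq cs1) ss1' ts'.
have [s [cs _ gs]] := closed_extend vg (I : closed_cells [::]); exists s => //.
exact: in_span1 ha gs (closed_uniq cs).
Qed.

Section Coefficient.
Variable e : cell.

(** The coefficient of [e], in view of a[e] (x) q = (-1)^(|e||a|) [e] (x) a q. *)
Let b (p : P) (q : W) : W := twist (cdeg e) (sf_val p e) *: q.

Let bDl q : {morph b^~ q : x y / x + y}.
Proof. by move=> x y; rewrite /b sf_valD twistD scalerDl. Qed.
Let bDr p : {morph b p : x y / x + y}.
Proof. by move=> x y; exact: scalerDr. Qed.
Let b_bal k l (a : A) p q : homog sA k a -> hmg P l p ->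
  b p (a *: q) = ksgn (k * l) (b (a *: p) q).
Proof.
move=> ha hp; have hpe : homog sA (l - cdeg e) (sf_val p e).
  by rewrite -[in X in homog _ _ X]hp; exact: homog_gcomp.
rewrite /b sf_valZ (twistE _ hpe) (twistE _ (dgr_homogM ha hpe)) !scale_ksgn scalerA.
rewrite (cdgr_comm hpe ha) scale_ksgn !ksgn_comp; apply: ksgn_eq; lia.
Qed.

Definition coefA : {additive tensor P W -> W} := tensor_liftA bDl bDr b_bal.
Definition coef (t : PW) : W := coefA t.

Lemma coef_pure p q : coef (pure p q) = twist (cdeg e) (sf_val p e) *: q.
Proof. exact: (tensor_liftE bDl bDr b_bal). Qed.
Lemma coefD t t' : coef (t + t') = coef t + coef t'. Proof. exact: (raddfD coefA). Qed.
Lemma coef0 : coef 0 = 0. Proof. exact: (raddf0 coefA). Qed.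
Lemma coef_ksgn n t : coef (ksgn n t) = ksgn n (coef t). Proof. exact: (raddf_ksgn coefA). Qed.
Lemma coef_sum I (r : seq I) (G : I -> PW) : coef (\sum_(i <- r) G i) = \sum_(i <- r) coef (G i).
Proof. exact: (raddf_sum coefA). Qed.

End Coefficient.

Lemma sbd_notin g g' : valid g -> g' \notin chld g -> sf_val (sbd g) g' = 0.
Proof.
case: g => n m a h x vg g'h; have [vh _ _ _ _] := vg; rewrite sbdE // sf_val_sum big1 // => i _.
rewrite (sgE _ _ (vh i)); case: eqP g'h => // -> /negP[]; exact: codom_f.
Qed.

Lemma pure_sbd_span g s q : valid g -> {subset chld g <= s} -> uniq s ->
  in_span s (pure (sbd g : P) q).
Proof.
case: g => n m a h x vg hs us; have [_ ha _ _ _] := vg; rewrite sbdE //.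
elim/big_ind: _ => [|y z hy hz|i _]; first by rewrite pure0l; exact: in_span0.
  by rewrite pureDl; exact: in_spanD.
by apply: in_span1 (ha i) _ us; apply: hs; exact: codom_f.
Qed.

Lemma chld_closed s g : closed_cells s -> g \in s -> valid g /\ {subset chld g <= s}.
Proof.
elim: s => //= g1 s IH [vg _ cg cs]; rewrite inE => /orP[/eqP ->|/(IH cs)[v h]]; split=> //.
  by move=> c /cg cs'; rewrite inE cs' orbT.
by move=> c /h cs'; rewrite inE cs' orbT.
Qed.

(** Induction along the filtration. The leading cell [e] occurs in no attaching chain of the list,
    so the coefficient of [e] in the differential of [t] is, up to sign, the differential of [w e];
    thus [w e] is a cocycle of [W] and bounds. *)
Lemma span_exact s t : closed_cells s -> in_span s t -> dm PW t = 0 -> exists y, t = dm PW y.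
Proof.
elim: s t => [|e s IH] t; first by move=> _ [w ->] _; exists 0; rewrite big_nil raddf0.
move=> [ve es ce cs] [w tE] dt.
have us := closed_uniq cs.
have cE g v : valid g -> coef e (pure (sg g 1 : P) v) = if e == g then v else 0.
  by move=> vg; rewrite coef_pure sgE //; case: ifP; rewrite ?twist1 ?scale1r ?twist0 ?scale0r.
have dE g v : valid g -> dm PW (pure (sg g 1 : P) v) =
    pure (sbd g : P) v + ksgn (cdeg g) (pure (sg g 1 : P) (dm W v)).
  by move=> vg; rewrite (pure_dif _ (homog_sg1 g)) sf_difE1.
have dw : dm W (w e) = 0.
  apply: (@ksgn_eq0 _ (cdeg e)).
  have := congr1 (coef e) dt; rewrite tE raddf_sum coef_sum big_cons coef0.
  rewrite dE // coefD coef_ksgn cE // eqxx coef_pure sbd_notin //; last first.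
    by apply: contra es => /ce.
  rewrite twist0 scale0r add0r big1_seq ?addr0 // => g /andP[_ gs].
  have [vg cg] := chld_closed cs gs.
  rewrite /term dE // coefD coef_ksgn cE // coef_pure sbd_notin //; last first.
    by apply: contra es => /cg.
  rewrite twist0 scale0r add0r; case: eqP => [eg|_]; last by rewrite ksgn0.
  by rewrite eg gs in es.
have [v wv] := (acyclicP W).1 aW _ dw.
(* The differential of [y] cancels the leading term; the rest involves the attaching chain of [e],
   which lies in the tail. *)
pose y : PW := ksgn (cdeg e) (pure (sg e 1 : P) v).
have [||z tz] := IH (t - dm PW y) cs.
- rewrite /y raddf_ksgn dE // ksgnD ksgnK -wv tE big_cons opprD addrCA.
  rewrite [X in in_span _ (_ + X)]addrAC subrr add0r.
  apply: in_spanD; last by exists w.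
  by apply/in_spanN/in_span_ksgn/pure_sbd_span.
- by rewrite raddfB difK dt subrr.
by exists (z + y); rewrite raddfD -tz subrK.
Qed.

End SfFlat.

Lemma semifree_K_flat (A : cdgRing) (N : dgMod A) : K_flat (semifree N).
Proof.
move=> W aW; apply/acyclicP => t dt; have [s cs ts] := span_exists t.
exact: span_exact cs ts dt.
Qed.

(** A semifree replacement of [Z] is K-flat and so preserves the acyclicity of [G]; K-flatness of
    [G] allows the return to [Z]. *)
Lemma K_flat_acyclic_tensor (A : cdgRing) (G Z : dgMod A) : K_flat G -> acyclic G ->
  acyclic (tensor_dgMod Z G).
Proof.
move=> kG aG; apply/(K_flat_acyclic kG (semifree_qi Z)); exact: semifree_K_flat.
Qed.

(** * Localization *)

Record mset (R : comPzRingType) := Mset {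
  mpred :> R -> Prop;
  mset1 : mpred 1;
  msetM : forall s t, mpred s -> mpred t -> mpred (s * t) }.

Definition S_bij (R : comPzRingType) (S : mset R) (V : lmodType R) : Prop :=
  forall s, S s -> (forall x : V, s *: x = 0 -> x = 0) /\ (forall x : V, exists y, x = s *: y).

Section Localization.
Variables (R : comPzRingType) (S : mset R) (V : lmodType R).

Definition den := {s : R | `[< S s >]}.

Definition mkden s (hs : S s) : den := exist _ s (asboolT hs).

Lemma denP (s : den) : S (val s). Proof. exact/asboolP/(valP s). Qed.

Definition den_mul (s t : den) : den := mkden (msetM (denP s) (denP t)).
Definition den_one : den := mkden (mset1 S).

Definition loc_rel (x y : V * den) : bool :=
  `[< exists2 u, S u & (u * val y.2) *: x.1 = (u * val x.2) *: y.1 >].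

Lemma loc_rel_equiv : equiv_class_of loc_rel.
Proof.
split=> [x|x y|y x z]; first by apply/asboolP; exists 1; [exact: mset1|].
  by apply/asboolP/asboolP => -[u hu e]; exists u.
move=> /asboolP[u hu e] /asboolP[w hw e']; apply/asboolP.
exists (u * w * val y.2); first by apply: msetM (denP _); exact: msetM.
have -> : u * w * val y.2 * val z.2 = w * val z.2 * (u * val y.2) by ring.
rewrite -scalerA e scalerA.
have -> : w * val z.2 * (u * val x.2) = u * val x.2 * (w * val z.2) by ring.
by rewrite -scalerA e' scalerA /=; congr (_ *: _); ring.
Qed.

Canonical loc_equiv := EquivRelPack loc_rel_equiv.

Definition loc : Type := {eq_quot loc_equiv}%qT.
HB.instance Definition _ := Choice.on loc.

Definition frac (v : V) (s : den) : loc := \pi_({eq_quot loc_equiv})%qT (v, s).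

Lemma fracP v s w t : frac v s = frac w t <->
  exists2 u, S u & (u * val t) *: v = (u * val s) *: w.
Proof.
by split=> [/eqmodP/asboolP|h] //; apply/eqmodP/asboolP.
Qed.

Lemma loc_surj (x : loc) : exists v s, x = frac v s.
Proof. by exists (repr x).1, (repr x).2; rewrite /frac -surjective_pairing reprK. Qed.

Lemma frac_mul v s t : frac (val t *: v) (den_mul s t) = frac v s.
Proof. by apply/fracP; exists 1; [exact: mset1 | rewrite scalerA /=; congr (_ *: _); ring]. Qed.

Definition loc_add (x y : loc) : loc :=
  frac (val (repr y).2 *: (repr x).1 + val (repr x).2 *: (repr y).1) (den_mul (repr x).2 (repr y).2).
Definition loc_opp (x : loc) : loc := frac (- (repr x).1) (repr x).2.
Definition loc_scale (a : R) (x : loc) : loc := frac (a *: (repr x).1) (repr x).2.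

Lemma repr_frac v s : exists2 u, S u & (u * val s) *: (repr (frac v s)).1 =
  (u * val (repr (frac v s)).2) *: v.
Proof. by apply/fracP; rewrite /frac -surjective_pairing reprK. Qed.

Lemma loc_addE v s w t :
  loc_add (frac v s) (frac w t) = frac (val t *: v + val s *: w) (den_mul s t).
Proof.
have [a ha ea] := repr_frac v s; have [b hb eb] := repr_frac w t.
set x := repr (frac v s) in ea *; set y := repr (frac w t) in eb *.
apply/fracP; exists (a * b); first exact: msetM.
rewrite !scalerDr !scalerA /=; congr (_ + _).
  have -> : a * b * (val s * val t) * val y.2 = b * val t * val y.2 * (a * val s) by ring.
  by rewrite -scalerA ea scalerA /=; congr (_ *: _); ring.
have -> : a * b * (val s * val t) * val x.2 = a * val s * val x.2 * (b * val t) by ring.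
by rewrite -scalerA eb scalerA /=; congr (_ *: _); ring.
Qed.

Lemma loc_oppE v s : loc_opp (frac v s) = frac (- v) s.
Proof.
have [a ha ea] := repr_frac v s; apply/fracP; exists a => //.
by rewrite !scalerN ea.
Qed.

Lemma loc_scaleE c v s : loc_scale c (frac v s) = frac (c *: v) s.
Proof.
have [a ha ea] := repr_frac v s; apply/fracP; exists a => //.
by rewrite scalerA [_ * c]mulrC -(scalerA c) ea !scalerA; congr (_ *: _); ring.
Qed.

Definition loc_zero : loc := frac 0 den_one.

Lemma loc_eq v s w t : val s = val t -> v = w -> frac v s = frac w t.
Proof. by move=> /val_inj -> ->. Qed.

Lemma loc_addA : associative loc_add.
Proof.
move=> x y z; have [v [s ->]] := loc_surj x; have [w [t ->]] := loc_surj y.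
have [u [r ->]] := loc_surj z; rewrite !loc_addE; apply: loc_eq => /=; first by ring.
rewrite !scalerDr !scalerA -addrA; congr (_ *: _ + (_ *: _ + _)); ring.
Qed.
Lemma loc_addC : commutative loc_add.
Proof.
move=> x y; have [v [s ->]] := loc_surj x; have [w [t ->]] := loc_surj y.
by rewrite !loc_addE addrC; apply: loc_eq => //=; ring.
Qed.
Lemma loc_add0 : left_id loc_zero loc_add.
Proof.
move=> x; have [v [s ->]] := loc_surj x; rewrite loc_addE scaler0 add0r.
by apply: loc_eq; rewrite /= ?mul1r ?scale1r.
Qed.
Lemma loc_addN : left_inverse loc_zero loc_opp loc_add.
Proof.
move=> x; have [v [s ->]] := loc_surj x; rewrite loc_oppE loc_addE scalerN addNr.
by apply/fracP; exists 1; rewrite ?scaler0 //; exact: mset1.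
Qed.

HB.instance Definition _ := GRing.isZmodule.Build loc loc_addA loc_addC loc_add0 loc_addN.

Lemma loc_scaleA a b x : loc_scale a (loc_scale b x) = loc_scale (a * b) x.
Proof. by have [v [s ->]] := loc_surj x; rewrite !loc_scaleE scalerA. Qed.
Lemma loc_scale1 : left_id 1 loc_scale.
Proof. by move=> x; have [v [s ->]] := loc_surj x; rewrite loc_scaleE scale1r. Qed.
Lemma loc_scaleDr : right_distributive loc_scale +%R.
Proof.
move=> a x y; have [v [s ->]] := loc_surj x; have [w [t ->]] := loc_surj y.
rewrite [frac v s + _]loc_addE !loc_scaleE [RHS]loc_addE; apply: loc_eq => //.
by rewrite scalerDr !scalerA ![_ * a]mulrC.
Qed.
Lemma loc_scaleDl x : {morph loc_scale^~ x : a b / a + b}.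
Proof.
move=> a b; have [v [s ->]] := loc_surj x; rewrite !loc_scaleE [RHS]loc_addE.
rewrite -[LHS](frac_mul _ _ s); apply: loc_eq => //.
by rewrite scalerDl scalerDr.
Qed.

HB.instance Definition _ := GRing.Zmodule_isLmodule.Build R loc
  loc_scaleA loc_scale1 loc_scaleDr loc_scaleDl.

Definition loc_in (v : V) : loc := frac v den_one.

Lemma loc_inD : {morph loc_in : x y / x + y}.
Proof.
move=> x y; rewrite [RHS]loc_addE; apply: loc_eq; rewrite /= ?mul1r //.
by rewrite !scale1r.
Qed.
Lemma loc_inZ a x : loc_in (a *: x) = a *: loc_in x.
Proof. by rewrite [RHS]loc_scaleE. Qed.

Lemma loc_in_eq0 v : loc_in v = 0 -> exists2 s, S s & s *: v = 0.
Proof. by move=> /fracP[u hu]; rewrite scaler0 mulr1 => e; exists u. Qed.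

Lemma loc_den (x : loc) : exists s v, S s /\ s *: x = loc_in v.
Proof.
have [v [s ->]] := loc_surj x; exists (val s), v; split; first exact: denP.
rewrite [LHS]loc_scaleE; apply/fracP; exists 1; first exact: mset1.
by rewrite /= !mul1r scale1r.
Qed.

Lemma loc_bij : S_bij S loc.
Proof.
move=> s hs; split=> x; have [v [t ->]] := loc_surj x.
  rewrite [LHS]loc_scaleE => /fracP[u hu]; rewrite scaler0 mulr1 scalerA => e.
  apply/fracP; exists (u * s); first exact: msetM.
  by rewrite mulr1 scaler0.
exists (frac v (den_mul t (mkden hs))); rewrite [RHS]loc_scaleE.
by rewrite -[LHS](frac_mul _ _ (mkden hs)).
Qed.

Section Lift.
Variables (Y : lmodType R) (bY : S_bij S Y) (f : V -> Y).
Hypothesis fD : {morph f : x y / x + y}.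
Hypothesis fZ : forall a x, f (a *: x) = a *: f x.

(** For one fraction v/s representing [x], the solution of s y = f v serves every other fraction,
    since elements of [S] can be cancelled in [Y]. *)
Let lift_ex (x : loc) : exists y, forall s v, s *: x = loc_in v -> s *: y = f v.
Proof.
have [s [v [hs sx]]] := loc_den x; have [sinj ssur] := bY hs.
have [y fv] := ssur (f v); exists y => t w tx.
have fN u : f (- u) = - f u by rewrite -scaleN1r fZ scaleN1r.
have : loc_in (s *: w - t *: v) = 0.
  by rewrite -scaleNr loc_inD !loc_inZ -tx -sx !scalerA -scalerDl mulNr mulrC subrr scale0r.
move=> /loc_in_eq0[u hu /(congr1 f)]; rewrite fZ (_ : f 0 = 0); last first.
  by rewrite -(scale0r (0 : V)) fZ scale0r.
move=> /(bY hu).1/eqP; rewrite fD fN subr_eq0 !fZ => /eqP e.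
apply/eqP; rewrite -subr_eq0; apply/eqP/sinj.
by rewrite scalerBr e fv scalerA scalerA mulrC subrr.
Qed.

Definition loc_lift (x : loc) : Y := sval (cid (lift_ex x)).

Lemma loc_liftP s v x : s *: x = loc_in v -> s *: loc_lift x = f v.
Proof. by rewrite /loc_lift; case: cid => y /= h; exact: h. Qed.

Lemma loc_lift_in v : loc_lift (loc_in v) = f v.
Proof. by rewrite -[LHS]scale1r; apply: loc_liftP; rewrite scale1r. Qed.

Lemma loc_liftD : {morph loc_lift : x y / x + y}.
Proof.
move=> x y; have [s [v [hs sx]]] := loc_den x; have [t [w [ht ty]]] := loc_den y.
apply/eqP; rewrite -subr_eq0; apply/eqP; apply: (bY (msetM hs ht)).1.
rewrite scalerBr (loc_liftP (v := t *: v + s *: w)).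
  rewrite fD !fZ -(loc_liftP sx) -(loc_liftP ty) scalerDr !scalerA [t * s]mulrC subrr //.
by rewrite loc_inD !loc_inZ -sx -ty scalerDr !scalerA [t * s]mulrC.
Qed.

Lemma loc_liftZ a x : loc_lift (a *: x) = a *: loc_lift x.
Proof.
have [s [v [hs sx]]] := loc_den x.
apply/eqP; rewrite -subr_eq0; apply/eqP; apply: (bY hs).1.
rewrite scalerBr (loc_liftP (v := a *: v)); first by rewrite fZ -(loc_liftP sx) !scalerA mulrC subrr.
by rewrite loc_inZ -sx !scalerA mulrC.
Qed.

End Lift.

Lemma loc_hom_eq (Y : lmodType R) (f g : loc -> Y) : S_bij S Y ->
  (forall a x, f (a *: x) = a *: f x) -> (forall a x, g (a *: x) = a *: g x) ->
  (forall v, f (loc_in v) = g (loc_in v)) -> forall x, f x = g x.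
Proof.
move=> bY fZ gZ fg x; have [s [v [hs sx]]] := loc_den x.
apply/eqP; rewrite -subr_eq0; apply/eqP; apply: (bY _ hs).1.
by rewrite scalerBr -fZ -gZ sx fg subrr.
Qed.

End Localization.

(** * Complexes over an ordinary commutative ring *)

Section OverRing.
Variable R : comPzRingType.
Local Notation B := (conc R).
Implicit Types (M N : dgMod B).

Lemma homog_conc0 (a : B) : homog (dgr_str B) 0 a.
Proof. by apply/homog_conc; left. Qed.

Lemma gcomp_linear M n (a : R) (x : M) :
  gcomp (dgm_str M) n (a *: x) = a *: gcomp (dgm_str M) n x.
Proof. by rewrite (gcompZ n x (homog_conc0 a)) subr0. Qed.

Lemma dif_linear M (a : R) (x : M) : dm M (a *: x) = a *: dm M x.
Proof. by rewrite (dgm_leibniz x (homog_conc0 a)) scale0r add0r. Qed.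

Lemma homog_linear M n (a : R) (x : M) : hmg M n x -> hmg M n (a *: x).
Proof. by move=> hx; have := dgm_homogZ (homog_conc0 a) hx; rewrite add0r. Qed.

Lemma conc_deg M N n (f : M -> N) : {morph f : x y / x + y} ->
  (forall i x, hmg M i x -> hmg N (i + n) (f x)) ->
  (forall (a : R) x, f (a *: x) = a *: f x) -> hom_deg n f.
Proof.
move=> fD fh fZ; split=> // k a x /homog_conc[->|->]; first by rewrite mulr0 fZ.
by rewrite fZ scale0r ksgn0.
Qed.

Lemma conc_hom_linear M N n (f : M -> N) (a : R) x : hom_deg n f -> f (a *: x) = a *: f x.
Proof. by move=> hf; rewrite (homgZ hf _ (homog_conc0 a)) mulr0. Qed.

Section Builder.
Variables (V : lmodType R) (X : dgStruct V).
Hypothesis XgZ : forall n (a : R) x, gcomp X n (a *: x) = a *: gcomp X n x.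
Hypothesis XdZ : forall (a : R) x, dif X (a *: x) = a *: dif X x.

(** A homogeneous scalar of nonzero degree is 0 here, so the Leibniz rule reduces to linearity of
    the differential. *)
Definition conc_dgMod : dgMod B.
Proof.
apply: (@DGMod B (V : lmodType B) X) => [m n a x /homog_conc ha hx|m a x /homog_conc ha].
  case: ha => [->|->]; last by rewrite scale0r; exact: homog0.
  by rewrite add0r /homog [LHS]XgZ hx.
rewrite scale0r add0r; case: ha => [->|->]; first exact: XdZ.
by rewrite !scale0r ksgn0 raddf0.
Defined.

End Builder.

Section Concentrated.
Variable V : lmodType R.

Definition ccomp (n : int) : {additive V -> V} :=
  if n == 0 then (idfun : {additive V -> V}) else (\0 : {additive V -> V}).

Lemma ccompE n x : ccomp n x = if n == 0 then x else 0.
Proof. by rewrite /ccomp; case: ifP. Qed.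

Lemma ccompK m n x : ccomp m (ccomp n x) = if m == n then ccomp n x else 0.
Proof.
rewrite !ccompE; case: (n =P 0) => [->|_]; last by rewrite !if_same.
by case: (m == 0).
Qed.

Lemma ccomp_sum x : exists2 s : seq int, uniq s & x = \sum_(n <- s) ccomp n x.
Proof. by exists [:: 0]; rewrite // big_seq1. Qed.

Definition cstr : dgStruct V.
Proof. by apply: (@DGStruct _ (Grading ccompK ccomp_sum) \0) => // n x _; exact: homog0. Defined.

Lemma ccompZ n (a : R) x : gcomp cstr n (a *: x) = a *: gcomp cstr n x.
Proof. by rewrite /= !ccompE; case: ifP; rewrite ?scaler0. Qed.

Lemma cdifZ (a : R) x : dif cstr (a *: x) = a *: dif cstr x.
Proof. by rewrite /= scaler0. Qed.

Definition cmod : dgMod B := conc_dgMod ccompZ cdifZ.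

Lemma homog_cmod n (x : V) : hmg cmod n x <-> (n = 0 \/ x = 0).
Proof.
rewrite /homog /= ccompE; case: eqP => [->|n0]; split=> //; first by left.
- by right.
- by case.
Qed.

Lemma cmod_dif (x : V) : dm cmod x = 0. Proof. by []. Qed.

End Concentrated.

Lemma cmod_deg (V : lmodType R) N n (f : V -> N) : {morph f : x y / x + y} ->
  (forall (a : R) x, f (a *: x) = a *: f x) -> (forall x, hmg N n (f x)) ->
  hom_deg n (f : cmod V -> N).
Proof.
move=> fD fZ fh; apply: conc_deg => // i x /homog_cmod[->|->]; first by rewrite add0r.
by rewrite -(scale0r (0 : V)) fZ scale0r; exact: homog0.
Qed.

Definition cmod_map (V W : lmodType R) (f : V -> W) (fD : {morph f : x y / x + y})
  (fZ : forall (a : R) x, f (a *: x) = a *: f x) : dgHom (cmod V) (cmod W).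
Proof.
apply: (@deg0_dgHom B (cmod V) (cmod W) f).
  apply: cmod_deg => // x; exact/homog_cmod/or_introl.
by move=> x; rewrite /Dh !cmod_dif ksgn_id -(scale0r (0 : V)) fZ scale0r subrr.
Defined.

Section DgLoc.
Variables (S : mset R) (M : dgMod B).
Local Notation L := (loc S (dgm_sort M : lmodType R)).
Local Notation i := (@loc_in R S (dgm_sort M : lmodType R)).

Definition locf (f : M -> M) (fD : {morph f : x y / x + y})
  (fZ : forall (a : R) x, f (a *: x) = a *: f x) : L -> L :=
  @loc_lift R S (dgm_sort M : lmodType R) _ (@loc_bij _ _ _) (fun x => i (f x))
    (fun x y => etrans (congr1 i (fD x y)) (loc_inD _ _ _)) 
    (fun a x => etrans (congr1 i (fZ a x)) (loc_inZ _ _ _)).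

Section LocF.
Variables (f : M -> M) (fD : {morph f : x y / x + y})
  (fZ : forall (a : R) x, f (a *: x) = a *: f x).
Lemma locfD : {morph locf fD fZ : x y / x + y}. Proof. exact: loc_liftD. Qed.
Lemma locfZ a x : locf fD fZ (a *: x) = a *: locf fD fZ x. Proof. exact: loc_liftZ. Qed.
Lemma locf_in x : locf fD fZ (i x) = i (f x). Proof. exact: loc_lift_in. Qed.
End LocF.

Definition lcomp n : {additive L -> L} :=
  mk_additive (zmod_morphD (locfD (raddfD (gcomp (dgm_str M) n)) (gcomp_linear n))).

Definition ldif : {additive L -> L} :=
  mk_additive (zmod_morphD (locfD (raddfD (dm M)) (@dif_linear M))).

Lemma lcompZ n (a : R) x : lcomp n (a *: x) = a *: lcomp n x. Proof. exact: locfZ. Qed.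
Lemma ldifZ (a : R) x : ldif (a *: x) = a *: ldif x. Proof. exact: locfZ. Qed.
Lemma lcomp_in n x : lcomp n (i x) = i (gcomp (dgm_str M) n x). Proof. exact: locf_in. Qed.
Lemma ldif_in x : ldif (i x) = i (dm M x). Proof. exact: locf_in. Qed.

Lemma lcompK m n x : lcomp m (lcomp n x) = if m == n then lcomp n x else 0.
Proof.
have h v : lcomp m (lcomp n (i v)) = if m == n then lcomp n (i v) else 0.
  by rewrite !lcomp_in gcompK; case: ifP.
case: ifP h => _ h.
  apply: (loc_hom_eq (f := fun x => lcomp m (lcomp n x)) (g := fun x => lcomp n x)
    (@loc_bij _ _ _)) => // a y; by rewrite !lcompZ.
apply: (loc_hom_eq (f := fun x => lcomp m (lcomp n x)) (g := fun=> 0)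
  (@loc_bij _ _ _)) => // a y; by rewrite ?lcompZ ?scaler0.
Qed.

Lemma lcomp_sum x : exists2 s : seq int, uniq s & x = \sum_(n <- s) lcomp n x.
Proof.
have [s [v [hs sx]]] := loc_den x.
have [t ut vE] := gcomp_sum (dgm_str M) v; exists t => //.
apply/eqP; rewrite -subr_eq0; apply/eqP; apply: (@loc_bij _ _ _ _ hs).1.
have iD := @loc_inD R S (dgm_sort M : lmodType R).
rewrite scalerBr scaler_sumr (eq_bigr (fun n => i (gcomp (dgm_str M) n v))).
  rewrite sx {1}vE -[i (\sum_(n <- t) _)]/(mk_additive (zmod_morphD iD) _) raddf_sum.
  exact: subrr.
by move=> n _; rewrite -lcompZ sx lcomp_in.
Qed.

Definition lstr : dgStruct L.
Proof.
apply: (@DGStruct _ (Grading lcompK lcomp_sum) ldif) => [n x hx|x].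
  rewrite /homog -{2}hx.
  apply: (loc_hom_eq (f := fun x => lcomp (n + 1) (ldif x)) (g := fun x => ldif (lcomp n x))
    (@loc_bij _ _ _)) => [a y|a y|v].
  - by rewrite ldifZ lcompZ.
  - by rewrite lcompZ ldifZ.
  by rewrite ldif_in !lcomp_in ldif_in gcomp_dif addrK.
apply: (loc_hom_eq (f := fun x => ldif (ldif x)) (g := fun=> 0) (@loc_bij _ _ _)) => [a y|a y|v].
- by rewrite !ldifZ.
- by rewrite scaler0.
by rewrite !ldif_in difK.
Defined.

Definition locdg : dgMod B := @conc_dgMod L lstr lcompZ ldifZ.

Lemma locdg_dif_in (x : M) : dm locdg (i x) = i (dm M x). Proof. exact: ldif_in. Qed.

Lemma locdg_homog_in n (x : M) : hmg M n x -> hmg locdg n (i x).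
Proof. by move=> hx; rewrite /homog [LHS]lcomp_in hx. Qed.

Definition locdg_in : dgHom M locdg.
Proof.
apply: (@deg0_dgHom B M locdg i).
  apply: conc_deg => [|k x hx|]; [exact: loc_inD| |exact: loc_inZ].
  by rewrite addr0; exact: locdg_homog_in.
by move=> x; rewrite /Dh locdg_dif_in ksgn_id subrr.
Defined.

End DgLoc.

End OverRing.

(** * Localization of complexes and tensor products *)

Section LocTheory.
Variables (R : comPzRingType) (S : mset R).
Local Notation B := (conc R).
Implicit Types (M N G : dgMod B).

Lemma cpureZ M G (a : R) (p : M) (q : G) :
  a *: (pure p q : tensor_dgMod M G) = pure (a *: p) q.
Proof. exact: pureZ. Qed.

Lemma cHomgZ M G (a : R) (x : Hom_dgMod M G) p : Hom_val (a *: x) p = a *: Hom_val x p.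
Proof. exact: HomgZ. Qed.

Lemma cdgHomZ M N (f : dgHom M N) (a : R) x : f (a *: x) = a *: f x.
Proof. exact: dgHomZ. Qed.

Definition bijM M : Prop := S_bij S (dgm_sort M : lmodType R).

(** Elements of [S] act bijectively on cohomology, phrased with total cocycles as in
    [quasi_isoP]. *)
Definition qbij M : Prop := forall s, S s ->
  (forall z y : M, dm M z = 0 -> s *: z = dm M y -> exists x, z = dm M x) /\
  (forall z : M, dm M z = 0 -> exists z' y, dm M z' = 0 /\ z = s *: z' + dm M y).

Lemma bij_inj M s (x y : M) : bijM M -> S s -> s *: x = s *: y -> x = y.
Proof.
move=> bM hs e; apply/eqP; rewrite -subr_eq0; apply/eqP; apply: (bM s hs).1.
by rewrite scalerBr e subrr.
Qed.

Lemma locdg_bij M : bijM (locdg S M). Proof. exact: loc_bij. Qed.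

Lemma locdg_den M (x : locdg S M) : exists s v, S s /\ s *: x = locdg_in S M v.
Proof. exact: loc_den. Qed.

Lemma locdg_in_eq0 M v : locdg_in S M v = 0 -> exists2 s, S s & s *: v = 0.
Proof. exact: loc_in_eq0. Qed.

Lemma locdg_cocycle M (x : locdg S M) : dm _ x = 0 ->
  exists s v, [/\ S s, dm M v = 0 & s *: x = locdg_in S M v].
Proof.
move=> dx; have [s [v [hs sx]]] := locdg_den x.
have : locdg_in S M (dm M v) = 0 by rewrite dgh_dif -sx dif_linear dx scaler0.
move=> /locdg_in_eq0[u hu uv]; exists (u * s), (u *: v); split; first exact: msetM.
  by rewrite dif_linear uv.
by rewrite -scalerA sx cdgHomZ.
Qed.

(** Denominators are cleared in the localization and divided out again on cohomology classes of
    [M]. *)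
Lemma locdg_in_qi M : qbij M -> quasi_iso (locdg_in S M).
Proof.
move=> qM; apply/quasi_isoP; split=> [z y dz zy|w dw].
  have [s [v [hs sy]]] := locdg_den y.
  have : locdg_in S M (s *: z - dm M v) = 0.
    by rewrite dgHomB cdgHomZ zy dgh_dif -sy dif_linear subrr.
  move=> /locdg_in_eq0[u hu]; rewrite scalerBr scalerA -dif_linear => /subr0_eq e.
  exact: (qM _ (msetM hu hs)).1 e.
have [s [v [hs dv sw]]] := locdg_cocycle dw.
have [z [y [dz vE]]] := (qM _ hs).2 _ dv.
have [y' yE] := (@locdg_bij M s hs).2 (locdg_in S M y).
exists z, y'; split=> //; apply: (bij_inj (@locdg_bij M) hs).
by rewrite sw vE dgHomD cdgHomZ dgh_dif scalerDr -dif_linear -yE.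
Qed.

Section Extend.
Variables (M N : dgMod B) (bN : bijM N) (f : dgHom M N).

Let ext := loc_lift bN (dgHomD f) (cdgHomZ f).

Let ext_eq (g h : locdg S M -> N) : (forall (a : R) x, g (a *: x) = a *: g x) ->
  (forall (a : R) x, h (a *: x) = a *: h x) ->
  (forall v, g (locdg_in S M v) = h (locdg_in S M v)) -> forall x, g x = h x.
Proof. exact: loc_hom_eq bN. Qed.

Lemma extD : {morph (ext : locdg S M -> N) : x y / x + y}. Proof. exact: loc_liftD. Qed.
Lemma extZ (a : R) (x : locdg S M) : ext (a *: x) = a *: ext x. Proof. exact: loc_liftZ. Qed.
Lemma ext_in v : ext (locdg_in S M v) = f v. Proof. exact: loc_lift_in. Qed.

Lemma ext_deg : hom_deg 0 (ext : locdg S M -> N).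
Proof.
apply: conc_deg => [|i x hx|]; [exact: extD| |exact: extZ].
rewrite addr0 /homog -[in RHS]hx; symmetry.
apply: (ext_eq (g := fun x => ext (gcomp (dgm_str (locdg S M)) i x))
  (h := fun x => gcomp (dgm_str N) i (ext x))) => [a y|a y|v].
- by rewrite gcomp_linear extZ.
- by rewrite extZ gcomp_linear.
by rewrite gcomp_dgHom !ext_in gcomp_dgHom.
Qed.

Lemma ext_dif (x : locdg S M) : Dh 0 (ext : locdg S M -> N) x = 0.
Proof.
apply/eqP; rewrite subr_eq0 ksgn_id; apply/eqP.
apply: (ext_eq (g := fun x => dm N (ext x)) (h := fun x => ext (dm (locdg S M) x))) => [a y|a y|v].
- by rewrite extZ dif_linear.
- by rewrite dif_linear extZ.
by rewrite -dgh_dif !ext_in dgh_dif.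
Qed.

Definition locdg_ext : dgHom (locdg S M) N := deg0_dgHom ext_deg ext_dif.

Lemma locdg_ext_in v : locdg_ext (locdg_in S M v) = f v. Proof. exact: ext_in. Qed.

End Extend.

Definition locdg_map M N (f : dgHom M N) : dgHom (locdg S M) (locdg S N) :=
  locdg_ext (@locdg_bij N) (comp_dgHom (locdg_in S N) f).

Lemma locdg_map_in M N (f : dgHom M N) v : locdg_map f (locdg_in S M v) = locdg_in S N (f v).
Proof. exact: locdg_ext_in. Qed.

Lemma locdg_map_qi M N (f : dgHom M N) : quasi_iso f -> quasi_iso (locdg_map f).
Proof.
move=> /quasi_isoP[fi fs]; apply/quasi_isoP; split=> [x y dx xy|w dw].
  have [s [v [hs dv sx]]] := locdg_cocycle dx; have [t [w [ht ty]]] := locdg_den y.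
  have : locdg_in S N (t *: f v - s *: dm N w) = 0.
    rewrite dgHomB !cdgHomZ -locdg_map_in -sx cdgHomZ xy dgh_dif -ty dif_linear.
    by rewrite !scalerA mulrC subrr.
  move=> /locdg_in_eq0[u hu]; rewrite scalerBr -!dif_linear -!(cdgHomZ f) => /subr0_eq e.
  have [|x' x'E] := fi _ _ _ e; first by rewrite !dif_linear dv !scaler0.
  have hut : S (u * (t * s)) by apply: msetM => //; exact: msetM.
  have [x'' xE] := (@locdg_bij M _ hut).2 (locdg_in S M x').
  exists x''; apply: (bij_inj (@locdg_bij M) hut).
  by rewrite -dif_linear -xE -dgh_dif -x'E !cdgHomZ -sx !scalerA mulrA.
have [s [v [hs dv sw]]] := locdg_cocycle dw.
have [z [y [dz vE]]] := fs _ dv.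
have [y' yE] := (@locdg_bij N s hs).2 (locdg_in S N y).
have [z' zE] := (@locdg_bij M s hs).2 (locdg_in S M z).
exists z', y'; split; first apply: (bij_inj (@locdg_bij M) hs).
  by rewrite -dif_linear -zE -dgh_dif dz scaler0 dgHom0.
apply: (bij_inj (@locdg_bij N) hs).
by rewrite sw vE scalerDr -dif_linear -yE -(cdgHomZ (locdg_map f)) -zE locdg_map_in dgHomD dgh_dif.
Qed.

(** Division by [s] on [M] is linear of degree 0, so it can be applied to the left factor. *)
Lemma bij_tensor M G : bijM M -> bijM (tensor_dgMod M G).
Proof.
move=> bM s hs; have [inj sur] := bM _ hs.
pose g x : M := sval (cid (sur x)).
have gE x : s *: g x = x by rewrite /g; case: cid.
have hg : hom_deg 0 g.
  apply: conc_deg => [x y|i x hx|a x]; first by apply: (bij_inj bM hs); rewrite scalerDr !gE.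
    rewrite addr0 /homog; apply: (bij_inj bM hs); rewrite -gcomp_linear gE; exact: hx.
  by apply: (bij_inj bM hs); rewrite scalerA mulrC -scalerA !gE.
have sg (t : tensor_dgMod M G) : s *: (tmap g t : tensor_dgMod M G) = t.
  elim/tensor_ind: t => [x y IHx IHy|l r p q hp hq].
    by rewrite (tmapD hg) scalerDr IHx IHy.
  by rewrite (tmap_pure hg) cpureZ gE.
have gs (t : tensor_dgMod M G) : tmap g (s *: t) = t.
  elim/tensor_ind: t => [x y IHx IHy|l r p q hp hq].
    by rewrite scalerDr (tmapD hg) IHx IHy.
  rewrite cpureZ (tmap_pure hg); congr (pure _ _).
  by apply: (bij_inj bM hs); rewrite gE.
split=> [x sx|x]; first by rewrite -(gs x) sx (tmap0 _ hg).
by exists (tmap g x); rewrite sg.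
Qed.

Lemma bij_Hom M G : bijM M -> bijM (Hom_dgMod G M).
Proof.
move=> bM s hs; have [inj sur] := bM _ hs.
pose g x : M := sval (cid (sur x)).
have gE x : s *: g x = x by rewrite /g; case: cid.
have hg : hom_deg 0 g.
  apply: conc_deg => [x y|i x hx|a x]; first by apply: (bij_inj bM hs); rewrite scalerDr !gE.
    rewrite addr0 /homog; apply: (bij_inj bM hs); rewrite -gcomp_linear gE; exact: hx.
  by apply: (bij_inj bM hs); rewrite scalerA mulrC -scalerA !gE.
split=> [x sx|x].
  by apply: Hom_eq => p; apply: inj; rewrite -cHomgZ sx.
have hx : (fun p => g (Hom_val x p)) \in is_hom (P := G) (N := M).
  suff K : forall f : G -> M, f \in is_hom (P := G) (N := M) ->
    (fun p => g (f p)) \in is_hom (P := G) (N := M) by exact: (K _ (valP x)).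
  apply: (is_hom_ind (K := fun f : G -> M =>
      (fun p => g (f p)) \in is_hom (P := G) (N := M))) => [f f' hf hf'|n f hf].
    have -> : (fun p => g ((f + f') p)) = (fun p => g (f p)) + (fun p => g (f' p)).
      by apply/funext => p; rewrite (homgD hg).
    exact: is_homD.
  by apply: (is_hom_deg (n := n)); apply: hom_deg_compE hg hf; rewrite addr0.
by exists (MkHom hx); apply: Hom_eq => p; rewrite cHomgZ /= gE.
Qed.

Section LocTensor.
Variables M G : dgMod B.
Local Notation MG := (tensor_dgMod M G).
Local Notation LMG := (locdg S MG).

(** The map out of the localization is built in curried form: [S] acts bijectively on this Hom
    complex, so [c] extends from [M] to its localization. *)
Let c : dgHom M (Hom_dgMod G LMG).
Proof.
apply: (deg0_dgHom (curry_deg (dgHom_deg (locdg_in S MG)))) => t; apply: Hom_eq => x.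
by rewrite curry_Dh Dh_dgHom.
Defined.

Let cE m g : Hom_val (c m) g = locdg_in S MG (pure m g). Proof. by []. Qed.

Let e := locdg_ext (@bij_Hom _ G (@locdg_bij MG)) c.

(* (x / s) (x) g |-> (x (x) g) / s *)
Definition loc_tensor : dgHom (tensor_dgMod (locdg S M) G) LMG.
Proof.
apply: (deg0_dgHom (uncurry_deg (dgHom_deg e))).
elim/tensor_ind => [x y hx hy|l r p q hp hq].
  by rewrite (homgD (Dh_deg (uncurry_deg (dgHom_deg e)))) hx hy addr0.
by rewrite uncurry_Dh Dh_dgHom.
Defined.

Lemma loc_tensor_pure x g : loc_tensor (pure x g) = Hom_val (e x) g.
Proof. exact: (uncurryE (dgHom_deg e)). Qed.

Let a := locdg_ext (@bij_tensor _ G (@locdg_bij M)) (tensor_l (locdg_in S M) G).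

Let a_pure m g : a (locdg_in S MG (pure m g)) = pure (locdg_in S M m) g.
Proof. by rewrite locdg_ext_in tensor_lE (tmap_pure (dgHom_deg _)). Qed.

Lemma loc_tensor_qi : quasi_iso loc_tensor.
Proof.
apply: (@iso_qi _ _ _ _ a); [by move=> x; rewrite dgh_dif|exact: dgHom0| |].
  elim/tensor_ind => [x y hx hy|l r p q hp hq]; first by rewrite !dgHomD hx hy.
  have [s [v [hs sp]]] := locdg_den p.
  apply: (bij_inj (@bij_tensor _ G (@locdg_bij M)) hs).
  rewrite -(cdgHomZ a) -(cdgHomZ loc_tensor) cpureZ sp loc_tensor_pure locdg_ext_in cE a_pure //.
apply: (loc_hom_eq (f := fun x => loc_tensor (a x)) (g := id) (@locdg_bij MG)) => // [b x|].
  by rewrite !cdgHomZ.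
elim/tensor_ind => [x y hx hy|l r p q hp hq]; first by rewrite [loc_in _ _]loc_inD !dgHomD hx hy.
by rewrite [a _]a_pure loc_tensor_pure locdg_ext_in cE.
Qed.

End LocTensor.

Section UnitTensor.
Variable G : dgMod B.
Local Notation U := (cmod R^o).

Let b (r : U) (g : G) : G := (r : B) *: g.
Let bDl g : {morph b^~ g : x y / x + y}. Proof. by move=> x y; exact: scalerDl. Qed.
Let bDr r : {morph b r : x y / x + y}. Proof. by move=> x y; exact: scalerDr. Qed.
Let b_bal k l (a : B) (r : U) g : homog (dgr_str B) k a -> hmg U l r ->
  b r (a *: g) = ksgn (k * l) (b (a *: r) g).
Proof.
move=> /homog_conc[->|->] _; first by rewrite mul0r /b scalerA [_ * a]mulrC -scalerA ksgn_id scalerA.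
by rewrite /b scale0r scaler0 scale0r scale0r ksgn0.
Qed.

Let uA : {additive tensor U G -> G} := tensor_liftA bDl bDr b_bal.
Let u : tensor_dgMod U G -> G := uA.
Let uE r g : u (pure r g) = (r : B) *: g. Proof. exact: (tensor_liftE bDl bDr b_bal). Qed.
Let uD x y : u (x + y) = u x + u y. Proof. exact: (raddfD uA). Qed.

Let u_deg : hom_deg 0 u.
Proof.
apply: conc_deg => // [i x|a x].
  rewrite addr0; move: i x; apply: tensor_homog_ind => [n x y hx hy|n|l r p q hp hq].
  - by rewrite uD; exact: homogD.
  - by rewrite [u 0](raddf0 uA); exact: homog0.
  rewrite uE; case/homog_cmod: hp => ->; last by rewrite scale0r; exact: homog0.
  by rewrite add0r; exact: homog_linear.
elim/tensor_ind: x => [x y hx hy|l r p q hp hq]; first by rewrite scalerDr !uD hx hy scalerDr.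
by rewrite cpureZ !uE scalerA.
Qed.

Let u_dif x : Dh 0 u x = 0.
Proof.
elim/tensor_ind: x => [x y hx hy|l r p q hp hq].
  by rewrite (homgD (Dh_deg u_deg)) hx hy addr0.
rewrite /Dh (pure_dif _ hp) cmod_dif pure0l add0r uE dif_linear ksgn_id.
case/homog_cmod: hp => ->; first by rewrite ksgn_id uE subrr.
by rewrite pure0l ksgn0 scale0r [u 0](raddf0 uA) subrr.
Qed.

Definition unit_tensor : dgHom (tensor_dgMod U G) G := deg0_dgHom u_deg u_dif.

Lemma unit_tensorE r g : unit_tensor (pure r g) = (r : B) *: g. Proof. exact: uE. Qed.

Lemma unit_tensor_qi : quasi_iso unit_tensor.
Proof.
pose one : U := (1 : R^o).
have p1 : hmg U 0 one by apply/homog_cmod/or_introl.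
apply: (@iso_qi B (tensor_dgMod U G) G unit_tensor (fun g => pure one g)); last 2 first.
- elim/tensor_ind => [x y hx hy|l r p q hp hq]; first by rewrite dgHomD pureDr hx hy.
  rewrite unit_tensorE (pure_bal _ (@homog_conc0 R p) p1) mul0r ksgn_id; congr (pure _ _).
  exact: mulr1.
- by move=> g; rewrite unit_tensorE scale1r.
- by move=> g; rewrite (pure_dif _ p1) cmod_dif pure0l add0r ksgn_id.
exact: pure0r.
Qed.

End UnitTensor.

(* A null-homotopy is evaluated at a cocycle lifting [one]. *)
Lemma acyclic_Hom_semifree_eval M N (one : M) :
  (forall x, dm M x = 0) ->
  (forall i v, hmg N i v -> dm N v = 0 ->
    exists2 f : M -> N, hom_deg i f & f one = v /\ forall x, dm N (f x) = 0) ->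
  acyclic (Hom_dgMod (semifree M) N) -> acyclic N.
Proof.
move=> dM h /Hom_acyclicP aH; apply/acyclicP => v dv; apply: boundary_sum => i.
have [f hf [fv df]] := h i _ (homog_gcomp _ i v) (gcomp_cocycle i dv).
have hfs : hom_deg i (fun t => f (semifree_map M t)).
  by apply: hom_deg_compE hf (dgHom_deg _); rewrite add0r.
have [|g hg gE] := aH i _ hfs.
  by move=> x; rewrite /Dh dgh_dif df dM (homg0 hf) ksgn0 subr0.
have [_ sur] := (quasi_isoP _).1 (semifree_qi M).
have [z [y [dz oneE]]] := sur one (dM _).
exists (g z); rewrite -fv oneE dM addr0 gE /Dh dz (homg0 hg) ksgn0.
exact: subr0.
Qed.

End LocTheory.

(** * Short exact sequences *)

(* Linear identities in an abelian group are decided by comparing integer coefficients. *)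
Inductive zexp := ZVar of nat | ZAdd of zexp & zexp | ZOpp of zexp | ZZero.

Fixpoint zev (V : zmodType) (env : seq V) (e : zexp) : V :=
  match e with
  | ZVar n => nth 0 env n
  | ZAdd a b => zev env a + zev env b
  | ZOpp a => - zev env a
  | ZZero => 0
  end.

Fixpoint zcoef (e : zexp) (i : nat) : int :=
  match e with
  | ZVar n => if n == i then 1 else 0
  | ZAdd a b => zcoef a i + zcoef b i
  | ZOpp a => - zcoef a i
  | ZZero => 0
  end.

Lemma zevE (V : zmodType) (env : seq V) e :
  zev env e = \sum_(i < size env) nth 0 env i *~ zcoef e i.
Proof.
elim: e => [n|a IHa b IHb|a IHa|] /=.
- have [ns|ns] := ltnP n (size env); last first.
    by rewrite nth_default // big1 // => i _; case: eqP ns => // ->; rewrite leqNgt ltn_ord.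
  rewrite (bigD1 (Ordinal ns)) //= eqxx mulr1z big1 ?addr0 // => i.
  by rewrite -val_eqE /= eq_sym => /negPf ->.
- by rewrite IHa IHb -big_split; apply: eq_bigr => i _; rewrite /= mulrzDr.
- by rewrite IHa -sumrN; apply: eq_bigr => i _; rewrite mulrNz.
by rewrite big1.
Qed.

Lemma zev_eq (V : zmodType) (env : seq V) e1 e2 :
  all (fun i => zcoef e1 i == zcoef e2 i) (iota 0 (size env)) -> zev env e1 = zev env e2.
Proof.
move=> /allP h; rewrite !zevE; apply: eq_bigr => i _.
by rewrite (eqP (h i _)) // mem_iota ltn_ord.
Qed.

(** The test by [constr_eq] sits in an inner match, so that it runs while the index is being
    computed and its failure selects the next branch. *)
Ltac zlookup x env :=
  lazymatch env with
  | nil => constr:(O)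
  | cons ?y ?env' => match constr:(tt) with
    | _ => let _ := match constr:(tt) with _ => constr_eq x y end in constr:(O)
    | _ => let n := zlookup x env' in constr:(S n)
    end
  end.

Ltac zmem x env :=
  lazymatch env with
  | nil => constr:(false)
  | cons ?y ?env' => match constr:(tt) with
    | _ => let _ := match constr:(tt) with _ => constr_eq x y end in constr:(true)
    | _ => zmem x env'
    end
  end.

Ltac zvars t env :=
  lazymatch t with
  | @Algebra.add _ ?a ?b => let env' := zvars a env in zvars b env'
  | @Algebra.opp _ ?a => zvars a env
  | @Algebra.zero _ => env
  | _ => let m := zmem t env in
    lazymatch m with true => env | false => constr:(cons t env) end
  end.

Ltac zreify t env :=
  lazymatch t with
  | @Algebra.add _ ?a ?b =>
      let a' := zreify a env in let b' := zreify b env in constr:(ZAdd a' b')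
  | @Algebra.opp _ ?a => let a' := zreify a env in constr:(ZOpp a')
  | @Algebra.zero _ => constr:(ZZero)
  | _ => let n := zlookup t env in constr:(ZVar n)
  end.

Ltac zmod_in V :=
  lazymatch goal with
  | |- ?l = ?r =>
    let env0 := zvars l constr:(@nil (Algebra.Zmodule.sort V)) in
    let env := zvars r env0 in
    let l' := zreify l env in
    let r' := zreify r env in
    exact (@zev_eq V env l' r' (erefl true))
  end.

Section ShortExact.
Variables (A : cdgRing) (M' M M'' T' T : dgMod A).
Variables (i : dgHom M' M) (q : dgHom M M'').
Hypothesis i_inj : forall x, i x = 0 -> x = 0.
Hypothesis qi0 : forall x, q (i x) = 0.
Hypothesis q_ker : forall x, q x = 0 -> exists y, x = i y.
Hypothesis q_sur : forall z, exists x, z = q x.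
Variables (f' : dgHom T' M') (f : dgHom T M) (g : dgHom T' T) (h : T' -> M).
Hypotheses (qf' : quasi_iso f') (qf : quasi_iso f).
Hypotheses (hh : hom_deg (-1) h) (fg : forall t, f (g t) - i (f' t) = Dh (-1) h t).

(** Here [g] lifts [i] to the resolutions up to the homotopy [h]; adding [h] on the shifted copy of
    [T'] makes up for the square commuting only up to homotopy. *)
Let theta (c : cone g) : M'' := q (f (cone_rho c) + h (cone_pi c)).

Let hD t : Dh (-1) h t = dm M (h t) + h (dm T' t).
Proof. by rewrite /Dh /ksgn /= opprK. Qed.

Let hfr : hom_deg 0 (fun c : cone g => f (cone_rho c)).
Proof. by apply: hom_deg_compE (dgHom_deg f) (cone_rho_deg g); rewrite addr0. Qed.
Let hhp : hom_deg 0 (fun c : cone g => h (cone_pi c)).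
Proof. by apply: hom_deg_compE hh (cone_pi_deg g). Qed.

Let theta_deg : hom_deg 0 theta.
Proof. by apply: (hom_deg_compE (n := 0) _ (dgHom_deg q)) (hom_degD hfr hhp). Qed.

Let theta_dif c : Dh 0 theta c = 0.
Proof.
rewrite (Dh_compE (n := 0) _ c _ (dgHom_deg q)) // Dh_dgHom // add0r ksgn_id DhD.
rewrite (Dh_compE (n := 0) _ c _ (dgHom_deg f)) // Dh_dgHom // add0r ksgn_id Dh_rho.
rewrite (Dh_compE (n := 1) _ c _ hh) // Dh_pi (homg0 hh) ksgn0 addr0 -fg dgHomN.
by rewrite addrA addNr add0r dgHomN qi0 oppr0.
Qed.

Definition ses_cone : dgHom (cone g) M'' := deg0_dgHom theta_deg theta_dif.

(** The five lemma for the long exact sequences of both rows, done as a diagram chase because the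
    short exact sequence need not split. The cone of [g] thus resolves [M'']. *)
Lemma ses_cone_qi : quasi_iso ses_cone.
Proof.
have [/quasi_isoP[f'i f's] /quasi_isoP[fi fs]] := (qf', qf).
have cocP (c : cone g) : dm _ c = 0 ->
    dm T' (cone_pi c) = 0 /\ dm T (cone_rho c) = - g (cone_pi c).
  move=> dc; split.
    by have := Dh_pi c; rewrite /Dh dc (homg0 (cone_pi_deg g)) ksgn0 subr0.
  by have := Dh_rho c; rewrite /Dh dc (homg0 (cone_rho_deg g)) ksgn0 subr0.
have sigmaD t : dm (cone g) (cone_sigma g t) = cone_j g (g t) - cone_sigma g (dm T' t).
  by rewrite -Dh_sigma /Dh /ksgn /= opprK addrK.
have jD t : dm (cone g) (cone_j g t) = cone_j g (dm T t).
  by apply/eqP; rewrite -subr_eq0; apply/eqP; exact: (Dh_j g t).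
have jdeg := cone_j_deg g.
apply/quasi_isoP; split=> [c m'' dc thc|m'' dm''].
  have [dt' dt] := cocP c dc; set t := cone_rho c in dt; set t' := cone_pi c in dt' dt.
  have [m m''E] := q_sur m''.
  have [|m' m'E] := q_ker (x := f t + h t' - dm M m).
    by rewrite dgHomB dgh_dif -m''E -thc subrr.
  have fgt : f (g t') = i (f' t') + dm M (h t').
    have /eqP := fg t'; rewrite hD dt' (homg0 hh) addr0 subr_eq => /eqP ->.
    by rewrite addrC.
  have [|t1 t1E] := f'i t' (- m') dt'.
    apply/eqP; rewrite raddfN /= -subr_eq0 opprK; apply/eqP/i_inj.
    rewrite dgHomD [i (dm _ _)]dgh_dif -m'E raddfB difK subr0 raddfD -[dm M (f t)]dgh_dif dt.
    by rewrite dgHomN fgt opprD -addrA addNr addr0 addrN.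
  have [|t2 [y' [dt2 yE]]] := f's (f' t1 + m').
    apply: i_inj; rewrite raddfD -dgh_dif -t1E dgHomD [i (dm _ _)]dgh_dif -m'E.
    rewrite raddfB difK subr0 raddfD -[dm M (f t)]dgh_dif dt.
    by rewrite dgHomN fgt opprD -addrA addNr addr0 addrN.
  (* Correcting [t1] by the cocycle [t2] keeps the differential [t'] and makes [f' u] equal to
     [- m'] up to a boundary. *)
  pose u := t1 - t2.
  have du : dm T' u = t' by rewrite raddfB dt2 subr0 -t1E.
  have f'u : f' u = dm M' y' - m'.
    have -> : dm M' y' = f' t1 + m' - f' t2 by rewrite yE; zmod_in M'.
    by rewrite dgHomB; zmod_in M'.
  have fgu : f (g u) = i (f' u) + dm M (h u) + h t'.
    have /eqP := fg u; rewrite hD du subr_eq => /eqP ->.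
    by rewrite addrC addrA.
  have [||t3 t3E] := fi (t + g u) (m + i y' + h u).
  - by rewrite raddfD dt -dgh_dif du addNr.
  - have ftE : f t = i m' + dm M m - h t' by rewrite -m'E subrK addrK.
    rewrite dgHomD fgu ftE f'u dgHomB !raddfD /= [i (dm _ _)]dgh_dif.
    zmod_in M.
  exists (cone_j g t3 - cone_sigma g u).
  rewrite raddfB jD sigmaD du -t3E (homgD jdeg).
  rewrite -[c in LHS]cone_split -/t -/t'; zmod_in (cone g).
have [m mE] := q_sur m''.
have [|m' m'E] := q_ker (x := dm M m); first by rewrite dgh_dif -mE.
have dm' : dm M' m' = 0 by apply: i_inj; rewrite dgh_dif -m'E difK.
have [t' [y' [dt' m'E2]]] := f's _ dm'.
have fgt : f (g t') = dm M (m - i y' + h t').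
  have /eqP := fg t'; rewrite hD dt' (homg0 hh) addr0 subr_eq => /eqP ->.
  rewrite raddfD raddfB /= m'E m'E2 -[dm M (i y')]dgh_dif dgHomD addrK addrC //.
have [|t tE] := fi (g t') _ _ fgt; first by rewrite -dgh_dif dt' dgHom0.
have [|t0 [y [dt0 yE]]] := fs (f t - (m - i y' + h t')).
  by rewrite raddfB -fgt -dgh_dif -tE subrr.
exists (cone_j g (t - t0) - cone_sigma g t'), (- q y); split.
  rewrite raddfB jD sigmaD dt' (homg0 (cone_sigma_deg g)) subr0 raddfB dt0 subr0 -tE subrr //.
rewrite -[ses_cone _]/(theta _) /theta (homgB (cone_rho_deg g)) (homgB (cone_pi_deg g)).
rewrite cone_rhoj cone_rhosigma cone_pij cone_pisigma subr0 sub0r (homgN hh) [f (_ - _)]dgHomB.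
have -> : f t - f t0 - h t' = m - i y' + dm M y.
  have -> : dm M y = f t - (m - i y' + h t') - f t0 by rewrite yE; zmod_in M.
  zmod_in M.
by rewrite dgHomD dgHomB qi0 subr0 -mE dgh_dif raddfN addrK.
Qed.

End ShortExact.

(** * Ideals and residue fields *)

Section Ideals.
Variable R : comPzRingType.
Implicit Types (I J : R -> Prop) (x y : R).

Definition colon I x : R -> Prop := fun r => I (r * x).
Definition adjoin I x : R -> Prop := fun r => exists a b, I a /\ r = a + b * x.

Lemma colon_ideal I x : is_ideal I -> is_ideal (colon I x).
Proof.
move=> [I0 ID IM]; rewrite /colon; split=> [|a b ha hb|a b hb]; first by rewrite mul0r.
  by rewrite mulrDl; exact: ID.
by rewrite -mulrA; exact: IM.
Qed.

Lemma adjoin_ideal I x : is_ideal I -> is_ideal (adjoin I x).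
Proof.
move=> [I0 ID IM]; split=> [|_ _ [a [b [ha ->]]] [c [d [hc ->]]]|r _ [a [b [ha ->]]]].
- by exists 0, 0; split; rewrite // mul0r addr0.
- by exists (a + c), (b + d); split; [exact: ID | ring].
by exists (r * a), (r * b); split; [exact: IM | ring].
Qed.

Lemma adjoin_sub I x r : I r -> adjoin I x r.
Proof. by move=> Ir; exists r, 0; rewrite mul0r addr0. Qed.

Lemma adjoin_mem I x : is_ideal I -> adjoin I x x.
Proof. by move=> [I0 _ _]; exists 0, 1; rewrite mul1r add0r. Qed.

Lemma zero_ideal : is_ideal (fun r : R => r = 0).
Proof. by split=> // [x y -> ->|a x ->]; rewrite ?addr0 ?mulr0. Qed.

Hypothesis nR : noetherian R.

(** Without a maximal element, choice gives a strictly increasing chain of ideals; its union is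
    finitely generated, so all generators occur at some stage [N], against the strictness of the
    next inclusion. *)
Lemma noetherian_max (P : (R -> Prop) -> Prop) I0 : is_ideal I0 -> P I0 ->
  exists I, [/\ is_ideal I, P I &
    forall J, is_ideal J -> (forall x, I x -> J x) -> P J -> forall x, J x -> I x].
Proof.
move=> iI0 PI0; apply: contrapT => nmax.
pose T := {I : R -> Prop | is_ideal I /\ P I}.
have step (u : T) : exists v : T, (forall x, sval u x -> sval v x) /\
    exists x, sval v x /\ ~ sval u x.
  case: u => I [iI PI]; apply: contrapT => nI; apply: nmax; exists I; split=> // J iJ IJ PJ x Jx.
  by apply: contrapT => nIx; apply: nI; exists (exist _ J (conj iJ PJ)); split=> //; exists x.
pose ch n := iter n (fun u => sval (cid (step u))) (exist _ I0 (conj iI0 PI0) : T).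
have chS n : (forall x, sval (ch n) x -> sval (ch n.+1) x) /\
    exists x, sval (ch n.+1) x /\ ~ sval (ch n) x.
  by rewrite /ch iterS; case: cid.
have chm m n x : (m <= n)%N -> sval (ch m) x -> sval (ch n) x.
  by move=> /subnKC <-; elim: (n - m)%N => [|k IH] h; rewrite ?addn0 // addnS; exact/(chS _).1/IH.
have chi n : is_ideal (sval (ch n)) by case: (svalP (ch n)).
have [|n [g gP]] := nR (I := fun x => exists n, sval (ch n) x).
  split=> [|x y [m hx] [n hy]|a x [n hx]].
  - by exists 0; case: (chi 0).
  - exists (maxn m n); case: (chi (maxn m n)) => _ D _; apply: D.
      by apply: chm hx; exact: leq_maxl.
    by apply: chm hy; exact: leq_maxr.
  by exists n; case: (chi n) => _ _; apply.
have hg i : exists m, sval (ch m) (g i).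
  apply/gP; exists (fun j => if j == i then 1 else 0).
  rewrite (bigD1 i) //= eqxx mul1r big1 ?addr0 // => j /negPf ->.
  by rewrite mul0r.
pose N := \max_i sval (cid (hg i)).
have [x [hx nx]] := (chS N).2; apply: nx.
have [c ->] : exists c : 'I_n -> R, x = \sum_(i < n) c i * g i by apply/gP; exists N.+1.
have [Z D M] := chi N; elim/big_ind: _ => // i _; apply: M.
by apply: (chm (sval (cid (hg i)))); [exact: leq_bigmax | case: cid].
Qed.

(* An ideal maximal among those violating C is prime; since C is tested on the two
   outer terms of 0 -> R/(I : x) -> R/I -> R/(I + x) -> 0, one has (I : x) = I for x
   outside I. *)
Lemma prime_principle (C : (R -> Prop) -> Prop) :
  (forall I x, is_ideal I -> C (adjoin I x) -> C (colon I x) -> C I) ->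
  C (fun=> True) -> ~ C (fun r => r = 0) ->
  exists p, [/\ is_ideal p, ~ p 1, forall x y, p (x * y) -> p x \/ p y, ~ C p &
    forall s, ~ p s -> C (adjoin p s)].
Proof.
move=> Cext C1 C0; have [p [ip nCp pmax]] := noetherian_max (P := fun I => ~ C I) zero_ideal C0.
have big J : is_ideal J -> (forall x, p x -> J x) -> (exists x, J x /\ ~ p x) -> C J.
  move=> iJ pJ [x [Jx npx]]; apply: contrapT => nCJ; apply: npx; exact: (pmax J).
have Cadj s : ~ p s -> C (adjoin p s).
  move=> ps; apply: big; [exact: adjoin_ideal|exact: adjoin_sub|].
  by exists s; split=> //; exact: adjoin_mem.
exists p; split=> // [p1|x y pxy].
  apply: nCp; suff -> : p = (fun=> True) by [].
  apply/funext => r; apply/propext; split=> // _.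
  by rewrite -[r]mulr1; case: ip => _ _; apply.
apply: contrapT => /not_orP[px py]; apply: nCp; apply: (Cext p x) => //; first exact: Cadj.
apply: big; first exact: colon_ideal.
  by move=> r pr; rewrite /colon mulrC; case: ip => _ _; apply.
by exists y; split=> //; rewrite /colon mulrC.
Qed.

End Ideals.

Section QuotientModule.
Variables (R : comPzRingType) (I : R -> Prop) (iI : is_ideal I).

Definition inI : {pred R} := [pred x | `[< I x >]].

Lemma inI_closed : zmod_closed inI.
Proof.
have [I0 ID IM] := iI; split; first exact/asboolP.
move=> x y /asboolP hx /asboolP hy; apply/asboolP.
by rewrite -mulN1r; apply: ID => //; exact: IM.
Qed.
HB.instance Definition _ := GRing.isZmodClosed.Build R inI inI_closed.

Definition qmod : Type := Quotient.quot inI.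
HB.instance Definition _ := GRing.Zmodule.on qmod.

Definition qin : {additive R -> qmod} := \pi_(Quotient.quot inI)%qT.

Lemma qin_surj (x : qmod) : exists r, x = qin r.
Proof. by exists (repr x); rewrite /= reprK. Qed.

Lemma qin_eq r s : qin r = qin s <-> I (r - s).
Proof.
split=> [/eqP|h]; last apply/eqP.
  by rewrite -Quotient.idealrBE => /asboolP.
by rewrite -Quotient.idealrBE; apply/asboolP.
Qed.

Lemma qin_eq0 r : qin r = 0 <-> I r.
Proof. by rewrite -(raddf0 qin) qin_eq subr0. Qed.

Definition qscale (a : R) (x : qmod) : qmod := qin (a * repr x).

Lemma qscaleE a r : qscale a (qin r) = qin (a * r).
Proof.
apply/qin_eq; rewrite -mulrBr; case: iI => _ _; apply.
by apply/qin_eq; rewrite /= reprK.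
Qed.

Lemma qscaleA a b x : qscale a (qscale b x) = qscale (a * b) x.
Proof. by have [r ->] := qin_surj x; rewrite !qscaleE mulrA. Qed.
Lemma qscale1 : left_id 1 qscale.
Proof. by move=> x; have [r ->] := qin_surj x; rewrite qscaleE mul1r. Qed.
Lemma qscaleDr : right_distributive qscale +%R.
Proof.
move=> a x y; have [r ->] := qin_surj x; have [s ->] := qin_surj y.
by rewrite -raddfD !qscaleE mulrDr raddfD.
Qed.
Lemma qscaleDl x : {morph qscale^~ x : a b / a + b}.
Proof. by move=> a b; have [r ->] := qin_surj x; rewrite !qscaleE mulrDl raddfD. Qed.

HB.instance Definition _ := GRing.Zmodule_isLmodule.Build R qmod
  qscaleA qscale1 qscaleDr qscaleDl.

Lemma qinZ a r : qin (a * r) = a *: qin r. Proof. by rewrite -qscaleE. Qed.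

Lemma qin1 r : qin r = r *: qin 1. Proof. by rewrite -qinZ mulr1. Qed.

Section Cyclic.
Variables (V : lmodType R) (v : V).
Hypothesis Iv : forall r, I r -> r *: v = 0.

Definition qlift (x : qmod) : V := repr x *: v.

Lemma qlift_in r : qlift (qin r) = r *: v.
Proof.
apply/eqP; rewrite -subr_eq0 -scalerBl; apply/eqP/Iv/qin_eq.
by rewrite /= reprK.
Qed.

Lemma qliftD : {morph qlift : x y / x + y}.
Proof.
move=> x y; have [r ->] := qin_surj x; have [s ->] := qin_surj y.
by rewrite -raddfD !qlift_in scalerDl.
Qed.

Lemma qliftZ a x : qlift (a *: x) = a *: qlift x.
Proof. by have [r ->] := qin_surj x; rewrite -qinZ !qlift_in scalerA. Qed.

End Cyclic.

End QuotientModule.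

(** * Contractibility, and exact sequences under tensor and Hom *)

Section MoreHom.
Variable A : cdgRing.
Implicit Types P M N W : dgMod A.

Lemma id_deg P : hom_deg 0 (fun x : P => x).
Proof. by split=> // [i x|k a x _]; rewrite ?addr0 ?mul0r. Qed.

(** The identity of [P] is the derivative of some [h], so a cycle [u] is, up to sign, the derivative
    of u h. *)
Lemma acyclic_Hom_contract P W : K_projective P -> acyclic P -> acyclic (Hom_dgMod P W).
Proof.
move=> kP /kP/Hom_acyclicP aP; apply/Hom_acyclicP => n u hu du.
have [|h hh hE] := aP 0 _ (id_deg P); first by move=> x; rewrite /Dh ksgn_id subrr.
have huh : hom_deg (n - 1) (fun x => ksgn n (u (h x))).
  by apply: (hom_deg_ksgnE n); apply: hom_deg_compE hu hh; lia.
exists (fun x => ksgn n (u (h x))) => // x.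
rewrite Dh_ksgn (Dh_compE (n := 0 - 1) _ x _ hu); last by lia.
by rewrite du add0r -hE ksgnK.
Qed.

Lemma K_projective_acyclic P M N (f : dgHom M N) : K_projective P -> quasi_iso f ->
  acyclic (Hom_dgMod P M) -> acyclic (Hom_dgMod P N).
Proof.
move=> kP qf /Hom_acyclicP aM; apply/Hom_acyclicP => n w hw dw.
have [v [u [hv dv hu] wE]] := Hom_post_surj kP qf hw dw.
have [v' hv' vE] := aM n v hv dv.
have hfv : hom_deg (n - 1) (fun x => f (v' x)).
  by apply: hom_deg_compE (dgHom_deg f) hv'; rewrite addr0.
exists (fun x => f (v' x) + u x) => [|x]; first exact: hom_degD hfv hu.
rewrite DhD (Dh_compE (n := n - 1) _ x _ (dgHom_deg f)) ?addr0 //.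
by rewrite Dh_dgHom // add0r ksgn_id -vE.
Qed.

Lemma acyclic_zero_tensor M G : (forall x : M, x = 0) -> acyclic (tensor_dgMod M G).
Proof.
move=> M0; apply/acyclicP => t _; exists 0; rewrite raddf0.
elim/tensor_ind: t => [x y -> ->|l r p q _ _]; first by rewrite addr0.
by rewrite (M0 p) pure0l.
Qed.

Lemma ses_id_qi (M' M M'' : dgMod A) (i : dgHom M' M) (q : dgHom M M'') :
  (forall x, i x = 0 -> x = 0) -> (forall x, q (i x) = 0) ->
  (forall x, q x = 0 -> exists y, x = i y) -> (forall z, exists x, z = q x) ->
  exists f : dgHom (cone i) M'', quasi_iso f.
Proof.
move=> i_inj qi0 q_ker q_sur.
have idq N : quasi_iso (id_dgHom N).
  by apply: (@iso_qi _ _ _ _ (fun x : N => x)).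
have h0 : hom_deg (-1) (fun _ : M' => 0 : M).
  by split=> [x y|k x _|k a x _]; rewrite ?addr0 ?scaler0 ?ksgn0 //; exact: homog0.
have fg t : id_dgHom M (i t) - i (id_dgHom M' t) = Dh (-1) (fun _ : M' => 0 : M) t.
  by rewrite /Dh raddf0 ksgn0 subr0 subrr.
by exists (ses_cone qi0 h0 fg); apply: ses_cone_qi.
Qed.

(** The cone of [i] is quasi-isomorphic to [M''], so its tensor product with [G] is acyclic too. *)
Lemma ses_tensor (M' M M'' : dgMod A) (i : dgHom M' M) (q : dgHom M M'') G :
  (forall x, i x = 0 -> x = 0) -> (forall x, q (i x) = 0) ->
  (forall x, q x = 0 -> exists y, x = i y) -> (forall z, exists x, z = q x) ->
  K_flat G -> acyclic (tensor_dgMod M'' G) -> quasi_iso (tensor_l i G).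
Proof.
move=> i_inj qi0 q_ker q_sur kG aG; apply: tensor_cone_qi.
have [f qf] := ses_id_qi i_inj qi0 q_ker q_sur.
exact/(K_flat_acyclic kG qf).
Qed.

Lemma ses_Hom (M' M M'' : dgMod A) (i : dgHom M' M) (q : dgHom M M'')
  (T' T : dgMod A) (f' : dgHom T' M') (f : dgHom T M) W :
  (forall x, i x = 0 -> x = 0) -> (forall x, q (i x) = 0) ->
  (forall x, q x = 0 -> exists y, x = i y) -> (forall z, exists x, z = q x) ->
  K_projective T' -> K_projective T -> quasi_iso f' -> quasi_iso f ->
  acyclic (Hom_dgMod (semifree M'') W) ->
  forall (g : dgHom T' T) (h : T' -> M), hom_deg (-1) h ->
  (forall t, f (g t) - i (f' t) = Dh (-1) h t) -> acyclic (Hom_dgMod (cone g) W).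
Proof.
move=> i_inj qi0 q_ker q_sur kT' kT qf' qf aW g h hh fg.
apply: (acyclic_Hom_indep (@semifree_K_projective _ M'') (cone_K_projective kT' kT)
  (semifree_qi _) _ aW).
exact: (ses_cone_qi i_inj qi0 q_ker q_sur qf' qf hh fg).
Qed.

(** A lift [g] of [i] to semifree resolutions has a cone that resolves [M'']. A cycle on the
    resolution of [M] becomes null-homotopic after [g], and then already before it by
    [pre_cone_inj]. *)
Lemma ses_Hom_ext (M' M M'' : dgMod A) (i : dgHom M' M) (q : dgHom M M'') W :
  (forall x, i x = 0 -> x = 0) -> (forall x, q (i x) = 0) ->
  (forall x, q x = 0 -> exists y, x = i y) -> (forall z, exists x, z = q x) ->
  acyclic (Hom_dgMod (semifree M'') W) -> acyclic (Hom_dgMod (semifree M') W) ->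
  acyclic (Hom_dgMod (semifree M) W).
Proof.
move=> i_inj qi0 q_ker q_sur aM'' /Hom_acyclicP aM'.
have [kT' kT] := (@semifree_K_projective A M', @semifree_K_projective A M).
have hif : hom_deg 0 (fun t => i (semifree_map M' t)).
  by apply: hom_deg_compE (dgHom_deg i) (dgHom_deg (semifree_map M')); rewrite addr0.
have [|v [u [hv dv hu] E]] := Hom_post_surj kT' (semifree_qi M) hif.
  by move=> t; rewrite (Dh_compE (n := 0) _ t _ (dgHom_deg i)) ?addr0 // !Dh_dgHom // dgHom0 ksgn0 addr0.
pose g := deg0_dgHom hv dv.
have aC : acyclic (Hom_dgMod (cone g) W).
  apply: (ses_Hom i_inj qi0 q_ker q_sur kT' kT (semifree_qi _) (semifree_qi _) aM''
    (h := fun t => - u t)).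
    exact: hom_degN hu.
  by move=> t; rewrite E DhN -[g t]/(v t) opprD addrA subrr add0r.
apply/Hom_acyclicP => n x hx dx.
have hxg : hom_deg n (fun t => x (g t)) by apply: hom_deg_compE hx (dgHom_deg g); rewrite add0r.
have [|y hy yE] := aM' n _ hxg; last exact: (pre_cone_inj aC hx dx hy yE).
by move=> t; rewrite (Dh_compE (n := 0) _ t _ hx) ?add0r // dx Dh_dgHom // (homg0 hx) ksgn0 addr0.
Qed.

End MoreHom.

Record primeId (R : comPzRingType) := PrimeId {
  pid :> R -> Prop;
  pid_ideal : is_ideal pid;
  pid1 : ~ pid 1;
  pidM : forall x y, pid (x * y) -> pid x \/ pid y }.

Section Residue.
Variable R : comPzRingType.
Local Notation B := (conc R).

Definition compl (p : primeId R) : mset R.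
Proof.
by exists (fun s => ~ p s); [exact: pid1 | move=> s t hs ht /pidM[]].
Defined.

Definition quo (I : R -> Prop) (iI : is_ideal I) : dgMod B := cmod (qmod iI).

(** The residue field k(p), kept as a module in degree 0. Being a vector space over it is expressed
    by [p] acting as zero and the complement of [p] acting bijectively. *)
Definition resid (p : primeId R) : dgMod B := locdg (compl p) (quo (pid_ideal p)).

Definition scal (s : R) (M : dgMod B) : dgHom M M.
Proof.
apply: (@deg0_dgHom B M M (fun x => (s : B) *: x)).
  apply: conc_deg => [x y|i x|a x]; first exact: scalerDr.
    by rewrite addr0; exact: homog_linear.
  by rewrite !scalerA mulrC.
by move=> x; rewrite /Dh dif_linear ksgn_id subrr.
Defined.

Lemma scalE s M x : scal s M x = (s : B) *: x. Proof. by []. Qed.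

(** * Maps and exact sequences of cyclic modules *)

Section QuoMaps.
Variables (I J : R -> Prop) (iI : is_ideal I) (iJ : is_ideal J) (x : R).
Hypothesis IJ : forall r, I r -> J (r * x).

Let ann r : I r -> r *: qin iJ x = 0.
Proof. by move=> Ir; rewrite -qinZ; apply/qin_eq0/IJ. Qed.

Definition quo_map : dgHom (quo iI) (quo iJ) := cmod_map (qliftD (iI:=iI) ann) (qliftZ (iI:=iI) ann).

Lemma quo_mapE r : quo_map (qin iI r) = qin iJ (r * x).
Proof. by rewrite qinZ -(qlift_in iI ann). Qed.

End QuoMaps.

Lemma quo_proj_subproof (I : R -> Prop) x : forall r, I r -> adjoin I x (r * 1).
Proof. by move=> r Ir; rewrite mulr1; exact: adjoin_sub. Qed.

Section QuoSes.
Variables (I : R -> Prop) (iI : is_ideal I) (x : R) (iK : is_ideal (adjoin I x)).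
Let proj := quo_map iI iK (@quo_proj_subproof I x).

Let projE r : proj (qin iI r) = qin iK r.
Proof. by rewrite -[in RHS](mulr1 r); exact: quo_mapE. Qed.

Lemma quo_proj_sur z : exists y, z = proj y.
Proof. by have [r ->] := qin_surj z; exists (qin iI r); rewrite (projE r). Qed.

Let proj_mul r : proj (qin iI (r * x)) = 0.
Proof.
rewrite (projE (r * x)); apply/qin_eq0.
by exists 0, r; rewrite add0r; split=> //; case: iI.
Qed.

Let proj_ker y : proj y = 0 -> exists r, y = qin iI (r * x).
Proof.
have [r ->] := qin_surj y; rewrite (projE r) => /qin_eq0[a [b [Ia ->]]].
by exists b; apply/qin_eq; rewrite addrK.
Qed.

Section Colon.
Variables (iJ : is_ideal (colon I x)).
Let inc := quo_map iJ iI (fun r (h : colon I x r) => h).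

Let incE r : inc (qin iJ r) = qin iI (r * x).
Proof. exact: quo_mapE. Qed.

(** With the next two lemmas and [quo_proj_sur]: exactness of 0 -> R/(I : x) -> R/I -> R/(I + x) ->
    0. *)
Lemma quo_inc_inj y : inc y = 0 -> y = 0.
Proof. by have [r ->] := qin_surj y; rewrite (incE r) => /qin_eq0 h; apply/qin_eq0. Qed.

Lemma quo_proj_inc y : proj (inc y) = 0.
Proof. by have [r ->] := qin_surj y; rewrite (incE r); exact: proj_mul. Qed.

Lemma quo_proj_ker y : proj y = 0 -> exists z, y = inc z.
Proof. by move=> /proj_ker[r ->]; exists (qin iJ r); rewrite (incE r). Qed.

End Colon.

Section Scal.
Hypothesis Ix : forall r, I (r * x) -> I r.
Let inc := scal x (quo iI).

Let incE r : inc (qin iI r) = qin iI (r * x).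
Proof. by rewrite mulrC qinZ. Qed.

(** If (I : x) = I, as for a prime I and x outside it, the first map of the sequence can be taken to
    be multiplication by [x] on R/I. *)
Lemma quo_scal_inj y : inc y = 0 -> y = 0.
Proof. by have [r ->] := qin_surj y; rewrite (incE r) => /qin_eq0/Ix h; apply/qin_eq0. Qed.

Lemma quo_proj_scal y : proj (inc y) = 0.
Proof. by have [r ->] := qin_surj y; rewrite (incE r); exact: proj_mul. Qed.

Lemma quo_proj_scal_ker y : proj y = 0 -> exists z, y = inc z.
Proof. by move=> /proj_ker[r ->]; exists (qin iI r); rewrite (incE r). Qed.

End Scal.
End QuoSes.

Lemma quo_True0 (iI : is_ideal (fun _ : R => True)) (x : quo iI) : x = 0.
Proof. by have [r ->] := qin_surj x; apply/qin_eq0. Qed.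

Lemma prime_mul (p : primeId R) s r : ~ p s -> p (r * s) -> p r.
Proof. by move=> ps /pidM[]. Qed.

Hypothesis nR : noetherian R.

Lemma tensor_support (G : dgMod B) : K_flat G -> ~ acyclic G ->
  exists p : primeId R, ~ acyclic (tensor_dgMod (resid p) G).
Proof.
move=> kG nG.
(* Quantified over the proofs that [I] is an ideal, because [quo] depends on one while
   [prime_principle] speaks of bare predicates. *)
pose C I := forall iI : is_ideal I, acyclic (tensor_dgMod (quo iI) G).
have [||C0|p0 [ip p1 pM /existsNP[iI nD] Cs]] := @prime_principle R nR C.
- move=> I x iI CK CJ iI'.
  have iK := adjoin_ideal x iI; have iJ := colon_ideal x iI.
  apply/(acyclic_qi _).1: (CJ iJ).
  apply: (ses_tensor (@quo_inc_inj I iI' x iJ) (@quo_proj_inc I iI' x iK iJ)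
    (@quo_proj_ker I iI' x iK iJ) (@quo_proj_sur I iI' x iK) kG (CK iK)).
- by move=> iI; apply: acyclic_zero_tensor => x; exact: quo_True0.
- apply: nG; have z := @zero_ideal R.
  pose u := @cmod_map R R^o (qmod z) (qin z) (raddfD (qin z)) (qinZ z).
  have qu : quasi_iso u.
    apply/quasi_isoP; split=> [r y _ /qin_eq0 ->|w _]; first by exists 0; rewrite raddf0.
    have [r ->] := qin_surj w; exists r, 0; split=> //; rewrite raddf0 addr0 //.
  apply/(acyclic_qi (unit_tensor_qi G)); apply/(K_flat_acyclic kG qu); exact: C0.
pose p := @PrimeId R p0 iI p1 pM.
exists p => ak; apply: nD.
(* For [s] outside p, multiplication by [s] on R/p is injective with cokernel R/(p + s), and R/(p +
   s) (x) G is acyclic by the choice of p. *)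
have qD : qbij (compl p) (tensor_dgMod (quo iI) G).
  move=> s hs; have iK := adjoin_ideal s iI.
  have qi : quasi_iso (tensor_l (scal s (quo iI)) G).
    apply: (ses_tensor (@quo_scal_inj p0 iI s (fun r => prime_mul (p := p) hs))
      (@quo_proj_scal p0 iI s iK) (@quo_proj_scal_ker p0 iI s iK)
      (@quo_proj_sur p0 iI s iK) kG (Cs s hs iK)).
  have sE t : tensor_l (scal s (quo iI)) G t = (s : B) *: t.
    elim/tensor_ind: t => [x y hx hy|l r q g _ _]; first by rewrite dgHomD hx hy scalerDr.
    by rewrite tensor_lE (tmap_pure (dgHom_deg _)) cpureZ.
  have [inj sur] := (quasi_isoP _).1 qi.
  split=> [z y dz|z dz]; first by rewrite -sE; exact: inj.
  by have [w [y [dw ->]]] := sur z dz; exists w, y; rewrite sE.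
(* By [qD], R/p (x) G has the same cohomology as its localization, which is k(p) (x) G. *)
apply/(acyclic_qi (locdg_in_qi qD)); exact/(acyclic_qi (loc_tensor_qi _ _ _)).
Qed.

End Residue.

(** * Detecting complexes by RHom out of residue fields *)

Section HomSupport.
Variable R : comPzRingType.
Local Notation B := (conc R).
Implicit Types (M N G W V : dgMod B) (S : mset R).

Section CyclicMaps.
Variables (S : mset R) (I : R -> Prop) (iI : is_ideal I).
Local Notation Q := (quo iI).
Local Notation L := (locdg S Q).

Lemma quo_dif (x : Q) : dm Q x = 0. Proof. by []. Qed.

Lemma quo_homog (x : Q) : hmg Q 0 x. Proof. by apply/homog_cmod; left. Qed.

Lemma locquo_dif (x : L) : dm L x = 0.
Proof.
have [s [v [hs sx]]] := locdg_den x; apply: (bij_inj (@locdg_bij _ S Q) hs).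
by rewrite -dif_linear sx -dgh_dif quo_dif dgHom0 scaler0.
Qed.

Lemma locquo_homog (x : L) : hmg L 0 x.
Proof.
have [s [v [hs sx]]] := locdg_den x; apply: (bij_inj (@locdg_bij _ S Q) hs).
by rewrite -gcomp_linear sx gcomp_dgHom quo_homog.
Qed.

Section Lift.
Variables (V : dgMod B) (i : int) (v : V).
Hypotheses (hv : hmg V i v) (Iv : forall r, I r -> (r : B) *: v = 0).

Definition quo_lift : Q -> V := @qlift R I iI (dgm_sort V : lmodType R) v.

Lemma quo_lift_in r : quo_lift (qin iI r) = (r : B) *: v.
Proof. exact: qlift_in. Qed.

Lemma quo_liftD : {morph quo_lift : x y / x + y}. Proof. exact: qliftD. Qed.
Lemma quo_liftZ (a : R) x : quo_lift (a *: x) = (a : B) *: quo_lift x.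
Proof. exact: qliftZ. Qed.

Lemma quo_lift_homog x : hmg V i (quo_lift x).
Proof. by have [r ->] := qin_surj x; rewrite quo_lift_in; exact: homog_linear. Qed.

Lemma quo_lift_deg : hom_deg i quo_lift.
Proof. apply: cmod_deg; [exact: quo_liftD|exact: quo_liftZ|exact: quo_lift_homog]. Qed.

Hypothesis bV : bijM S V.

Definition locquo_lift : L -> V :=
  @loc_lift R S (dgm_sort Q : lmodType R) (dgm_sort V : lmodType R) bV quo_lift quo_liftD quo_liftZ.

Lemma locquo_lift_in x : locquo_lift (locdg_in S Q x) = quo_lift x.
Proof. exact: loc_lift_in. Qed.

Lemma locquo_liftZ (a : R) x : locquo_lift (a *: x) = (a : B) *: locquo_lift x.
Proof. exact: loc_liftZ. Qed.

Lemma locquo_lift_den x : exists s r, S s /\ (s : B) *: locquo_lift x = (r : B) *: v.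
Proof.
have [s [q [hs sx]]] := locdg_den x; have [r qE] := qin_surj q; exists s, r; split=> //.
by rewrite -locquo_liftZ sx locquo_lift_in qE quo_lift_in.
Qed.

Lemma locquo_lift_deg : hom_deg i locquo_lift.
Proof.
apply: conc_deg => [|k x hx|]; [exact: loc_liftD| |exact: locquo_liftZ].
have [k0|k0] := eqVneq k 0; last first.
  have -> : x = 0 by rewrite -hx (gcomp_homog _ (locquo_homog x)) (negPf k0).
  by rewrite -(scale0r (0 : L)) locquo_liftZ scale0r; exact: homog0.
rewrite k0 add0r; have [s [r [hs sx]]] := locquo_lift_den x.
apply: (bij_inj bV hs); rewrite -gcomp_linear sx.
exact: homog_linear.
Qed.

Lemma locquo_lift_dif x : dm V v = 0 -> dm V (locquo_lift x) = 0.
Proof.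
move=> dv; have [s [r [hs sx]]] := locquo_lift_den x.
by apply: (bij_inj bV hs); rewrite -dif_linear sx dif_linear dv !scaler0.
Qed.

Lemma locquo_lift1 : locquo_lift (locdg_in S Q (qin iI 1)) = v.
Proof. by rewrite locquo_lift_in quo_lift_in scale1r. Qed.

End Lift.
End CyclicMaps.

Lemma Hom_dmE M N n (x : Hom_dgMod M N) p : hom_deg n (Hom_val x) ->
  Hom_val (dm _ x) p = Dh n (Hom_val x) p.
Proof. exact: Hom_difE. Qed.

(** The cone lemmas treat maps of a fixed degree, so bijectivity on a Hom complex has to be checked
    degree by degree. *)
Lemma qbij_graded S M : (forall s, S s -> forall n,
  (forall z y : M, hmg M n z -> dm M z = 0 -> hmg M (n - 1) y -> s *: z = dm M y ->
     exists x, z = dm M x) /\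
  (forall z : M, hmg M n z -> dm M z = 0 -> exists z' y, dm M z' = 0 /\ z = s *: z' + dm M y)) ->
  qbij S M.
Proof.
move=> h s hs; split=> [z y dz sz|z dz].
  apply: boundary_sum => n; apply: ((h s hs n).1 _ (gcomp (dgm_str M) (n - 1) y)).
  - exact: homog_gcomp.
  - exact: gcomp_cocycle.
  - exact: homog_gcomp.
  by rewrite -gcomp_linear sz gcomp_dif.
have [l _ zE] := gcomp_sum (dgm_str M) z.
have hn n : exists u : M * M, dm M u.1 = 0 /\ gcomp (dgm_str M) n z = s *: u.1 + dm M u.2.
  have [z' [y hy]] := (h s hs n).2 _ (homog_gcomp _ n z) (gcomp_cocycle n dz).
  by exists (z', y).
exists (\sum_(n <- l) (sval (cid (hn n))).1), (\sum_(n <- l) (sval (cid (hn n))).2); split.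
  by rewrite raddf_sum big1 // => n _; case: cid => u [].
rewrite {1}zE scaler_sumr raddf_sum -big_split; apply: eq_bigr => n _ /=.
by case: cid => u [].
Qed.

Lemma sf_zero_acyclic M W : (forall x : M, x = 0) -> acyclic (Hom_dgMod (semifree M) W).
Proof.
move=> M0; apply: acyclic_Hom_contract; first exact: semifree_K_projective.
apply/(acyclic_qi (semifree_qi M))/acyclicP => x _; exists 0; rewrite (M0 x).
by rewrite raddf0.
Qed.

(** [R] in the form R/0, so that maps out of it and out of its localization are instances of the
    lifts above. *)
Definition zquo : dgMod B := quo (@zero_ideal R).

Lemma zquo_tensor G : exists f : dgHom (tensor_dgMod zquo G) G, quasi_iso f.
Proof.
have a0 r : r = 0 -> r *: (1 : R^o) = 0 by move=> ->; exact: scale0r.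
pose f : dgHom zquo (cmod R^o) :=
  cmod_map (qliftD (iI := @zero_ideal R) a0) (qliftZ (iI := @zero_ideal R) a0).
exists (comp_dgHom (unit_tensor G) (tensor_l f G)).
apply: comp_qi (unit_tensor_qi G).
pose zi := @zero_ideal R; pose g : dgHom (cmod R^o) zquo :=
  @cmod_map R R^o (qmod zi) (qin zi) (raddfD (qin zi)) (qinZ zi).
have fg : cancel g f.
  by move=> r; rewrite [LHS](@qlift_in R _ (@zero_ideal R) R^o 1 a0 r); exact: mulr1.
have gf : cancel f g.
  by move=> x; have [r ->] := qin_surj x; rewrite -[qin _ r]/(g r) fg.
apply: (@iso_qi _ _ _ _ (tensor_l g G)) => [x||t|t].
- by rewrite dgh_dif.
- exact: dgHom0.
- rewrite !tensor_lE (tmap_comp _ (dgHom_deg f) (dgHom_deg g)); exact: tmap_id gf.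
rewrite !tensor_lE (tmap_comp _ (dgHom_deg g) (dgHom_deg f)); exact: tmap_id fg.
Qed.

Hypothesis nR : noetherian R.

(** With S the complement of p, RHom(k(p), W) is RHom(S^-1 R, U) for U = RHom(R/p, W). By the choice
    of p, S acts bijectively on the cohomology of U, so U may be replaced by S^-1 U, where every
    homogeneous cocycle is the image of 1 under a map from S^-1 R. *)
Lemma Hom_support W : ~ acyclic W ->
  exists p : primeId R, ~ acyclic (Hom_dgMod (semifree (resid p)) W).
Proof.
move=> nW; pose C I := forall iI : is_ideal I, acyclic (Hom_dgMod (semifree (quo iI)) W).
have [||C0|p0 [ip p1 pM /existsNP[iI nD] Cs]] := @prime_principle R nR C.
- move=> I x iI CK CJ iI'.
  have iK := adjoin_ideal x iI; have iJ := colon_ideal x iI.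
  exact: (ses_Hom_ext (@quo_inc_inj R I iI' x iJ) (@quo_proj_inc R I iI' x iK iJ)
    (@quo_proj_ker R I iI' x iK iJ) (@quo_proj_sur R I iI' x iK) (CK iK) (CJ iJ)).
- by move=> iI; apply: sf_zero_acyclic => x; exact: quo_True0.
- apply: nW; apply: (acyclic_Hom_semifree_eval (M := zquo) (one := qin _ 1)) (C0 _) => // i v hv dv.
  have Iv r : r = 0 -> (r : B) *: v = 0 by move=> ->; exact: scale0r.
  exists (quo_lift (iI := @zero_ideal R) v); first exact: quo_lift_deg hv Iv.
  split=> [|x]; first by rewrite (quo_lift_in _ Iv) scale1r.
  by have [r ->] := qin_surj x; rewrite (quo_lift_in _ Iv) dif_linear dv scaler0.
pose p := @PrimeId R p0 iI p1 pM.
exists p => ak; apply: nD.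
set D := quo iI in ak *; pose S := compl p.
pose U := Hom_dgMod (semifree D) W; pose RS := locdg S zquo.
have kD := @semifree_K_projective B D.
have qU : qbij S U.
  apply: qbij_graded => s hs n; have iK := adjoin_ideal s iI.
  have h0 : hom_deg (-1) (fun _ : semifree D => 0 : D).
    by split=> [x y|k x _|k a x _]; rewrite ?addr0 ?scaler0 ?ksgn0 //; exact: homog0.
  (* This cone resolves R/(p + s), and RHom(R/(p + s), W) vanishes by the choice of p. *)
  have aC : acyclic (Hom_dgMod (cone (scal s (semifree D))) W).
    apply: (ses_Hom (@quo_scal_inj R p0 iI s (fun r => prime_mul (p := p) hs))
      (@quo_proj_scal R p0 iI s iK) (@quo_proj_scal_ker R p0 iI s iK)
      (@quo_proj_sur R p0 iI s iK) kD kD (semifree_qi D) (semifree_qi D) (Cs s hs iK) h0).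
    by move=> t; rewrite !scalE cdgHomZ subrr /Dh raddf0 ksgn0 subr0.
  have sE (z : U) (t : semifree D) m : hom_deg m (Hom_val z) ->
      Hom_val ((s : B) *: z) t = Hom_val z (scal s (semifree D) t).
    by move=> hz; rewrite cHomgZ scalE (conc_hom_linear _ _ hz).
  have dE (z : U) m (hz : hom_deg m (Hom_val z)) : dm U z = 0 -> forall t, Dh m (Hom_val z) t = 0.
    by move=> dz t; rewrite -(Hom_dmE t hz) dz.
  split=> [z y /homog_HomP hz dz /homog_HomP hy szy|z /homog_HomP hz dz].
    have [|v hv zE] := pre_cone_inj aC hz (dE _ _ hz dz) hy.
      by move=> t; rewrite -[LHS](sE _ t _ hz) szy; exact: (Hom_dmE t hy).
    exists (MkHom (is_hom_deg hv)); apply: Hom_eq => t.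
    by rewrite (Hom_dmE (x := MkHom (is_hom_deg hv)) t hv) zE.
  have [x [v [hx dx hv] zE]] := pre_cone_surj aC hz (dE _ _ hz dz).
  exists (MkHom (is_hom_deg hx)), (MkHom (is_hom_deg hv)); split.
    by apply: Hom_eq => t; rewrite (Hom_dmE (x := MkHom (is_hom_deg hx)) t hx) dx.
  apply: Hom_eq => t; rewrite HomgD (sE (MkHom (is_hom_deg hx)) t _ hx).
  by rewrite (Hom_dmE (x := MkHom (is_hom_deg hv)) t hv) zE.
have qi := locdg_in_qi qU.
have kRS := @semifree_K_projective B RS.
apply/(acyclic_qi qi).
have bU : bijM S (locdg S U) := @locdg_bij _ S U.
apply: (acyclic_Hom_semifree_eval (M := RS) (one := locdg_in S zquo (qin _ 1))).
- exact: locquo_dif.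
- move=> i v hv dv; have Iv r : r = 0 -> (r : B) *: v = 0 by move=> ->; exact: scale0r.
  exists (locquo_lift (iI := @zero_ideal R) Iv bU); first exact: locquo_lift_deg hv _ _.
  by split=> [|x]; [exact: locquo_lift1 | exact: locquo_lift_dif].
apply: (K_projective_acyclic kRS qi); apply/acyclic_adjunction.
have [z qz] := zquo_tensor (semifree D).
(* The tensor product of the resolutions of S^-1 R and of R/p resolves S^-1(R/p), which is k(p). *)
pose e := comp_dgHom (locdg_map S (semifree_map D)) (comp_dgHom (locdg_map S z)
  (comp_dgHom (loc_tensor S zquo (semifree D)) (tensor_l (semifree_map RS) (semifree D)))).
have qe : quasi_iso e.
  apply: comp_qi (locdg_map_qi _ (semifree_qi D)); apply: comp_qi (locdg_map_qi _ qz).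
  apply: comp_qi (loc_tensor_qi _ _ _); apply: K_flat_qi_l (semifree_qi _); exact: semifree_K_flat.
exact: (acyclic_Hom_indep (@semifree_K_projective B (resid p)) (K_projective_tensor kRS kD)
  (semifree_qi (resid p)) qe ak).
Qed.

End HomSupport.

(** * Support at primes *)

Lemma scaler_comb (R : comPzRingType) (V : lmodType R) (s s' r r' : R) (x y y' : V) :
  s' *: (s *: y - r *: x) + s *: (s' *: y' - r' *: x) =
  (s * s') *: (y + y') - (s' * r + s * r') *: x.
Proof.
rewrite !scalerBr !scalerA scalerDr scalerDl [s' * s]mulrC.
by rewrite opprD addrACA.
Qed.

(* Over the residue field of p every complex of vector spaces with nonzero cohomology
   has a shift of the residue field as a direct summand; the splitting is
   read off a hyperplane that contains the boundaries but misses a given cocycle. *)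
Section Splitting.
Variables (R : comPzRingType) (p : primeId R).
Local Notation B := (conc R).
Local Notation S := (compl p).
Local Notation k := (resid p).
Local Notation kin := (locdg_in S (quo (pid_ideal p))).
Variable V : dgMod B.
Hypotheses (pV : forall (r : R) (v : V), p r -> (r : B) *: v = 0) (bV : bijM S V).

Let one : k := kin (qin (pid_ideal p) 1).

Lemma resid_den (c : k) : exists s r, S s /\ (s : B) *: c = (r : B) *: one.
Proof.
have [s [q [hs sc]]] := locdg_den c; have [r qE] := qin_surj q; exists s, r; split=> //.
rewrite sc -(cdgHomZ kin); congr (kin _).
by rewrite qE qin1.
Qed.

Lemma resid_one_kill (r : R) : p r -> (r : B) *: one = 0.
Proof.
move=> pr; rewrite -(cdgHomZ kin) -[RHS](dgHom0 kin).
by congr (kin _); rewrite -qin1; apply/qin_eq0.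
Qed.

Section Cocycle.
Variables (i : int) (z : V).
Hypotheses (hz : hmg V i z) (dz : dm V z = 0) (nz : ~ exists y, z = dm V y).

(** Subspaces over the residue field avoiding [z], phrased without fractions as submodules saturated
    under [S]. The last clause makes them contain all components of degree other than [i] and all
    boundaries. *)
Let good (X : set V) : Prop :=
  [/\ forall x y, X x -> X y -> X (x + y), forall (r : R) x, X x -> X ((r : B) *: x),
      forall s x, S s -> X ((s : B) *: x) -> X x, ~ X z &
      forall x, (exists y, gcomp (dgm_str V) i x = dm V y) -> X x].

Let good0 : good (fun x => exists y, gcomp (dgm_str V) i x = dm V y).
Proof.
split=> // [x x' [y e] [y' e']|r x [y e]|s x hs [y]|[y]].
- by exists (y + y'); rewrite !raddfD e e'.
- by exists ((r : B) *: y); rewrite gcomp_linear dif_linear e.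
- have [y' ->] := (bV hs).2 y; rewrite gcomp_linear dif_linear => /(bij_inj bV hs) e.
  by exists y'.
by rewrite hz => e; apply: nz; exists y.
Qed.

Let hyperplane : exists H, good H /\ forall X, good X -> (forall x, H x -> X x) -> forall x, X x -> H x.
Proof.
have [F FP tF|H [HP Hmax]] := @Zorn_bigcup V (fun X => X = set0 \/ good X); last first.
  have gH : good H.
    case: HP => // H0; exfalso; apply: (Hmax _ _ (or_intror good0)).
    rewrite H0; split=> [x []|h].
    by apply: (h 0); exists 0; rewrite !raddf0.
  exists H; split=> // X gX HX x Xx; apply: contrapT => nHx.
  by apply: (Hmax X) (or_intror gX); split=> // XH; exact: nHx (XH _ Xx).
have gF X x : F X -> X x -> good X.
  by move=> FX Xx; case: (FP _ FX) => // X0; rewrite X0 in Xx.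
have [[X0 FX0 [x0 Xx0]]|nF] := pselect (exists2 X, F X & exists x, X x); last first.
  by left; apply/seteqP; split=> // x [X FX Xx]; apply: nF; exists X => //; exists x.
right; split=> [x y [X FX Xx] [Y FY Yy]|r x [X FX Xx]|s x hs [X FX Xx]|[X FX Xz]|x hx].
- have [XY|YX] := tF _ _ FX FY.
    by exists Y => //; have [YD _ _ _ _] := gF _ _ FY Yy; apply: YD => //; exact: XY.
  by exists X => //; have [XD _ _ _ _] := gF _ _ FX Xx; apply: XD => //; exact: YX.
- by exists X => //; have [_ XZ _ _ _] := gF _ _ FX Xx; exact: XZ.
- by exists X => //; have [_ _ XS _ _] := gF _ _ FX Xx; exact: XS hs Xx.
- by have [_ _ _ nX _] := gF _ _ FX Xz.
by exists X0 => //; have [_ _ _ _ X0b] := gF _ _ FX0 Xx0; exact: X0b.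
Qed.

Let H : set V := sval (cid hyperplane).
Let gH : good H. Proof. by rewrite /H; case: cid => X []. Qed.
Let Hmax X : good X -> (forall x, H x -> X x) -> forall x, X x -> H x.
Proof. by rewrite /H; case: cid => Y [] /= _ h; exact: h. Qed.

Let HD x y : H x -> H y -> H (x + y). Proof. by case: gH => h _ _ _ _; exact: h. Qed.
Let HZ (r : R) x : H x -> H ((r : B) *: x). Proof. by case: gH => _ h _ _ _; exact: h. Qed.
Let HS s x : S s -> H ((s : B) *: x) -> H x. Proof. by case: gH => _ _ h _ _; exact: h. Qed.
Let Hz : ~ H z. Proof. by case: gH. Qed.
Let Hb x : (exists y, gcomp (dgm_str V) i x = dm V y) -> H x.
Proof. by case: gH => _ _ _ _; exact. Qed.
Let H0 : H 0. Proof. by apply: Hb; exists 0; rewrite !raddf0. Qed.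
Let HN x : H x -> H (- x). Proof. by move=> /(HZ (-1)); rewrite scaleN1r. Qed.
Let HB x y : H x -> H y -> H (x - y). Proof. by move=> hx hy; apply: HD => //; exact: HN. Qed.

(** For [x] outside [H], the subspace spanned by [H] and [x] is strictly larger than [H], hence not
    good, and the only clause that can fail is the avoidance of [z]. *)
Let codim1 x : exists r s : R, S r /\ H ((r : B) *: x - (s : B) *: z).
Proof.
have [Hx|nHx] := pselect (H x).
  by exists 1, 0; split; [exact: pid1 | rewrite scale1r scale0r subr0].
pose X y := exists s r : R, S s /\ H ((s : B) *: y - (r : B) *: x).
have HX y : H y -> X y.
  by move=> Hy; exists 1, 0; split; [exact: pid1 | rewrite scale1r scale0r subr0].
have [s [r [hs Hzx]]] : X z.
  apply: contrapT => nXz; apply: nHx; apply: (Hmax (X := X)) => //; last first.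
    by exists 1, 1; split; [exact: pid1 | rewrite subrr].
  split=> // [y y' [s [r [hs h]]] [s' [r' [hs' h']]]|a y [s [r [hs h]]]|t y ht [s [r [hs h]]]|y hy].
  - exists (s * s'), (s' * r + s * r'); split; first exact: msetM.
    exact: (eq_ind _ H (HD (HZ s' h) (HZ s h')) _
      (@scaler_comb R (dgm_sort V : lmodType R) s s' r r' x y y')).
  - exists s, (a * r); split=> //.
    by rewrite scalerA [s * a]mulrC -!scalerA -scalerBr; exact: HZ.
  - exists (s * t), r; split; first exact: msetM.
    by rewrite -scalerA.
  exact/HX/Hb.
exists r, s; split; last by rewrite -opprB; exact: HN.
(* If [r] were in p it would kill [x], and [z] would lie in [H]. *)
move=> pr; move: Hzx; rewrite (pV _ pr) subr0 => /(HS hs); exact: Hz.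
Qed.

Let Iz (r : R) : p r -> (r : B) *: z = 0. Proof. exact: pV. Qed.
Let j : k -> V := locquo_lift (iI := pid_ideal p) Iz bV.
Let hj : hom_deg i j. Proof. exact: locquo_lift_deg hz Iz bV. Qed.
Let j1 : j one = z. Proof. exact: locquo_lift1. Qed.
Let jZ (r : R) c : j ((r : B) *: c) = (r : B) *: j c. Proof. exact: conc_hom_linear hj. Qed.

Let Hj c : H (j c) -> c = 0.
Proof.
have [s [r [hs sc]]] := resid_den c => Hc.
apply: (bij_inj (@locdg_bij _ S _) hs); rewrite scaler0 sc.
have [/resid_one_kill //|pr] := pselect (p r).
exfalso; apply: Hz; apply: (HS (s := r)) => //.
by rewrite -j1 -jZ -sc jZ; exact: HZ.
Qed.

(** So [V] is the sum of [H] and the image of [j]; the sum is direct by [Hj], and [proj] is the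
    resulting projection. *)
Let proj_ex x : exists c, H (x - j c).
Proof.
have [r [s [hr Hx]]] := codim1 x.
have [c cE] := (@locdg_bij _ S (quo (pid_ideal p)) r hr).2 ((s : B) *: one).
by exists c; apply: (HS hr); rewrite scalerBr -jZ -cE jZ j1.
Qed.

Let proj x : k := sval (cid (proj_ex x)).
Let projP x : H (x - j (proj x)). Proof. by rewrite /proj; case: cid. Qed.
Let proj_eq x c : H (x - j c) -> proj x = c.
Proof.
move=> h; apply/eqP; rewrite -subr_eq0; apply/eqP/Hj; rewrite (homgB hj).
have -> : j (proj x) - j c = (x - j c) - (x - j (proj x)) by zmod_in V.
exact: HB.
Qed.

Let proj_deg : hom_deg (- i) proj.
Proof.
apply: conc_deg => [x y|n x hx|a x].
- apply: proj_eq; rewrite (homgD hj).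
  have -> : x + y - (j (proj x) + j (proj y)) = (x - j (proj x)) + (y - j (proj y)).
    by zmod_in V.
  exact: HD.
- have [ni|ni] := eqVneq n i; first by rewrite ni addrN; exact: locquo_homog.
  rewrite (_ : proj x = 0); first exact: homog0.
  apply: proj_eq; rewrite (homg0 hj) subr0; apply: Hb; exists 0.
  by rewrite (gcomp_homog _ hx) eq_sym (negPf ni) raddf0.
by apply: proj_eq; rewrite jZ -scalerBr; exact: HZ.
Qed.

(** The map [j] is a cycle because [z] is a cocycle, and [proj] is one because [H] contains every
    boundary. *)
Lemma cocycle_split : exists (j : k -> V) (q : V -> k),
  [/\ hom_deg i j, hom_deg (- i) q, forall x, Dh i j x = 0, forall x, Dh (- i) q x = 0 &
      cancel j q].
Proof.
exists j, proj; split=> // [x|x|c].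
- by rewrite /Dh locquo_lift_dif // locquo_dif (homg0 hj) ksgn0 subrr.
- rewrite /Dh locquo_dif sub0r (_ : proj _ = 0) ?ksgn0 ?oppr0 //.
  apply: proj_eq; rewrite (homg0 hj) subr0; apply: Hb; exists (gcomp (dgm_str V) (i - 1) x).
  exact: gcomp_dif.
by apply: proj_eq; rewrite subrr.
Qed.

End Cocycle.

Lemma resid_split : ~ acyclic V -> exists i (j : k -> V) (q : V -> k),
  [/\ hom_deg i j, hom_deg (- i) q, forall x, Dh i j x = 0, forall x, Dh (- i) q x = 0 &
      cancel j q].
Proof.
move=> nV; apply: contrapT => h; apply: nV; apply/acyclicP => z dz.
apply: boundary_sum => i; apply: contrapT => nz; apply: h; exists i.
exact: cocycle_split (homog_gcomp _ i z) (gcomp_cocycle i dz) nz.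
Qed.

End Splitting.

(** * Supports decide the vanishing of tensor products and of Hom *)

Section ResidueTest.
Variable R : comPzRingType.
Local Notation B := (conc R).
Implicit Types (X Y F N V W : dgMod B) (p : primeId R).

Lemma resid_kill p (r : R) (c : resid p) : p r -> (r : B) *: c = 0.
Proof.
move=> pr; have [s [a [hs sc]]] := resid_den c.
apply: (bij_inj (@locdg_bij _ (compl p) _) hs).
rewrite scaler0 scalerA [_ * r]mulrC -scalerA sc scalerA.
by rewrite [r * a]mulrC -scalerA resid_one_kill // scaler0.
Qed.

Lemma resid_tensor_kill p X (r : R) (t : tensor_dgMod (resid p) X) : p r -> (r : B) *: t = 0.
Proof.
move=> pr; elim/tensor_ind: t => [x y hx hy|l m c x _ _]; first by rewrite scalerDr hx hy addr0.
by rewrite cpureZ resid_kill // pure0l.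
Qed.

Lemma resid_tensor_bij p X : bijM (compl p) (tensor_dgMod (resid p) X).
Proof. exact/bij_tensor/locdg_bij. Qed.

Lemma tensor_retract V W F i (j : W -> V) (q : V -> W) : hom_deg i j -> hom_deg (- i) q ->
  (forall x, Dh i j x = 0) -> (forall x, Dh (- i) q x = 0) -> cancel j q ->
  acyclic (tensor_dgMod V F) -> acyclic (tensor_dgMod W F).
Proof.
move=> hj hq dj dq jK /acyclicP aV; apply/acyclicP => z dz.
have [|y yE] := aV (tmap j z).
  by rewrite (tmap_dif _ hj) dz (tmap0 _ hj) ksgn0 addr0; exact: tmap_eq0 dj.
have dqy := tmap_dif y hq; rewrite (tmap_eq0 _ dq) add0r -yE in dqy.
exists (ksgn (- i) (tmap q y : tensor_dgMod W F)).
rewrite [RHS](raddf_ksgn (dif (dgm_str (tensor_dgMod W F)))) dqy ksgnK.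
by rewrite (tmap_comp _ hj hq) tmap_id.
Qed.

Lemma acyclic_tensor_l X F : K_flat F -> acyclic X -> acyclic (tensor_dgMod X F).
Proof. by move=> kF aX; apply: acyclic_swap; exact: kF. Qed.

Hypothesis nR : noetherian R.

(** If k(p) (x) X is not acyclic, k(p) is a shifted retract of it, and k(p) (x) F one of k(p) (x) X
    (x) F. Conversely, a prime in the support of X (x) F is in both supports, since K-flat factors
    preserve acyclicity. *)
Lemma tensor_test X F : K_flat X -> K_flat F -> acyclic (tensor_dgMod X F) <->
  forall p, acyclic (tensor_dgMod (resid p) X) \/ acyclic (tensor_dgMod (resid p) F).
Proof.
move=> kX kF; have kXF := K_flat_tensor kX kF; split=> [aXF p|h].
  have [|nX] := pselect (acyclic (tensor_dgMod (resid p) X)); [by left|right].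
  have [i [j [q [hj hq dj dq jK]]]] :=
    resid_split (@resid_tensor_kill p X) (@resid_tensor_bij p X) nX.
  apply: (tensor_retract hj hq dj dq jK); rewrite acyclic_assoc.
  exact: (K_flat_acyclic_tensor (Z := resid p) kXF aXF).
apply: contrapT => /(tensor_support nR kXF)[p]; apply.
case: (h p) => a.
  by rewrite -acyclic_assoc; exact: (acyclic_tensor_l kF a).
rewrite -acyclic_assoc acyclic_tensorC -acyclic_assoc.
exact: (acyclic_tensor_l kX (acyclic_swap a)).
Qed.

Lemma Hom_test X Y N : K_projective X -> K_flat X -> K_projective Y -> K_flat Y ->
  (forall p, acyclic (tensor_dgMod (resid p) X) -> acyclic (tensor_dgMod (resid p) Y)) ->
  acyclic (Hom_dgMod X N) -> acyclic (Hom_dgMod Y N).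
Proof.
move=> pX kX pY kY XY aXN; apply: contrapT => /(Hom_support nR)[p]; apply.
set E := semifree (resid p).
have [pE qE] := (@semifree_K_projective B (resid p), @semifree_qi B (resid p)).
rewrite -acyclic_adjunction.
have [aY|nY] := pselect (acyclic (tensor_dgMod (resid p) Y)).
  apply: acyclic_Hom_contract; first exact: K_projective_tensor.
  exact/(K_flat_acyclic kY qE).
have nX : ~ acyclic (tensor_dgMod (resid p) X) by move=> /XY.
have [i [j [q [hj hq dj dq jK]]]] :=
  resid_split (@resid_tensor_kill p X) (@resid_tensor_bij p X) nX.
have aEN : acyclic (Hom_dgMod E N).
  apply: (acyclic_Hom_retract (K_projective_tensor pE pX) pE (K_flat_qi_l kX qE) qE
    hj hq dj dq jK).
  by rewrite acyclic_adjunction; exact: pE aXN.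
(* The factors are exchanged so that the vanishing of RHom(k(p), N) can be used inside RHom(Y,
   -). *)
apply: (acyclic_Hom_iso (f := swap Y E) (g := swap E Y) (@swapK _ _ _)).
by rewrite acyclic_adjunction; exact: pY aEN.
Qed.

End ResidueTest.

(** * Change of rings *)

Section ChangeOfRings.
Variables (A : cdgRing) (R : comPzRingType).
Local Notation B := (conc R).
Variable phi : dgRingHom A B.
Local Notation F := (restr_scalars phi).
Implicit Types (Z N : dgMod B) (P G : dgMod A).

Lemma restr_scaleE Z (a : A) (z : F Z) : a *: z = (phi a : B) *: (z : Z). Proof. by []. Qed.

Lemma phi_homog k (a : A) : homog (dgr_str A) k a -> k = 0 \/ phi a = 0.
Proof. by move=> /(dgrh_homog phi)/homog_conc. Qed.

(** Scalars of nonzero degree act as 0 through [phi], so Koszul signs against scalars disappear on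
    restricted modules. *)
Lemma restr_ksgn Z k n (a : A) (z : F Z) : homog (dgr_str A) k a ->
  ksgn (n * k) (a *: z) = a *: z.
Proof.
move=> /phi_homog[->|a0]; first by rewrite mulr0 ksgn_id.
by rewrite restr_scaleE a0 scale0r ksgn0.
Qed.

Lemma restr_bal Z P k (a : A) (z : F Z) (x : P) : homog (dgr_str A) k a ->
  pure z (a *: x) = pure (a *: z) x.
Proof.
move=> ha; elim/(homog_ind (X := dgm_str (F Z))): z => [z z' hz hz'|l z hz].
  by rewrite scalerDr !pureDl hz hz'.
by rewrite (pure_bal _ ha hz) -pure_ksgnl mulrC (restr_ksgn _ _ ha).
Qed.

Lemma conc_bal Z N (s : R) (z : Z) (t : N) : pure z ((s : B) *: t) = pure ((s : B) *: z) t.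
Proof.
elim/(homog_ind (X := dgm_str Z)): z => [z z' hz hz'|l z hz]; first by rewrite scalerDr !pureDl hz hz'.
by rewrite (pure_bal _ (homog_conc0 s) hz) mul0r ksgn_id.
Qed.

Definition restr_map Z N (f : dgHom Z N) : dgHom (F Z) (F N).
Proof.
apply: (@deg0_dgHom A (F Z) (F N) f); last by move=> x; exact: (Dh_dgHom f x (n := 0)).
split=> [x y|i x hx|k a x ha]; first exact: (dgHomD f).
  by rewrite addr0; exact: (dgh_homog f hx).
by rewrite mul0r ksgn_id; exact: (dgHomZ f (phi a) x).
Defined.

Lemma restr_map_qi Z N (f : dgHom Z N) : quasi_iso f -> quasi_iso (restr_map f).
Proof. by move=> /quasi_isoP h; apply/quasi_isoP; exact: h. Qed.

Lemma restr_acyclic Z : acyclic Z -> acyclic (F Z).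
Proof. by move=> /acyclicP h; apply/acyclicP. Qed.

Local Notation U := (F (cmod R^o)).

Definition mulU (b : R) : dgHom U U := restr_map (scal b (cmod R^o)).

Section Extension.
Variable P : dgMod A.

(** A separate copy of the tensor product: the original carries an [A]-module structure, this one an
    [R]-module structure through the left factor. *)
Definition ext_sort : Type := tensor U P.
HB.instance Definition _ := GRing.Zmodule.on ext_sort.

Definition ext_scale (b : R) (t : ext_sort) : ext_sort := tensor_l (mulU b) P t.

Lemma ext_scale_pure b (r : U) (x : P) : ext_scale b (pure r x) = pure ((b * r : R^o) : U) x.
Proof. by rewrite /ext_scale tensor_lE (tmap_pure (dgHom_deg _)). Qed.

Lemma ext_scaleD b t t' : ext_scale b (t + t') = ext_scale b t + ext_scale b t'.
Proof. exact: (dgHomD (tensor_l (mulU b) P)). Qed.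

Lemma ext_scaleA a b t : ext_scale a (ext_scale b t) = ext_scale (a * b) t.
Proof.
elim/tensor_ind: t => [t t' ht ht'|l m r x _ _]; first by rewrite !ext_scaleD ht ht'.
by rewrite !ext_scale_pure mulrA.
Qed.
Lemma ext_scale1 : left_id 1 ext_scale.
Proof.
elim/tensor_ind=> [t t' ht ht'|l m r x _ _]; first by rewrite ext_scaleD ht ht'.
by rewrite ext_scale_pure mul1r.
Qed.
Lemma ext_scaleDr : right_distributive ext_scale +%R. Proof. exact: ext_scaleD. Qed.
Lemma ext_scaleDl t : {morph ext_scale^~ t : a b / a + b}.
Proof.
move=> a b; elim/tensor_ind: t => [t t' ht ht'|l m r x _ _].
  by rewrite !ext_scaleD ht ht' addrACA.
by rewrite !ext_scale_pure mulrDl pureDl.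
Qed.

HB.instance Definition _ := GRing.Zmodule_isLmodule.Build R ext_sort
  ext_scaleA ext_scale1 ext_scaleDr ext_scaleDl.

Let str : dgStruct ext_sort := tensor_str U P.

Lemma ext_gcompZ n (a : R) (t : ext_sort) : gcomp str n (a *: t) = a *: gcomp str n t.
Proof. exact: (gcomp_dgHom (tensor_l (mulU a) P)). Qed.

Lemma ext_difZ (a : R) (t : ext_sort) : dif str (a *: t) = a *: dif str t.
Proof. by rewrite [RHS](dgh_dif (tensor_l (mulU a) P)). Qed.

(* R (x)_A P *)
Definition ext : dgMod B := conc_dgMod ext_gcompZ ext_difZ.

Definition epure (r : R^o) (x : P) : ext := pure (r : U) x.

Lemma epureZ (s r : R) x : (s : B) *: epure r x = epure (s * r) x.
Proof. exact: ext_scale_pure. Qed.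

Lemma epure1 r x : epure r x = (r : B) *: epure 1 x.
Proof. by rewrite epureZ mulr1. Qed.

Lemma epureDr r x y : epure r (x + y) = epure r x + epure r y. Proof. exact: pureDr. Qed.

Lemma U_homog (r : U) : hmg U 0 r.
Proof. by apply/(@homog_cmod R R^o); left. Qed.

Lemma epure_homog r n x : hmg P n x -> hmg ext n (epure r x).
Proof. by move=> hx; rewrite -[n]add0r; exact: homog_pure (U_homog r) hx. Qed.

Lemma epure_dif r x : dm ext (epure r x) = epure r (dm P x).
Proof. by rewrite [LHS](pure_dif _ (U_homog r)) pure0l add0r ksgn_id. Qed.

Lemma epure_act r k (a : A) x : homog (dgr_str A) k a ->
  epure r (a *: x) = (phi a : B) *: epure r x.
Proof. by move=> ha; rewrite epureZ; exact: (restr_bal (Z := cmod R^o)) ha. Qed.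

Lemma ext_ind (K : ext -> Prop) : (forall s t, K s -> K t -> K (s + t)) ->
  (forall n x r, hmg P n x -> K (epure r x)) -> forall t, K t.
Proof. by move=> KD Kp; elim/tensor_ind => // m n r x _ hx; exact: (Kp n). Qed.

Section TensorExt.
Variable Z : dgMod B.
Local Notation ZE := (tensor_dgMod Z ext).
Local Notation ZP := (tensor_dgMod (F Z) P).

Section Fixed.
Variable z : Z.
Let c (r : U) (x : P) : tensor (F Z) P := pure ((r : B) *: z : F Z) x.
Let cDl x : {morph c^~ x : r s / r + s}.
Proof. by move=> r s; rewrite /c -pureDl; congr (pure _ _); exact: (@scalerDl B Z z r s). Qed.
Let cDr r : {morph c r : x y / x + y}. Proof. exact: pureDr. Qed.
Let c_bal k l (a : A) r x : homog (dgr_str A) k a -> hmg U l r ->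
  c r (a *: x) = ksgn (k * l) (c (a *: r) x).
Proof.
move=> ha hr; rewrite /c (restr_bal _ _ ha) -pure_ksgnl mulrC.
have -> : ((a *: r : U) : B) *: z = a *: ((r : B) *: z : F Z).
  exact: (esym (@scalerA B Z (phi a) r z)).
by rewrite (restr_ksgn _ _ ha).
Qed.

Definition ext_act : {additive tensor U P -> tensor (F Z) P} := tensor_liftA cDl cDr c_bal.

Lemma ext_act_pure r x : ext_act (epure r x) = pure ((r : B) *: z : F Z) x.
Proof. exact: (tensor_liftE cDl cDr c_bal). Qed.

Lemma ext_actD s t : ext_act (s + t) = ext_act s + ext_act t. Proof. exact: raddfD. Qed.

End Fixed.

Let bDl (t : ext) : {morph (fun z => ext_act z t) : x y / x + y}.
Proof.
move=> x y; elim/ext_ind: t => [s t hs ht|n u r _].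
  by rewrite !ext_actD hs ht addrACA.
by rewrite !ext_act_pure scalerDr pureDl.
Qed.
Let bDr z : {morph (fun t : ext => ext_act z t) : x y / x + y}. Proof. exact: ext_actD. Qed.
Let b_bal k l (s : B) z (t : ext) : homog (dgr_str B) k s -> hmg Z l z ->
  ext_act z (s *: t) = ksgn (k * l) (ext_act (s *: z) t).
Proof.
have E : ext_act z (s *: t) = ext_act (s *: z) t.
  elim/ext_ind: t => [t t' ht ht'|n u r _]; first by rewrite scalerDr !ext_actD ht ht'.
  by rewrite epureZ !ext_act_pure scalerA mulrC.
move=> /homog_conc[->|s0] _; first by rewrite mul0r ksgn_id.
rewrite E s0 scale0r (_ : ext_act 0 t = 0) ?ksgn0 //.
by apply: (addIr (ext_act 0 t)); rewrite -bDl !add0r.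
Qed.

(** The isomorphism of Z (x)_R (R (x)_A P) with FZ (x)_A P sending z (x) (r (x) x) to rz (x) x; its
    inverse is [ext_unit]. *)
Definition ext_mul : {additive tensor Z ext -> tensor (F Z) P} := tensor_liftA bDl bDr b_bal.

Lemma ext_mulE z r x : ext_mul (pure z (epure r x)) = pure ((r : B) *: z : F Z) x.
Proof. by rewrite -ext_act_pure; exact: (tensor_liftE bDl bDr b_bal). Qed.

Let eDl x : {morph (fun z : F Z => pure (z : Z) (epure 1 x) : tensor Z ext) : y z / y + z}.
Proof. by move=> y z; exact: pureDl. Qed.
Let eDr (z : F Z) : {morph (fun x => pure (z : Z) (epure 1 x) : tensor Z ext) : x y / x + y}.
Proof. by move=> x y; rewrite epureDr pureDr. Qed.
Let e_bal k l (a : A) (z : F Z) x : homog (dgr_str A) k a -> hmg (F Z) l z ->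
  pure (z : Z) (epure 1 (a *: x)) =
  ksgn (k * l) (pure ((a *: z : F Z) : Z) (epure 1 x) : tensor Z ext).
Proof.
move=> ha hz; rewrite (epure_act _ _ ha) conc_bal -pure_ksgnl mulrC.
by congr (pure _ _); rewrite -[LHS](restr_ksgn l (z : F Z) ha).
Qed.

Definition ext_unit : {additive tensor (F Z) P -> tensor Z ext} := tensor_liftA eDl eDr e_bal.

Lemma ext_unitE z x : ext_unit (pure z x) = pure (z : Z) (epure 1 x).
Proof. exact: (tensor_liftE eDl eDr e_bal). Qed.

Lemma tensor_ext_ind (K : ZE -> Prop) : (forall s t, K s -> K t -> K (s + t)) ->
  (forall m z r x, hmg Z m z -> K (pure z (epure r x))) -> forall t, K t.
Proof.
move=> KD Kp; elim/tensor_ind => // l m z t hz _.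
by elim/ext_ind: t => [s t hs ht|n x r _]; [rewrite pureDr; exact: KD | exact: (Kp l)].
Qed.

Lemma ext_mulK : cancel ext_mul ext_unit.
Proof.
elim/tensor_ext_ind => [s t hs ht|m z r x _]; first by rewrite !raddfD hs ht.
by rewrite ext_mulE ext_unitE -conc_bal -epure1.
Qed.

Lemma ext_unitK : cancel ext_unit ext_mul.
Proof.
elim/tensor_ind => [s t hs ht|l m z x _ _]; first by rewrite !raddfD hs ht.
by rewrite ext_unitE ext_mulE scale1r.
Qed.

Lemma ext_mul_dif t : ext_mul (dm ZE t) = dm ZP (ext_mul t).
Proof.
elim/tensor_ext_ind: t => [s t hs ht|m z r x hz]; first by rewrite !raddfD hs ht.
rewrite (pure_dif _ hz) raddfD raddf_ksgn epure_dif !ext_mulE.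
have hrz : hmg (F Z) m ((r : B) *: z) by exact: homog_linear.
by rewrite (pure_dif _ hrz); congr (pure _ _ + _); rewrite -dif_linear.
Qed.

Lemma ext_unit_dif t : ext_unit (dm ZP t) = dm ZE (ext_unit t).
Proof. by rewrite -{1}[t]ext_unitK -ext_mul_dif ext_mulK. Qed.

Lemma acyclic_tensor_ext : acyclic ZE <-> acyclic ZP.
Proof.
split; [apply: (@acyclic_transfer B A ZE ZP ext_mul ext_unit)
       |apply: (@acyclic_transfer A B ZP ZE ext_unit ext_mul)].
- exact: ext_mul_dif.
- exact: ext_unit_dif.
- exact: raddf0.
- exact: ext_unitK.
- exact: ext_unit_dif.
- exact: ext_mul_dif.
- exact: raddf0.
- exact: ext_mulK.
Qed.

End TensorExt.

Section HomExt.
Variable N : dgMod B.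

Lemma ext_unit_deg n (u : ext -> N) : hom_deg n u -> hom_deg n (fun x => u (epure 1 x) : F N).
Proof.
move=> hu; split=> [x y|i x hx|k a x ha]; first by rewrite epureDr (homgD hu).
  exact/(homgh hu)/epure_homog.
by rewrite (epure_act _ _ ha) (conc_hom_linear _ _ hu) -[LHS](restr_ksgn n (u _ : F N) ha).
Qed.

Lemma ext_unit_Dh n (u : ext -> N) x :
  Dh n (fun x => u (epure 1 x) : F N) x = Dh n u (epure 1 x).
Proof. by rewrite [RHS]/Dh epure_dif. Qed.

Section Adjoint.
Variables (n : int) (w : P -> F N).
Hypothesis hw : hom_deg n w.
Let c (r : U) (x : P) : N := (r : B) *: (w x : N).
Let cDl x : {morph c^~ x : r s / r + s}. Proof. by move=> r s; exact: (@scalerDl B N (w x) r s). Qed.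
Let cDr r : {morph c r : x y / x + y}.
Proof. by move=> x y; rewrite /c (homgD hw); exact: (@scalerDr B N r (w x) (w y)). Qed.
Let c_bal k l (a : A) r x : homog (dgr_str A) k a -> hmg U l r ->
  c r (a *: x) = ksgn (k * l) (c (a *: r) x).
Proof.
move=> ha hr; rewrite /c (homgZ hw _ ha) (restr_ksgn _ _ ha).
have -> : ((a *: r : U) : B) *: (w x : N) = a *: ((r : B) *: (w x : N) : F N).
  exact: (esym (@scalerA B N (phi a) r (w x))).
rewrite mulrC (restr_ksgn _ _ ha) !restr_scaleE !scalerA; congr (_ *: _); exact: mulrC.
Qed.

Definition ext_adjA : {additive tensor U P -> N} := tensor_liftA cDl cDr c_bal.
Definition ext_adj : ext -> N := ext_adjA.

Lemma ext_adjE r x : ext_adj (epure r x) = (r : B) *: (w x : N).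
Proof. exact: (tensor_liftE cDl cDr c_bal). Qed.

Lemma ext_adjD s t : ext_adj (s + t) = ext_adj s + ext_adj t.
Proof. exact: (raddfD ext_adjA). Qed.

Lemma ext_adj_deg : hom_deg n ext_adj.
Proof.
apply: conc_deg => [s t|i t|a t]; first exact: ext_adjD.
  move: i t; apply: tensor_homog_ind => [i s t hs ht|i|l m r x hr hx].
  - by rewrite ext_adjD; exact: homogD.
  - by rewrite [ext_adj 0](raddf0 ext_adjA); exact: homog0.
  rewrite ext_adjE; case/(@homog_cmod R R^o): hr => ->; last by rewrite scale0r; exact: homog0.
  by rewrite add0r; apply/homog_linear/(homgh hw).
elim/ext_ind: t => [s t hs ht|i x r _]; first by rewrite scalerDr !ext_adjD hs ht scalerDr.
by rewrite epureZ !ext_adjE scalerA.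
Qed.

Lemma ext_adj_Dh r x : Dh n ext_adj (epure r x) = (r : B) *: (Dh n w x : N).
Proof.
rewrite /Dh epure_dif !ext_adjE dif_linear -scaler_ksgn -scalerBr //.
Qed.

End Adjoint.

Lemma acyclic_Hom_ext : acyclic (Hom_dgMod ext N) <-> acyclic (Hom_dgMod P (F N)).
Proof.
split=> /Hom_acyclicP h; apply/Hom_acyclicP => n f hf df.
  have [|v hv vE] := h n _ (ext_adj_deg hf).
    elim/ext_ind => [s t hs ht|i x r _]; last by rewrite ext_adj_Dh df scaler0.
    by rewrite (homgD (Dh_deg (ext_adj_deg hf))) hs ht addr0.
  exists (fun x => v (epure 1 x)) => [|x]; first exact: ext_unit_deg.
  by rewrite ext_unit_Dh -vE ext_adjE scale1r.
have [|w hw wE] := h n _ (ext_unit_deg hf); first by move=> x; rewrite ext_unit_Dh df.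
exists (ext_adj hw) => [|t]; first exact: ext_adj_deg.
elim/ext_ind: t => [s t hs ht|i x r _].
  by rewrite (homgD hf) (homgD (Dh_deg (ext_adj_deg hw))) hs ht.
by rewrite ext_adj_Dh -wE epure1 (conc_hom_linear _ _ hf).
Qed.

End HomExt.

(** Base change turns the tensor product with [Z] over [R] into one over [A], and restriction
    preserves acyclicity. *)
Lemma ext_K_flat : K_flat P -> K_flat ext.
Proof.
by move=> kP Z aZ; apply/acyclic_swap/acyclic_tensor_ext/acyclic_swap/kP/restr_acyclic.
Qed.

Lemma ext_K_projective : K_projective P -> K_projective ext.
Proof. by move=> kP N aN; apply/acyclic_Hom_ext/kP/restr_acyclic. Qed.

End Extension.
End ChangeOfRings.

(** * Comparing supports over the two rings *)

Section Compare.
Variables (A : cdgRing) (R : comPzRingType).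
Local Notation B := (conc R).
Variable phi : dgRingHom A B.
Local Notation F := (restr_scalars phi).
Hypothesis phi_surj : forall s : R, exists2 a : A, homog (dgr_str A) 0 a & phi a = s.
Implicit Types (X Y M N : dgMod B) (P : dgMod A) (p q : primeId R).

(* s acts on the cohomology of the tensor product through either factor, hence both as
   zero and bijectively. *)
Lemma disjoint_tensor X Y (s : R) : (forall x : X, (s : B) *: x = 0) ->
  (forall y : Y, (s : B) *: y = 0 -> y = 0) -> (forall y : Y, exists y', y = (s : B) *: y') ->
  acyclic (tensor_dgMod (semifree (F X)) (semifree (F Y))).
Proof.
move=> sX inj sur; have [a ha phia] := phi_surj s.
set GX := semifree (F X); set GY := semifree (F Y); set FX := tensor_dgMod (F X) GY.
set FY := tensor_dgMod (F Y) GX.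
pose f : dgHom (tensor_dgMod GX GY) FX := tensor_l (semifree_map (F X)) GY.
pose h : dgHom (tensor_dgMod GX GY) FY :=
  comp_dgHom (tensor_l (semifree_map (F Y)) GX) (swap GX GY).
have /quasi_isoP[f_inj _] : quasi_iso f by exact: K_flat_qi_l (@semifree_K_flat _ _) (semifree_qi _).
have qh : quasi_iso h.
  by apply: comp_qi; [exact: swap_qi | exact: K_flat_qi_l (@semifree_K_flat _ _) (semifree_qi _)].
have /quasi_isoP[_ h_sur] := qh.
apply/(acyclic_qi qh)/acyclicP => w dw.
have dZ (V : dgMod A) (v : V) : dm V (a *: v) = a *: dm V v.
  by rewrite (dgm_leibniz _ ha) (dif_homog0 ha) scale0r add0r ksgn_id.
pose g y : Y := sval (cid (sur y)).
have gE y : (s : B) *: g y = y by rewrite /g; case: cid.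
have gI (x y : Y) : (s : B) *: x = (s : B) *: y -> x = y.
  by move=> e; apply/eqP; rewrite -subr_eq0; apply/eqP/inj; rewrite scalerBr e subrr.
pose g' : F Y -> F Y := g.
have hg : hom_deg 0 g'.
  split=> [x y|i x hx|k c x hc].
  - by apply: gI; rewrite scalerDr !gE.
  - by rewrite addr0 /homog; apply: gI; rewrite -gcomp_linear gE; exact: hx.
  rewrite mul0r ksgn_id; apply: gI; rewrite gE restr_scaleE scalerA mulrC -scalerA.
  by rewrite gE.
have ag (t : FY) : a *: (tmap g' t : FY) = t.
  elim/tensor_ind: t => [x y hx hy|l m y x _ _]; first by rewrite (tmapD hg) scalerDr hx hy.
  by rewrite (tmap_pure hg) pureZ restr_scaleE phia gE.
have ga (t : FY) : tmap g' (a *: t) = t.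
  elim/tensor_ind: t => [x y hx hy|l m y x _ _]; first by rewrite scalerDr (tmapD hg) hx hy.
  by rewrite pureZ (tmap_pure hg) restr_scaleE phia; congr (pure _ _); apply: gI; rewrite gE.
have aX (t : FX) : a *: t = 0.
  elim/tensor_ind: t => [x y hx hy|l m y x _ _]; first by rewrite scalerDr hx hy addr0.
  by rewrite pureZ restr_scaleE phia sX pure0l.
have [z [y [dz wE]]] := h_sur w dw.
(* The image of a z in [FX] is 0, so a z bounds, and with it a w in [FY], where [a] can be divided
   out. *)
have [||z' z'E] := f_inj (a *: z) 0.
- by rewrite dZ dz scaler0.
- by rewrite dgHomZ aX raddf0.
pose v : FY := tmap g' (h z' + a *: y); exists v.
have aw : a *: w = dm FY (h z' + a *: y).
  by rewrite wE scalerDr -dgHomZ z'E dgh_dif raddfD dZ.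
by rewrite -(ga w) aw -[h z' + _]ag dZ ga.
Qed.

Lemma resid_disjoint p q (s : R) : p s -> ~ q s ->
  acyclic (tensor_dgMod (semifree (F (resid p))) (semifree (F (resid q)))).
Proof.
move=> ps qs; have bq := @locdg_bij R (compl q) (quo (pid_ideal q)) s qs.
apply: (disjoint_tensor (s := s)) bq.1 bq.2 => x; exact: resid_kill.
Qed.

Lemma primeId_eq p q : (forall s, p s <-> q s) -> p = q.
Proof.
case: p q => [p ip p1 pM] [q iq q1 qM] /= pq.
have e : p = q by apply/funext => s; apply/propext; exact: pq.
by case: _ / e iq q1 qM pq => iq q1 qM _; congr (PrimeId _ _ _); exact: Prop_irrelevance.
Qed.

(** Distinct primes differ at some element, which lies in exactly one of them; [swap] makes the two
    cases symmetric. *)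
Lemma resid_neq p q : p <> q -> acyclic (tensor_dgMod (F (resid q)) (semifree (F (resid p)))).
Proof.
move=> pq; apply/(K_flat_acyclic (@semifree_K_flat _ _) (semifree_qi (F (resid q)))).
apply: contrapT => na; apply: pq; apply: primeId_eq => s; split=> hs; apply: contrapT => ns.
  by apply: na; apply: acyclic_swap; exact: resid_disjoint hs ns.
by apply: na; exact: resid_disjoint hs ns.
Qed.

Lemma resid_one_neq0 p : locdg_in (compl p) (quo (pid_ideal p)) (qin (pid_ideal p) 1) <> 0.
Proof.
move=> /locdg_in_eq0[s hs]; rewrite -[LHS](qinZ (pid_ideal p) s 1) mulr1 => /qin_eq0 ps.
exact: hs.
Qed.

Lemma ext_resid_nonacyclic p : ~ acyclic (ext phi (semifree (F (resid p)))).
Proof.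
set G := semifree _ => aG.
have pG : K_projective (ext phi G) by exact/ext_K_projective/semifree_K_projective.
have /acyclic_Hom_ext/Hom_acyclicP aH := acyclic_Hom_contract (W := resid p) pG aG.
have [x|h hh hE] := aH 0 _ (dgHom_deg (semifree_map (F (resid p)))); first exact: Dh_dgHom.
have /quasi_isoP[_ sur] := semifree_qi (F (resid p)).
have d0 (x : F (resid p)) : dm _ x = 0 by exact: locquo_dif.
have [g [y [dg gE]]] := sur (locdg_in (compl p) (quo (pid_ideal p)) (qin (pid_ideal p) 1)) (d0 _).
apply: (@resid_one_neq0 p).
(* The homotopy is evaluated at a cocycle and takes values in a module with zero differential, so
   the element 1 would be 0. *)
by rewrite gE d0 addr0 hE /Dh d0 dg (homg0 hh) ksgn0 subr0.
Qed.

Hypothesis nR : noetherian R.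

Lemma ext_resid_test p P M Q (f : dgHom P (F M)) (g : dgHom Q M) :
  K_flat P -> quasi_iso f -> K_flat Q -> quasi_iso g ->
  acyclic (tensor_dgMod (resid p) (ext phi P)) <-> acyclic (tensor_dgMod (resid p) Q).
Proof.
move=> kP qf kQ qg; set k := resid p; set G := semifree (F k).
have kG : K_flat G by exact: semifree_K_flat.
have kG' : K_flat (ext phi G) by exact: ext_K_flat.
(* The residue field is moved to [A] and resolved by [G], [P] is replaced by what it resolves, and
   [G] is extended back to [R]: what remains is the tensor product over [R] of [Q] with the
   extension of [G], decided by supports. *)
rewrite acyclic_tensor_ext -(K_flat_acyclic kP (semifree_qi (F k))) acyclic_tensorC.
rewrite (K_flat_acyclic kG qf) -acyclic_tensor_ext -(K_flat_acyclic kG' qg) (tensor_test nR kQ kG').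
(* Some prime lies in the support of the extension of [G], and [resid_neq] leaves only [p]. *)
have [p' np'] := tensor_support nR kG' (@ext_resid_nonacyclic p).
have p'E : p' = p.
  by apply: contrapT => ne; apply: np'; apply/acyclic_tensor_ext/resid_neq => e; exact: ne.
split=> [/(_ p)[]//|aQ q]; first by rewrite -[X in resid X]p'E.
have [->|ne] := pselect (q = p); [by left|right].
by apply/acyclic_tensor_ext/resid_neq => e; exact: ne.
Qed.

End Compare.

Lemma to_H0_surj (A : cdgRing) (s : H0 A) :
  exists2 a : A, homog (dgr_str A) 0 a & to_H0 A a = s.
Proof.
have [z ->] := cohom_class_surj s; exists (val z); first exact: Z0_homog.
by congr (cohom_class _ _ _); apply: val_inj; exact: Z0_homog.
Qed.

Theorem theorem3p6 (A : cdgRing) (bA : bounded_cohomology A)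
    (nA : noetherian (H0 A)) (M N : dgMod (conc (H0 A))) :
  (forall (T : dgMod A) (T0 : dgMod (conc (H0 A))),
     is_LTensor (forget M) (forget N) T -> is_LTensor M N T0 ->
     (D_iso T (D_zero A) <-> D_iso T0 (D_zero (conc (H0 A)))))
  /\
  (forall (T : dgMod A) (T0 : dgMod (conc (H0 A))),
     is_RHom (forget M) (forget N) T -> is_RHom M N T0 ->
     (D_iso T (D_zero A) <-> D_iso T0 (D_zero (conc (H0 A))))).
Proof.
have surj := @to_H0_surj A; set phi := to_H0 A in surj.
split=> T T0 [P [f [kP qf TP]]] [Q [g [kQ qg T0Q]]];
  rewrite !D_iso_zeroP (D_iso_acyclic TP) (D_iso_acyclic T0Q).
  (* [tensor_test] asks for a K-flat second factor, which [N] need not be; its resolution over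
     H^0(A) stays a quasi-isomorphism after restriction to [A]. *)
  have [kF qF] := (@semifree_K_flat _ N, semifree_qi N).
  rewrite -(acyclic_qi (K_flat_qi_r kP (restr_map_qi phi qF))) -(acyclic_qi (K_flat_qi_r kQ qF)).
  rewrite (tensor_test nA kQ kF).
  have -> : acyclic (tensor_dgMod P (restr_scalars phi (semifree N))) <->
      acyclic (tensor_dgMod (ext phi P) (semifree N)).
    by rewrite acyclic_tensorC -acyclic_tensor_ext; exact: acyclic_tensorC.
  rewrite (tensor_test nA (ext_K_flat kP) kF).
  by split=> h p; case: (h p) => ap; [left|right|left|right] => //;
    apply/(ext_resid_test surj nA p kP qf kQ qg).
(* The given [P] and [Q] are only known to be K-projective; semifree resolutions are also K-flat, as
   the comparison of supports requires. *)
have [pS fS] := (@semifree_K_projective _ (forget M), @semifree_K_flat _ (forget M)).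
have qS := semifree_qi (forget M).
have [[pM fM] qM] := (@semifree_K_projective _ M, @semifree_K_flat _ M, semifree_qi M).
have pS' := ext_K_projective (phi := phi) pS; have fS' := ext_K_flat (phi := phi) fS.
have test p := ext_resid_test surj nA p fS qS fM qM.
split=> [aT|aT].
  apply: (acyclic_Hom_indep pM kQ qM qg).
  apply: (Hom_test nA pS' fS' pM fM) => [p|]; first by move=> /test.
  by apply/acyclic_Hom_ext; exact: (acyclic_Hom_indep kP pS qf qS).
apply: (acyclic_Hom_indep pS kP qS qf); apply/acyclic_Hom_ext.
apply: (Hom_test nA pM fM pS' fS') => [p|]; first by move=> ?; apply/test.
exact: (acyclic_Hom_indep kQ pM qg qM).
Qed.
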